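(* Let $\mathcal{H}(T,A,\mu)$ be a Cauchy--de Branges space with $T=\{t_n\}_{n\in\mathbb{N}}$ power separated, $|t_n|\ge 2$ for all $n$, and $A$ of finite order. Then $\mathcal{H}(T,A,\mu)$ has the strong localization property if and only if the (holomorphic) polynomials belong to $L^2(\mu)$ and are dense there.
   Context: Cauchy--de Branges space: let $T=\{t_n\}_{n\in\mathbb{N}}$ be a sequence of distinct complex numbers with $|t_n|\to\infty$, let $\mu=\sum_n\mu_n\delta_{t_n}$ with $\mu_n>0$ and $\sum_n\frac{\mu_n}{|t_n|^2+1}<\infty$, and let $A$ be an entire function with only simple zeros whose zero set is exactly $T$. Then $$\mathcal{H}(T,A,\mu)=\Big\{F:\ F(z)=A(z)\sum_n\frac{a_n\mu_n^{1/2}}{z-t_n},\ \{a_n\}\in\ell^2\Big\},\qquad \|F\|=\|\{a_n\}\|_{\ell^2},$$ which is a Hilbert space of entire functions. $T$ is power separated if there exist $C>0$ and $N>0$ such that $\mathrm{dist}(t_n,\{t_m\}_{m\ne n})\ge C|t_n|^{-N}$ for all $n$. For an entire function $f$, $\mathcal{Z}_f$ denotes the set of all zeros of $f$; $D(z,r)$ is the open disc with center $z$ and radius $r$. Polynomials are polynomials in the complex variable $z$. Strong localization property: $\mathcal{H}(T,A,\mu)$ (with $T$ power separated) has the strong localization property if there exists a sequence of pairwise disjoint discs $\{D(t_n,r_n)\}_n$ with $r_n\to0$ such that for every nonzero $f\in\mathcal{H}(T,A,\mu)$ the set $\mathcal{Z}_f\setminus\bigcup_nD(t_n,r_n)$ is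 finite and each disc $D(t_n,r_n)$, except possibly finitely many $n$ (depending on $f$), contains exactly one point of $\mathcal{Z}_f$. *)

(* Defs.v *)
From Stdlib Require Import Reals List.
From Coquelicot Require Import Coquelicot.
Open Scope R_scope.

(* Complex differentiability: the scalars are [C_AbsRing], not the reals. *)
Definition entire (f : C -> C) : Prop :=
  forall z : C, @ex_derive C_AbsRing C_NormedModule f z.

Definition finite_order (f : C -> C) : Prop :=
  exists rho r0 : R, 0 < rho /\ 0 < r0 /\
    forall z : C, r0 <= Cmod z -> Cmod (f z) <= exp (Rpower (Cmod z) rho).

Definition zeros (f : C -> C) (z : C) : Prop := f z = 0%C.

Definition disc (c : C) (r : R) (z : C) : Prop := Cmod (z - c)%C < r.

Definition finite_set {X : Type} (P : X -> Prop) : Prop :=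
  exists l : list X, forall x : X, P x -> In x l.

Record CdB_data (t : nat -> C) (A : C -> C) (mu : nat -> R) : Prop := {
  CdB_distinct : forall n m : nat, t n = t m -> n = m;
  CdB_infty : is_lim_seq (fun n => Cmod (t n)) p_infty;
  CdB_mu_pos : forall n : nat, 0 < mu n;
  CdB_mu_sum : ex_series (fun n => mu n / ((Cmod (t n)) ^ 2 + 1));
  CdB_entire : entire A;
  CdB_zeros : forall z : C, zeros A z <-> exists n : nat, z = t n;
  CdB_simple : forall n : nat, C_derive A (t n) <> 0%C
}.

(* The elements of H(T,A,mu).  The defining formula has removable
   singularities at the points [t n]; the values there are determined by
   requiring [F] to be entire. *)
Definition CdB_space (t : nat -> C) (A : C -> C) (mu : nat -> R)
    (F : C -> C) : Prop :=
  entire F /\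
  exists a : nat -> C,
    ex_series (fun n => (Cmod (a n)) ^ 2) /\
    forall z : C, (forall n : nat, z <> t n) ->
      exists S : C,
        @is_series C_AbsRing C_NormedModule
          (fun n => (a n * RtoC (sqrt (mu n)) / (z - t n))%C) S /\
        F z = (A z * S)%C.

Definition power_separated (t : nat -> C) : Prop :=
  exists c N : R, 0 < c /\ 0 < N /\
    forall n m : nat, m <> n ->
      c * Rpower (Cmod (t n)) (- N) <= Cmod (t n - t m)%C.

Definition strong_localization (t : nat -> C) (A : C -> C) (mu : nat -> R)
    : Prop :=
  exists r : nat -> R,
    (forall n : nat, 0 < r n) /\
    (forall n m : nat, n <> m ->
       forall z : C, ~ (disc (t n) (r n) z /\ disc (t m) (r m) z)) /\
    is_lim_seq r 0 /\
    forall f : C -> C, CdB_space t A mu f -> (exists z : C, f z <> 0%C) ->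
      finite_set (fun z => zeros f z /\ forall n : nat, ~ disc (t n) (r n) z) /\
      finite_set (fun n => ~ exists! z : C, disc (t n) (r n) z /\ zeros f z).

(* For mu = sum_n mu_n delta_{t_n}, the integral of h is
   sum_n h(t_n) mu_n. Every function is mu-measurable, and functions that
   agree on T are mu-a.e. equal. *)
Definition in_L2 (t : nat -> C) (mu : nat -> R) (g : C -> C) : Prop :=
  ex_series (fun n => (Cmod (g (t n))) ^ 2 * mu n).

Definition L2_norm (t : nat -> C) (mu : nat -> R) (g : C -> C) : R :=
  sqrt (Series (fun n => (Cmod (g (t n))) ^ 2 * mu n)).

Definition polynomial (p : C -> C) : Prop :=
  exists (d : nat) (c : nat -> C), forall z : C,
    p z = @sum_n C_AbelianMonoid (fun k => (c k * Cpow z k)%C) d.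

Definition subset_L2 (t : nat -> C) (mu : nat -> R) (D : (C -> C) -> Prop)
    : Prop :=
  forall p : C -> C, D p -> in_L2 t mu p.

Definition dense_L2 (t : nat -> C) (mu : nat -> R) (D : (C -> C) -> Prop)
    : Prop :=
  forall (g : C -> C) (eps : R), in_L2 t mu g -> 0 < eps ->
    exists p : C -> C, D p /\ in_L2 t mu p /\
      L2_norm t mu (fun z => (g z - p z)%C) < eps.

(* Main.v *)
(** Write an element of the space as [A * CT c], where [CT c z = sum c_n / (z - t_n)] and
    [c_n = a_n mu_n^(1/2)].  Everything is a statement about the zeros of such Cauchy transforms, and
    the basic tool is a partial fraction identity: if [CT c w = 0], then
    [CT c z * (p z + q) / (z - w)] is again a Cauchy transform, with coefficients
    [c_n (p t_n + q) / (t_n - w)].  So a zero can be divided out or moved without any complex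
    analysis; Goursat's theorem enters only to know that [A * CT c] is entire at the points [t_n].

    If polynomials are dense, some moment [sum c_n t_n^K] is nonzero.  For the first such [K],
    [z^(K+1) CT c z] tends to that moment outside discs of radius comparable to [|t_n|^-N], which
    confines the zeros to these discs, and inside a disc the zero is the fixed point of a contraction.

    Conversely, assume strong localization.  If [mu_n >= |t_n|^-M] for infinitely many [n], one starts
    from a finite transform decaying like a high power of [1/z] and keeps multiplying it by factors
    [(1 - z/w') / (1 - z/t_n)], with [t_n] far out and [w'] in a disc that already contains a zero;
    the changes are small, so the limit is an element with two zeros in infinitely many discs.  Hence
    [mu] decays rapidly and polynomials are in [L^2(mu)].  If they were not dense, some nonzero [c]
    would have all moments zero.  After dividing out finitely many zeros, the same construction, now
    moving zeros of [CT c] itself, shows that the zero [z_n] in the [n]-th disc is extremely close to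
    [t_n].  Moving each [z_n] to [t_n] then removes all the poles at the cost of a convergent product,
    so [CT c = 0], a contradiction. *)

Require Import Defs.
From Stdlib Require Import Reals Lra Lia List Classical ClassicalEpsilon FinFun.
From Coquelicot Require Import Coquelicot.
Open Scope R_scope.

(** * Complex differentiability *)

(** The radii in strong localization are chosen before the element, and about [r n] nothing is known
    beyond positivity, disjointness of the discs and [r n -> 0]. New zeros are therefore always
    planted at prescribed points, never located by estimates, and one element with two zeros in
    infinitely many discs refutes any choice of radii. The obstacle is the size of a Moebius factor
    at the other points of [T]: it is close to 1 only at points small compared with both [w] and
    [w']; elsewhere it is at best bounded by a power of [t i], and only while [w] keeps away from
    [t i]. So every construction needs powers of [1 / |t i|] to spare. Finite transforms get them
    from decay at infinity that is built in, transforms with vanishing moments from dividing out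
    zeros, one power for each division. Power separation keeps all losses polynomial: it makes some
    [|t n|^-q] summable, which fixes the scale of the admissible changes, and it bounds the loss
    caused by a nearby pole by a power. A zero at [t n] is just a missing coefficient, so zeros on
    and off [T] are treated alike. *)

Definition ccont (f : C -> C) (z : C) : Prop :=
  forall eps, 0 < eps -> exists delta, 0 < delta /\
    forall w, Cmod (w - z) < delta -> Cmod (f w - f z) < eps.

(** Caratheodory's form of the derivative: [phi] is the difference quotient, extended to [z] by [l].
    Off [z] it is determined by [f], so asking for the factorization at every [w] costs nothing, and
    the differentiation rules reduce to continuity of [phi]. *)
Definition cder (f : C -> C) (z l : C) : Prop :=
  exists phi : C -> C, ccont phi z /\ phi z = l /\
    forall w, f w = (f z + phi w * (w - z))%C.

Lemma Cmod_sub_sym (x y : C) : Cmod (x - y) = Cmod (y - x).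
Proof. rewrite <- Cmod_opp. f_equal. ring. Qed.

Lemma Cmod_triangle_sub (x y : C) : Cmod (x - y) <= Cmod x + Cmod y.
Proof. unfold Cminus. rewrite <- (Cmod_opp y). apply Cmod_triangle. Qed.

Lemma Cmod_triangle_rev (x y : C) : Cmod x - Cmod y <= Cmod (x - y).
Proof.
  assert (H := Cmod_triangle (x - y) y).
  replace (x - y + y)%C with x in H by ring. lra.
Qed.

Lemma Cmod_sub_pos (x y : C) : x <> y -> 0 < Cmod (x - y).
Proof.
  intros H. apply Cmod_gt_0. intros E. apply H.
  replace x with (x - y + y)%C by ring. rewrite E. ring.
Qed.

Lemma Csub_neq0 (x y : C) : x <> y -> (x - y)%C <> 0.
Proof. intros H. apply Cmod_gt_0. now apply Cmod_sub_pos. Qed.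

Lemma Cmod_self_sub (x : C) : Cmod (x - x) = 0.
Proof. replace (x - x)%C with (RtoC 0) by ring. apply Cmod_0. Qed.

Lemma ccont_const (k z : C) : ccont (fun _ => k) z.
Proof.
  intros e He. exists 1. split; [lra|]. intros. rewrite Cmod_self_sub. lra.
Qed.

Lemma ccont_id (z : C) : ccont (fun w => w) z.
Proof. intros e He. exists e. split; [lra|]. auto. Qed.

Lemma ccont_ext_loc (f g : C -> C) (z : C) (d : R) :
  0 < d -> (forall w, Cmod (w - z) < d -> f w = g w) -> ccont f z -> ccont g z.
Proof.
  intros Hd E Hf e He. destruct (Hf e He) as (d1 & Hd1 & H1).
  exists (Rmin d d1). split; [now apply Rmin_pos|]. intros w Hw.
  assert (Hm := Rmin_l d d1). assert (Hm' := Rmin_r d d1).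
  rewrite <- !E; [| rewrite Cmod_self_sub; lra | lra]. apply H1. lra.
Qed.

Lemma ccont_plus (f g : C -> C) (z : C) :
  ccont f z -> ccont g z -> ccont (fun w => f w + g w)%C z.
Proof.
  intros Hf Hg e He.
  destruct (Hf (e / 2) ltac:(lra)) as (d1 & Hd1 & H1).
  destruct (Hg (e / 2) ltac:(lra)) as (d2 & Hd2 & H2).
  exists (Rmin d1 d2). split; [now apply Rmin_pos|]. intros w Hw.
  assert (Hm := Rmin_l d1 d2). assert (Hm' := Rmin_r d1 d2).
  replace (f w + g w - (f z + g z))%C with ((f w - f z) + (g w - g z))%C by ring.
  eapply Rle_lt_trans; [apply Cmod_triangle|].
  specialize (H1 w). specialize (H2 w). lra.
Qed.

Lemma ccont_bounded (f : C -> C) (z : C) :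
  ccont f z -> exists d, 0 < d /\ forall w, Cmod (w - z) < d -> Cmod (f w) <= Cmod (f z) + 1.
Proof.
  intros Hf. destruct (Hf 1 ltac:(lra)) as (d & Hd & H). exists d. split; auto.
  intros w Hw. specialize (H w Hw). assert (K := Cmod_triangle_rev (f w) (f z)). lra.
Qed.

Lemma ccont_mult (f g : C -> C) (z : C) :
  ccont f z -> ccont g z -> ccont (fun w => f w * g w)%C z.
Proof.
  intros Hf Hg e He.
  set (M := Cmod (f z) + 1). set (N := Cmod (g z) + 1).
  assert (HM : 0 < M) by (assert (K := Cmod_ge_0 (f z)); unfold M; lra).
  assert (HN : 0 < N) by (assert (K := Cmod_ge_0 (g z)); unfold N; lra).
  destruct (ccont_bounded f z Hf) as (d0 & Hd0 & H0).
  destruct (Hf (e / 2 / N)) as (d1 & Hd1 & H1).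
  { apply Rdiv_lt_0_compat; lra. }
  destruct (Hg (e / 2 / M)) as (d2 & Hd2 & H2).
  { apply Rdiv_lt_0_compat; lra. }
  exists (Rmin d0 (Rmin d1 d2)). split; [repeat apply Rmin_pos; auto|]. intros w Hw.
  assert (A1 := Rmin_l d0 (Rmin d1 d2)). assert (A2 := Rmin_r d0 (Rmin d1 d2)).
  assert (A3 := Rmin_l d1 d2). assert (A4 := Rmin_r d1 d2).
  replace (f w * g w - f z * g z)%C with (f w * (g w - g z) + (f w - f z) * g z)%C by ring.
  eapply Rle_lt_trans; [apply Cmod_triangle|]. rewrite !Cmod_mult.
  specialize (H0 w ltac:(lra)). specialize (H1 w ltac:(lra)). specialize (H2 w ltac:(lra)).
  fold M in H0.
  assert (B1 : Cmod (f w) * Cmod (g w - g z) <= M * (e / 2 / M)).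
  { apply Rmult_le_compat; try apply Cmod_ge_0; lra. }
  assert (B2 : Cmod (f w - f z) * Cmod (g z) < e / 2 / N * N).
  { apply Rle_lt_trans with (e / 2 / N * Cmod (g z)).
    - apply Rmult_le_compat_r; [apply Cmod_ge_0|lra].
    - apply Rmult_lt_compat_l; [apply Rdiv_lt_0_compat; lra|]. unfold N. lra. }
  replace (M * (e / 2 / M)) with (e / 2) in B1 by (field; lra).
  replace (e / 2 / N * N) with (e / 2) in B2 by (field; lra). lra.
Qed.

Lemma ccont_inv (f : C -> C) (z : C) :
  f z <> 0%C -> ccont f z -> ccont (fun w => / f w)%C z.
Proof.
  intros Hz Hf e He. set (m := Cmod (f z)).
  assert (Hm : 0 < m) by now apply Cmod_gt_0.
  destruct (Hf (m / 2) ltac:(lra)) as (d0 & Hd0 & H0).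
  destruct (Hf (e * (m * m / 2))) as (d1 & Hd1 & H1).
  { assert (0 < m * m) by (apply Rmult_lt_0_compat; lra). apply Rmult_lt_0_compat; lra. }
  exists (Rmin d0 d1). split; [now apply Rmin_pos|]. intros w Hw.
  assert (A1 := Rmin_l d0 d1). assert (A2 := Rmin_r d0 d1).
  specialize (H0 w ltac:(lra)). specialize (H1 w ltac:(lra)).
  assert (Hw2 : m / 2 < Cmod (f w)).
  { assert (K := Cmod_triangle_rev (f z) (f w)). rewrite Cmod_sub_sym in K. unfold m in *. lra. }
  assert (Hw0 : f w <> 0%C) by (apply Cmod_gt_0; lra).
  replace (/ f w - / f z)%C with ((f z - f w) / (f w * f z))%C by (field; auto).
  rewrite Cmod_div by now apply Cmult_neq_0.
  rewrite Cmod_mult, Cmod_sub_sym. fold m.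
  apply Rmult_lt_reg_r with (Cmod (f w) * m); [apply Rmult_lt_0_compat; lra|].
  unfold Rdiv. rewrite Rmult_assoc, Rinv_l by (apply Rgt_not_eq, Rmult_lt_0_compat; lra).
  rewrite Rmult_1_r. eapply Rlt_le_trans; [apply H1|].
  apply Rmult_le_compat_l; [lra|]. 
  replace (m * m / 2) with (m / 2 * m) by field. apply Rmult_le_compat_r; lra.
Qed.

Lemma is_derive_cder (f : C -> C) (z l : C) :
  @is_derive C_AbsRing C_NormedModule f z l <-> cder f z l.
Proof.
  split.
  - intros [_ H].
    assert (H' := H z (fun P HP => HP)). clear H.
    exists (fun w => if excluded_middle_informative (w = z) then l
                     else ((f w - f z) / (w - z))%C).
    split; [|split].
    + intros e He. destruct (H' (mkposreal (e / 2) ltac:(lra))) as [d Hd].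
      exists d. split; [apply cond_pos|]. intros w Hw.
      destruct (excluded_middle_informative (z = z)) as [_|?]; [|easy].
      destruct (excluded_middle_informative (w = z)) as [E|E].
      { rewrite Cmod_self_sub. lra. }
      specialize (Hd w Hw). simpl in Hd.
      change (Cmod (f w - f z - (w - z) * l) <= e / 2 * Cmod (w - z)) in Hd.
      assert (Hp := Cmod_sub_pos _ _ E).
      replace ((f w - f z) / (w - z) - l)%C with ((f w - f z - (w - z) * l) / (w - z))%C
        by (field; now apply Csub_neq0).
      rewrite Cmod_div by now apply Csub_neq0.
      apply Rmult_lt_reg_r with (Cmod (w - z)); [lra|].
      unfold Rdiv. rewrite Rmult_assoc, Rinv_l, Rmult_1_r by lra.
      eapply Rle_lt_trans; [apply Hd|]. apply Rmult_lt_compat_r; lra.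
    + destruct (excluded_middle_informative (z = z)); easy.
    + intros w. destruct (excluded_middle_informative (w = z)) as [->|E]; [ring|].
      field. now apply Csub_neq0.
  - intros (phi & Hc & Hl & Hf). split.
    + apply (is_linear_scal_l (K := C_AbsRing) (V := C_NormedModule) l).
    + intros x Hx.
      assert (E : z = x).
      { apply (is_filter_lim_locally_unique (K := C_AbsRing) (V := AbsRing_NormedModule C_AbsRing)).
        exact Hx. }
      subst x. intros e.
      destruct (Hc e (cond_pos e)) as (d & Hd & H). exists (mkposreal d Hd).
      intros w Hw. specialize (H w Hw).
      change (Cmod (f w - f z - (w - z) * l) <= e * Cmod (w - z)).
      rewrite (Hf w). replace (f z + phi w * (w - z) - f z - (w - z) * l)%C
        with ((phi w - phi z) * (w - z))%C by (rewrite Hl; ring).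
      rewrite Cmod_mult. apply Rmult_le_compat_r; [apply Cmod_ge_0|lra].
Qed.

Lemma ex_derive_cder (f : C -> C) (z : C) :
  @ex_derive C_AbsRing C_NormedModule f z <-> exists l, cder f z l.
Proof. split; intros [l H]; exists l; now apply is_derive_cder. Qed.

Lemma cder_ccont (f : C -> C) (z l : C) : cder f z l -> ccont f z.
Proof.
  intros (phi & Hc & Hl & Hf).
  apply (ccont_ext_loc (fun w => f z + phi w * (w - z))%C f z 1); [lra| |].
  { intros w _. now rewrite <- Hf. }
  apply ccont_plus; [apply ccont_const|]. apply ccont_mult; auto.
  apply ccont_plus; [apply ccont_id|apply ccont_const].
Qed.

Lemma cder_const (k z : C) : cder (fun _ => k) z 0.
Proof.
  exists (fun _ => RtoC 0). split; [apply ccont_const|]. split; auto. intros; ring.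
Qed.

Lemma cder_id (z : C) : cder (fun w => w) z 1.
Proof.
  exists (fun _ => RtoC 1). split; [apply ccont_const|]. split; auto. intros; ring.
Qed.

Lemma cder_plus (f g : C -> C) (z l m : C) :
  cder f z l -> cder g z m -> cder (fun w => f w + g w)%C z (l + m).
Proof.
  intros (p & Hp & El & Hf) (q & Hq & Em & Hg).
  exists (fun w => p w + q w)%C. split; [now apply ccont_plus|]. split; [congruence|].
  intros w. rewrite Hf, Hg. ring.
Qed.

Lemma cder_mult (f g : C -> C) (z l m : C) :
  cder f z l -> cder g z m -> cder (fun w => f w * g w)%C z (l * g z + f z * m).
Proof.
  intros Hf0 (q & Hq & Em & Hg). assert (Cf := cder_ccont _ _ _ Hf0).
  destruct Hf0 as (p & Hp & El & Hf).
  exists (fun w => p w * g z + f w * q w)%C. split; [|split].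
  - apply ccont_plus; apply ccont_mult; auto. apply ccont_const.
  - subst. ring.
  - intros w. rewrite (Hg w), (Hf w). ring.
Qed.

Lemma cder_inv (f : C -> C) (z l : C) :
  f z <> 0%C -> cder f z l -> exists m, cder (fun w => / f w)%C z m.
Proof.
  intros Hz Hf0. assert (Cf := cder_ccont _ _ _ Hf0).
  destruct Hf0 as (p & Hp & El & Hf).
  assert (Ci : ccont (fun w => / f w)%C z) by now apply ccont_inv.
  exists (- p z * / f z * / f z)%C. 
  (* Away from [z] the function may vanish, and there the closed form of the slope fails; the plain
     difference quotient takes its place. Near [z] this branch is never reached. *)
  exists (fun w => if excluded_middle_informative (f w = 0) then (/ f w - / f z) / (w - z)
     else - p w * / f w * / f z)%C.
  split; [|split].
  - destruct (Cf (Cmod (f z)) (proj1 (Cmod_gt_0 _) Hz)) as (d & Hd & H).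
    apply (ccont_ext_loc (fun w => (- (1)) * p w * / f w * / f z)%C _ z d); auto.
    + intros w Hw. destruct (excluded_middle_informative (f w = 0)) as [E|E]; [|ring].
      specialize (H w Hw). rewrite E, Cmod_sub_sym in H.
      replace (f z - 0)%C with (f z) in H by ring. lra.
    + repeat apply ccont_mult; auto; apply ccont_const.
  - destruct (excluded_middle_informative (f z = 0)); easy.
  - intros w. destruct (excluded_middle_informative (f w = 0)) as [E|E].
    + assert (Hwz : w <> z) by congruence. generalize (/ f w)%C as X, (/ f z)%C as Y. intros.
      field. now apply Csub_neq0.
    + assert (E2 : (p w * (w - z) = f w - f z)%C) by (rewrite (Hf w) at 1; ring).
      replace (- p w * / f w * / f z * (w - z))%C with (- (p w * (w - z)) * / f w * / f z)%C by ring.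
      rewrite E2. field. auto.
Qed.

Lemma cder_ext_loc (f g : C -> C) (z l : C) (d : R) :
  0 < d -> (forall w, Cmod (w - z) < d -> f w = g w) -> cder f z l -> cder g z l.
Proof.
  intros Hd E (p & Hp & El & Hf).
  exists (fun w => if excluded_middle_informative (Cmod (w - z) < d) then p w
     else (g w - g z) / (w - z))%C.
  assert (Ez : f z = g z) by (apply E; rewrite Cmod_self_sub; lra).
  split; [|split].
  - apply (ccont_ext_loc p _ z d); auto.
    intros w Hw. destruct (excluded_middle_informative (Cmod (w - z) < d)); easy.
  - destruct (excluded_middle_informative (Cmod (z - z) < d)) as [_|N]; auto.
    rewrite Cmod_self_sub in N. lra.
  - intros w. destruct (excluded_middle_informative (Cmod (w - z) < d)) as [L|L].
    + rewrite <- E, <- Ez; auto.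
    + field. apply Csub_neq0. intros ->. rewrite Cmod_self_sub in L. lra.
Qed.

(** * Integration along segments *)

Notation CRInt := (RInt (V := C_R_CompleteNormedModule)).

Definition Jseg (f : C -> C) (a b : C) : C :=
  ((b - a) * CRInt (fun s : R => f (a + s * (b - a))%C) 0 1)%C.

Definition seg_cont (f : C -> C) (a b : C) : Prop :=
  forall s : R, 0 <= s <= 1 -> ccont f (a + s * (b - a))%C.

Lemma ccont_seg_continuous (f : C -> C) (a b : C) (s : R) :
  ccont f (a + s * (b - a))%C ->
  continuous (U := C_R_CompleteNormedModule) (fun s : R => f (a + s * (b - a))%C) s.
Proof.
  intros H.
  apply (filterlim_locally (fun s : R => f (a + s * (b - a))%C)).
  intros e. destruct (H e (cond_pos e)) as (d & Hd & Hf).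
  assert (K : 0 < d / (Cmod (b - a) + 1)).
  { apply Rdiv_lt_0_compat; auto. assert (Q := Cmod_ge_0 (b - a)). lra. }
  exists (mkposreal _ K). intros y Hy. 
  assert (Hb : Rabs (y - s) < d / (Cmod (b - a) + 1)) by exact Hy.
  apply C_NormedModule_mixin_compat1. apply Hf.
  replace (a + y * (b - a) - (a + s * (b - a)))%C with ((y - s)%R * (b - a))%C
    by (rewrite RtoC_minus; ring).
  rewrite Cmod_mult, Cmod_R.
  assert (Q := Cmod_ge_0 (b - a)).
  apply Rle_lt_trans with (Rabs (y - s) * (Cmod (b - a) + 1)).
  { apply Rmult_le_compat_l; [apply Rabs_pos|lra]. }
  apply Rlt_le_trans with (d / (Cmod (b - a) + 1) * (Cmod (b - a) + 1)).
  { apply Rmult_lt_compat_r; lra. }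
  right. field. lra.
Qed.

Lemma seg_cont_ex_RInt (f : C -> C) (a b : C) (u v : R) :
  seg_cont f a b -> 0 <= u <= 1 -> 0 <= v <= 1 ->
  ex_RInt (V := C_R_CompleteNormedModule) (fun s : R => f (a + s * (b - a))%C) u v.
Proof.
  intros H Hu Hv. apply ex_RInt_continuous. intros s Hs.
  apply ccont_seg_continuous. apply H.
  unfold Rmin, Rmax in Hs. destruct (Rle_dec u v); lra.
Qed.

Lemma Jseg_ext (f g : C -> C) (a b : C) :
  (forall s : R, 0 <= s <= 1 -> f (a + s * (b - a))%C = g (a + s * (b - a))%C) ->
  Jseg f a b = Jseg g a b.
Proof.
  intros H. unfold Jseg. f_equal. apply (RInt_ext (V := C_R_CompleteNormedModule)). intros s Hs.
  rewrite Rmin_left, Rmax_right in Hs by lra. apply H. lra.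
Qed.

Lemma Jseg_plus (f g : C -> C) (a b : C) :
  seg_cont f a b -> seg_cont g a b ->
  Jseg (fun w => f w + g w)%C a b = (Jseg f a b + Jseg g a b)%C.
Proof.
  intros Hf Hg. unfold Jseg.
  rewrite <- Cmult_plus_distr_l. f_equal.
  apply (RInt_plus (V := C_R_CompleteNormedModule)); apply seg_cont_ex_RInt; auto; lra.
Qed.

Lemma Jseg_bound (f : C -> C) (a b : C) (M : R) :
  seg_cont f a b ->
  (forall s : R, 0 <= s <= 1 -> Cmod (f (a + s * (b - a))%C) <= M) ->
  Cmod (Jseg f a b) <= Cmod (b - a) * M.
Proof.
  intros Hc H. unfold Jseg. rewrite Cmod_mult.
  apply Rmult_le_compat_l; [apply Cmod_ge_0|].
  rewrite Cmod_norm.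
  apply (norm_RInt_le (V := C_R_NormedModule)
    (fun s : R => f (a + s * (b - a))%C) (fun _ => M) 0 1
    (CRInt (fun s : R => f (a + s * (b - a))%C) 0 1) M); [lra| | |].
  - intros s Hs. specialize (H s Hs). rewrite Cmod_norm in H. exact H.
  - apply (RInt_correct (V := C_R_CompleteNormedModule)). apply seg_cont_ex_RInt; auto; lra.
  - assert (K := is_RInt_const 0 1 M). unfold scal in K. simpl in K. unfold mult in K. simpl in K.
    replace ((1 - 0) * M) with M in K by ring. exact K.
Qed.

(** The integral lives in a real normed module and is only real-linear by construction; a complex
    scalar is handled through real and imaginary parts. *)
Lemma C_RInt_mult_l (k : C) (f : R -> C) (u v : R) :
  ex_RInt (V := C_R_CompleteNormedModule) f u v ->
  CRInt (fun s => k * f s)%C u v =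
  (k * CRInt f u v)%C.
Proof.
  intros H. apply is_RInt_unique.
  assert (K := RInt_correct (V := C_R_CompleteNormedModule) _ _ _ H).
  set (l := CRInt f u v) in *.
  assert (K1 := is_RInt_fct_extend_fst (U := R_NormedModule) (V := R_NormedModule) _ _ _ _ K).
  assert (K2 := is_RInt_fct_extend_snd (U := R_NormedModule) (V := R_NormedModule) _ _ _ _ K).
  apply (is_RInt_fct_extend_pair (U := R_NormedModule) (V := R_NormedModule)); simpl.
  - exact (is_RInt_minus _ _ _ _ _ _ (is_RInt_scal _ _ _ (fst k) _ K1) (is_RInt_scal _ _ _ (snd k) _ K2)).
  - exact (is_RInt_plus _ _ _ _ _ _ (is_RInt_scal _ _ _ (fst k) _ K2) (is_RInt_scal _ _ _ (snd k) _ K1)).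
Qed.

Lemma Jseg_scal (k : C) (f : C -> C) (a b : C) :
  seg_cont f a b -> Jseg (fun w => k * f w)%C a b = (k * Jseg f a b)%C.
Proof.
  intros H. unfold Jseg.
  rewrite (C_RInt_mult_l k (fun s : R => f (a + s * (b - a))%C)); [ring|].
  apply seg_cont_ex_RInt; auto; lra.
Qed.

Lemma C_RInt_comp_lin (f : R -> C) (u v x y : R) :
  ex_RInt (V := C_R_CompleteNormedModule) f (u * x + v) (u * y + v) ->
  (u * CRInt (fun s => f (u * s + v)%R) x y)%C =
  CRInt f (u * x + v) (u * y + v).
Proof.
  intros H. rewrite <- (RInt_comp_lin (V := C_R_CompleteNormedModule) f u v x y H).
  destruct (Req_dec u 0) as [->|Hu].
  - rewrite (RInt_ext (V := C_R_CompleteNormedModule) (fun y0 : R => scal 0 (f (0 * y0 + v))) (fun _ => RtoC 0)).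
    2:{ intros s _. rewrite scal_R_Cmult. apply Cmult_0_l. }
    rewrite (RInt_const (V := C_R_CompleteNormedModule)). rewrite scal_R_Cmult. ring.
  - rewrite <- C_RInt_mult_l. 
    + apply (RInt_ext (V := C_R_CompleteNormedModule)). intros s _. symmetry. apply scal_R_Cmult.
    + assert (K := ex_RInt_comp_lin (V := C_R_NormedModule) f u v x y H).
      apply (ex_RInt_scal (V := C_R_NormedModule) _ _ _ (/ u)) in K.
      eapply ex_RInt_ext; [|apply K]. intros s _. simpl.
      rewrite (scal_assoc (V := C_R_NormedModule)). unfold mult; simpl.
      rewrite Rinv_l by auto. apply (scal_one (V := C_R_NormedModule)).
Qed.

Lemma Jseg_split (f : C -> C) (a b : C) (u : R) :
  seg_cont f a b -> 0 <= u <= 1 ->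
  Jseg f a b = (Jseg f a (a + u * (b - a)) + Jseg f (a + u * (b - a)) b)%C.
Proof.
  intros H Hu. unfold Jseg.
  set (F := fun s : R => f (a + s * (b - a))%C).
  assert (E1 : CRInt F 0 u =
    (u * CRInt (fun s : R => f (a + s * (a + u * (b - a) - a))%C) 0 1)%C).
  { assert (K := C_RInt_comp_lin F u 0 0 1).
    replace (u * 0 + 0) with 0 in K by ring. replace (u * 1 + 0) with u in K by ring.
    rewrite <- K. 2:{ apply seg_cont_ex_RInt; auto; lra. }
    f_equal. apply (RInt_ext (V := C_R_CompleteNormedModule)). intros s _. unfold F. f_equal.
    rewrite RtoC_plus, RtoC_mult. ring. }
  assert (E2 : CRInt F u 1 =
    ((1 - u) * CRInt
      (fun s : R => f (a + u * (b - a) + s * (b - (a + u * (b - a))))%C) 0 1)%C).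
  { assert (K := C_RInt_comp_lin F (1 - u) u 0 1).
    replace ((1 - u) * 0 + u) with u in K by ring. replace ((1 - u) * 1 + u) with 1 in K by ring.
    rewrite <- K. 2:{ apply seg_cont_ex_RInt; auto; lra. }
    rewrite RtoC_minus.
    f_equal. apply (RInt_ext (V := C_R_CompleteNormedModule)). intros s _. unfold F. f_equal.
    rewrite RtoC_plus, RtoC_mult, RtoC_minus. ring. }
  assert (E := RInt_Chasles (V := C_R_CompleteNormedModule) F 0 u 1).
  rewrite <- E. 2,3: apply seg_cont_ex_RInt; auto; lra.
  change (plus ?x ?y) with (x + y)%C. rewrite E1, E2. ring.
Qed.

Lemma Jseg_swap (f : C -> C) (a b : C) :
  seg_cont f a b -> Jseg f b a = (- Jseg f a b)%C.
Proof.
  intros H. unfold Jseg.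
  set (F := fun s : R => f (a + s * (b - a))%C).
  assert (Em : RtoC (-1) = (- (1))%C) by (apply injective_projections; simpl; ring).
  assert (K := C_RInt_comp_lin F (-1) 1 0 1).
  replace (-1 * 0 + 1) with 1 in K by ring. replace (-1 * 1 + 1) with 0 in K by ring.
  rewrite <- (opp_RInt_swap (V := C_R_CompleteNormedModule) F 0 1) in K
    by (apply seg_cont_ex_RInt; auto; lra).
  change (opp ?x) with (- x)%C in K.
  replace (CRInt (fun s : R => f (b + s * (a - b))%C) 0 1)
    with (CRInt (fun s : R => F (-1 * s + 1)) 0 1).
  - assert (K' := K ltac:(apply seg_cont_ex_RInt; auto; lra)). clear K.
    replace (CRInt F 0 1) with
      (RtoC (-1) * - CRInt F 0 1)%C.
    + rewrite <- K', Em. ring.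
    + rewrite Em. ring.
  - apply (RInt_ext (V := C_R_CompleteNormedModule)). intros s _. unfold F. f_equal.
    rewrite RtoC_plus, RtoC_mult, Em. ring.
Qed.

(** * Goursat on triangles *)

Lemma Cmult_cancel_l (k x y : C) : k <> 0%C -> (k * x = k * y)%C -> x = y.
Proof.
  intros Hk E. replace x with (/ k * (k * x))%C by (field; auto). rewrite E. field. auto.
Qed.

Lemma half_pow_small (M eps : R) : 0 < eps -> exists k : nat, M * (/ 2) ^ k < eps.
Proof.
  intros He. destruct (Rle_dec M 0) as [HM|HM].
  { exists O. simpl. lra. }
  destruct (pow_lt_1_zero (/ 2) ltac:(rewrite Rabs_pos_eq; lra) (eps / M)
    ltac:(apply Rdiv_lt_0_compat; lra)) as [k Hk].
  exists k. specialize (Hk k (le_n k)). rewrite Rabs_pos_eq in Hk by (apply pow_le; lra).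
  apply Rmult_lt_compat_l with (r := M) in Hk; [|lra].
  replace (M * (eps / M)) with eps in Hk by (field; lra). exact Hk.
Qed.

Lemma geom_increments (x : nat -> C) (M : R) :
  (forall k, Cmod (x (S k) - x k) <= M * (/ 2) ^ k) ->
  forall k m, Cmod (x (k + m)%nat - x k) <= 2 * M * (/ 2) ^ k.
Proof.
  intros H k m.
  assert (HM : 0 <= M) by (specialize (H O); assert (K := Cmod_ge_0 (x 1%nat - x 0%nat)); simpl in H; lra).
  assert (Hk : 0 < (/ 2) ^ k) by (apply pow_lt; lra).
  cut (Cmod (x (k + m)%nat - x k) <= 2 * M * ((/ 2) ^ k - (/ 2) ^ (k + m))).
  { intros L. assert (0 < (/ 2) ^ (k + m)) by (apply pow_lt; lra). nra. }
  induction m as [|m IH].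
  - rewrite Nat.add_0_r, Cmod_self_sub. lra.
  - rewrite Nat.add_succ_r. specialize (H (k + m)%nat).
    replace (x (S (k + m)) - x k)%C with ((x (S (k + m)) - x (k + m)%nat) + (x (k + m)%nat - x k))%C by ring.
    eapply Rle_trans; [apply Cmod_triangle|]. simpl pow. lra.
Qed.

(** Completeness of the plane with an explicit rate, read off the two coordinates. The same rate
    serves the shrinking triangles, the contraction and the limits of coefficient sequences. *)
Lemma geom_limit (x : nat -> C) (M : R) :
  (forall k, Cmod (x (S k) - x k) <= M * (/ 2) ^ k) ->
  exists l, forall k, Cmod (x k - l) <= 2 * M * (/ 2) ^ k.
Proof.
  intros H. assert (G := geom_increments x M H).
  assert (Cau : forall g : C -> R, (forall u v, Rabs (g u - g v) <= Cmod (u - v)) ->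
     exists l, is_lim_seq (fun k => g (x k)) (Finite l)).
  { intros g Hg. apply ex_lim_seq_cauchy_corr. intros e.
    destruct (half_pow_small (4 * M) e (cond_pos e)) as [k Hk]. exists k.
    intros n m Hn Hm. eapply Rle_lt_trans; [apply Hg|].
    replace (x n - x m)%C with ((x n - x k) - (x m - x k))%C by ring.
    eapply Rle_lt_trans; [apply Cmod_triangle_sub|].
    assert (G1 := G k (n - k)%nat). assert (G2 := G k (m - k)%nat).
    replace (k + (n - k))%nat with n in G1 by lia. replace (k + (m - k))%nat with m in G2 by lia.
    lra. }
  destruct (Cau Re) as [l1 H1].
  { intros u v. eapply Rle_trans; [|apply re_le_Cmod]. right. f_equal. }
  destruct (Cau Im) as [l2 H2].
  { intros u v. eapply Rle_trans; [|apply Rmax_Cmod].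
    eapply Rle_trans; [|apply Rmax_r]. right. f_equal. }
  exists (l1, l2). intros k.
  apply le_epsilon. intros e He.
  apply is_lim_seq_spec in H1. apply is_lim_seq_spec in H2.
  destruct (H1 (mkposreal (e / 2) ltac:(lra))) as [n1 N1].
  destruct (H2 (mkposreal (e / 2) ltac:(lra))) as [n2 N2].
  simpl in N1, N2. set (n := (k + (n1 + n2))%nat).
  specialize (N1 n ltac:(unfold n; lia)). specialize (N2 n ltac:(unfold n; lia)).
  replace (x k - (l1, l2))%C with (- (x n - x k) + (x n - (l1, l2)))%C by ring.
  eapply Rle_trans; [apply Cmod_triangle|]. rewrite Cmod_opp.
  apply Rplus_le_compat; [apply G|].
  replace (x n - (l1, l2))%C with (RtoC (Re (x n) - l1) + Ci * RtoC (Im (x n) - l2))%C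
    by (apply injective_projections; unfold Re, Im; simpl; ring).
  eapply Rle_trans; [apply Cmod_triangle|]. rewrite Cmod_mult, Cmod_Ci, !Cmod_R. lra.
Qed.

Definition Tri (f : C -> C) (T : C * C * C) : C :=
  match T with (a, b, c) => (Jseg f a b + Jseg f b c + Jseg f c a)%C end.

Definition cmid (a b : C) : C := (a + RtoC (/ 2) * (b - a))%C.

Definition sub1 (T : C * C * C) := match T with (a, b, c) => (a, cmid a b, cmid c a) end.
Definition sub2 (T : C * C * C) := match T with (a, b, c) => (cmid a b, b, cmid b c) end.
Definition sub3 (T : C * C * C) := match T with (a, b, c) => (cmid c a, cmid b c, c) end.
Definition sub4 (T : C * C * C) := match T with (a, b, c) => (cmid a b, cmid b c, cmid c a) end.

Definition tsize (T : C * C * C) : R :=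
  match T with (a, b, c) => Cmod (b - a) + Cmod (c - b) + Cmod (a - c) end.

(** Half-planes are the closed convex sets on which Goursat's theorem is proved, because later a
    vertex is cut off a triangle by a line and the remaining pieces lie in a half-plane that misses
    it. *)
Definition halfplane (p q h : R) (z : C) : Prop := h <= p * fst z + q * snd z.

Definition tri_in (K : C -> Prop) (T : C * C * C) : Prop :=
  match T with (a, b, c) => K a /\ K b /\ K c end.

Lemma RtoC_half : (RtoC (/ 2) + RtoC (/ 2))%C = RtoC 1.
Proof. rewrite <- RtoC_plus. f_equal. lra. Qed.

Lemma halfplane_seg (p q h s : R) (a b : C) :
  halfplane p q h a -> halfplane p q h b -> 0 <= s <= 1 ->
  halfplane p q h (a + s * (b - a))%C.
Proof.
  unfold halfplane. intros Ha Hb Hs. simpl.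
  replace (p * (fst a + (s * (fst b + - fst a) - 0 * (snd b + - snd a))) +
   q * (snd a + (s * (snd b + - snd a) + 0 * (fst b + - fst a))))
   with ((1 - s) * (p * fst a + q * snd a) + s * (p * fst b + q * snd b)) by ring.
  nra.
Qed.

Lemma halfplane_closed (p q h : R) (x : nat -> C) (l : C) (M : R) :
  (forall k, halfplane p q h (x k)) -> (forall k, Cmod (x k - l) <= M * (/ 2) ^ k) ->
  halfplane p q h l.
Proof.
  intros Hx Hl. unfold halfplane in *. apply le_epsilon. intros e He.
  destruct (half_pow_small ((Rabs p + Rabs q) * M) e He) as [k Hk].
  specialize (Hx k). specialize (Hl k).
  set (d := (x k - l)%C) in *.
  assert (R1 : Rabs (fst d) <= Cmod d)
    by (eapply Rle_trans; [|apply Rmax_Cmod]; apply Rmax_l).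
  assert (R2 : Rabs (snd d) <= Cmod d)
    by (eapply Rle_trans; [|apply Rmax_Cmod]; apply Rmax_r).
  assert (E : p * fst (x k) + q * snd (x k) = p * fst l + q * snd l + (p * fst d + q * snd d)).
  { unfold d. simpl. ring. }
  assert (A1 := Rle_abs (p * fst d)). assert (A2 := Rle_abs (q * snd d)).
  rewrite Rabs_mult in A1, A2.
  assert (P1 := Rabs_pos p). assert (P2 := Rabs_pos q). nra.
Qed.

Section Goursat.

Variables (f : C -> C) (p q h : R).
Hypothesis f_der : forall z, halfplane p q h z -> exists l, cder f z l.

Lemma halfplane_seg_cont (a b : C) :
  halfplane p q h a -> halfplane p q h b -> seg_cont f a b.
Proof.
  intros Ha Hb s Hs. destruct (f_der _ (halfplane_seg p q h s a b Ha Hb Hs)) as [l Hl].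
  eapply cder_ccont. apply Hl.
Qed.

Lemma halfplane_mid (a b : C) :
  halfplane p q h a -> halfplane p q h b -> halfplane p q h (cmid a b).
Proof. intros Ha Hb. apply halfplane_seg; auto; lra. Qed.

Lemma Tri_subdivide (T : C * C * C) : tri_in (halfplane p q h) T ->
  Tri f T = (Tri f (sub1 T) + Tri f (sub2 T) + Tri f (sub3 T) + Tri f (sub4 T))%C.
Proof.
  destruct T as [[a b] c]. intros (Ha & Hb & Hc). simpl.
  assert (H2 : 0 <= / 2 <= 1) by lra.
  assert (Mab := halfplane_mid a b Ha Hb). assert (Mbc := halfplane_mid b c Hb Hc).
  assert (Mca := halfplane_mid c a Hc Ha).
  rewrite (Jseg_split f a b (/ 2)), (Jseg_split f b c (/ 2)), (Jseg_split f c a (/ 2));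
    auto using halfplane_seg_cont.
  fold (cmid a b) (cmid b c) (cmid c a).
  rewrite (Jseg_swap f (cmid a b) (cmid b c)), (Jseg_swap f (cmid b c) (cmid c a)),
    (Jseg_swap f (cmid c a) (cmid a b)); auto using halfplane_seg_cont.
  ring.
Qed.

Definition tnext (T : C * C * C) : C * C * C :=
  if Rle_dec (Cmod (Tri f T) / 4) (Cmod (Tri f (sub1 T))) then sub1 T
  else if Rle_dec (Cmod (Tri f T) / 4) (Cmod (Tri f (sub2 T))) then sub2 T
  else if Rle_dec (Cmod (Tri f T) / 4) (Cmod (Tri f (sub3 T))) then sub3 T
  else sub4 T.

Lemma tnext_cases (T : C * C * C) :
  tnext T = sub1 T \/ tnext T = sub2 T \/ tnext T = sub3 T \/ tnext T = sub4 T.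
Proof. unfold tnext. repeat destruct Rle_dec; auto. Qed.

(** If the first three subtriangles all carry less than a quarter of the integral, the triangle
    inequality leaves at least a quarter for the fourth; hence [sub4] as the default in [tnext]. *)
Lemma tnext_large (T : C * C * C) : tri_in (halfplane p q h) T ->
  Cmod (Tri f T) / 4 <= Cmod (Tri f (tnext T)).
Proof.
  intros HT. unfold tnext. repeat destruct Rle_dec; auto.
  assert (E := f_equal Cmod (Tri_subdivide T HT)).
  assert (E1 := Cmod_triangle (Tri f (sub1 T) + Tri f (sub2 T) + Tri f (sub3 T)) (Tri f (sub4 T))).
  assert (E2 := Cmod_triangle (Tri f (sub1 T) + Tri f (sub2 T)) (Tri f (sub3 T))).
  assert (E3 := Cmod_triangle (Tri f (sub1 T)) (Tri f (sub2 T))).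
  lra.
Qed.

Lemma tnext_in (T : C * C * C) : tri_in (halfplane p q h) T ->
  tri_in (halfplane p q h) (tnext T).
Proof.
  destruct T as [[a b] c]. intros (Ha & Hb & Hc).
  destruct (tnext_cases (a, b, c)) as [E|[E|[E|E]]]; rewrite E; simpl;
    auto using halfplane_mid.
Qed.

Lemma tnext_size (T : C * C * C) : tsize (tnext T) = tsize T * / 2.
Proof.
  destruct T as [[a b] c]. destruct (tnext_cases (a, b, c)) as [E|[E|[E|E]]]; rewrite E; clear E; simpl;
  unfold cmid.
  - replace (a + RtoC (/ 2) * (b - a) - a)%C with (RtoC (/ 2) * (b - a))%C by ring.
    replace (a - (c + RtoC (/ 2) * (a - c)))%C with ((1 - RtoC (/ 2)) * (a - c))%C by ring.
    replace (c + RtoC (/ 2) * (a - c) - (a + RtoC (/ 2) * (b - a)))%C with (- RtoC (/ 2) * (b - c) + (1 - RtoC (/ 2) - RtoC (/2)) * (c - a))%C by ring.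
    rewrite <- RtoC_half. replace (RtoC (/ 2) + RtoC (/ 2) - RtoC (/ 2))%C with (RtoC (/ 2)) by ring.
    replace (- RtoC (/ 2) * (b - c) + (RtoC (/ 2) - RtoC (/ 2)) * (c - a))%C with (RtoC (/ 2) * (c - b))%C by ring.
    rewrite !Cmod_mult, Cmod_R, Rabs_pos_eq by lra. ring.
  - replace (b - (a + RtoC (/ 2) * (b - a)))%C with ((1 - RtoC (/ 2)) * (b - a))%C by ring.
    replace (b + RtoC (/ 2) * (c - b) - b)%C with (RtoC (/ 2) * (c - b))%C by ring.
    replace (a + RtoC (/ 2) * (b - a) - (b + RtoC (/ 2) * (c - b)))%C with (RtoC (/ 2) * (a - c) + (1 - RtoC (/ 2) - RtoC (/2)) * (a - b))%C by ring.
    rewrite <- RtoC_half. replace (RtoC (/ 2) + RtoC (/ 2) - RtoC (/ 2))%C with (RtoC (/ 2)) by ring.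
    replace (RtoC (/ 2) * (a - c) + (RtoC (/ 2) - RtoC (/ 2)) * (a - b))%C with (RtoC (/ 2) * (a - c))%C by ring.
    rewrite !Cmod_mult, Cmod_R, Rabs_pos_eq by lra. ring.
  - replace (c - (b + RtoC (/ 2) * (c - b)))%C with ((1 - RtoC (/ 2)) * (c - b))%C by ring.
    replace (c + RtoC (/ 2) * (a - c) - c)%C with (RtoC (/ 2) * (a - c))%C by ring.
    replace (b + RtoC (/ 2) * (c - b) - (c + RtoC (/ 2) * (a - c)))%C with (RtoC (/ 2) * (b - a) + (1 - RtoC (/ 2) - RtoC (/2)) * (b - c))%C by ring.
    rewrite <- RtoC_half. replace (RtoC (/ 2) + RtoC (/ 2) - RtoC (/ 2))%C with (RtoC (/ 2)) by ring.
    replace (RtoC (/ 2) * (b - a) + (RtoC (/ 2) - RtoC (/ 2)) * (b - c))%C with (RtoC (/ 2) * (b - a))%C by ring.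
    rewrite !Cmod_mult, Cmod_R, Rabs_pos_eq by lra. ring.
  - replace (b + RtoC (/ 2) * (c - b) - (a + RtoC (/ 2) * (b - a)))%C with (- RtoC (/ 2) * (a - c) + (1 - RtoC (/ 2) - RtoC (/2)) * (b - a))%C by ring.
    replace (c + RtoC (/ 2) * (a - c) - (b + RtoC (/ 2) * (c - b)))%C with (- RtoC (/ 2) * (b - a) + (1 - RtoC (/ 2) - RtoC (/2)) * (c - b))%C by ring.
    replace (a + RtoC (/ 2) * (b - a) - (c + RtoC (/ 2) * (a - c)))%C with (- RtoC (/ 2) * (c - b) + (1 - RtoC (/ 2) - RtoC (/2)) * (a - c))%C by ring.
    rewrite <- RtoC_half. replace (RtoC (/ 2) + RtoC (/ 2) - RtoC (/ 2) - RtoC (/ 2))%C with (RtoC 0) by ring.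
    rewrite !Cmult_0_l, !Cplus_0_r.
    rewrite !Cmod_mult, Cmod_opp, Cmod_R, Rabs_pos_eq by lra. ring.
Qed.

Definition tfst (T : C * C * C) : C := fst (fst T).

Lemma tnext_fst (T : C * C * C) : Cmod (tfst (tnext T) - tfst T) <= tsize T.
Proof.
  destruct T as [[a b] c].
  assert (P1 := Cmod_ge_0 (b - a)). assert (P2 := Cmod_ge_0 (c - b)). assert (P3 := Cmod_ge_0 (a - c)).
  destruct (tnext_cases (a, b, c)) as [E|[E|[E|E]]]; rewrite E; clear E; unfold tfst; simpl;
  unfold cmid.
  - rewrite Cmod_self_sub. lra.
  - replace (a + RtoC (/ 2) * (b - a) - a)%C with (RtoC (/ 2) * (b - a))%C by ring.
    rewrite Cmod_mult, Cmod_R, Rabs_pos_eq by lra. lra.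
  - replace (c + RtoC (/ 2) * (a - c) - a)%C with ((RtoC (/ 2) - 1) * (a - c))%C by ring.
    rewrite <- RtoC_half. replace (RtoC (/ 2) - (RtoC (/ 2) + RtoC (/ 2)))%C with (- RtoC (/ 2))%C by ring.
    rewrite Cmod_mult, Cmod_opp, Cmod_R, Rabs_pos_eq by lra. lra.
  - replace (a + RtoC (/ 2) * (b - a) - a)%C with (RtoC (/ 2) * (b - a))%C by ring.
    rewrite Cmod_mult, Cmod_R, Rabs_pos_eq by lra. lra.
Qed.

End Goursat.

Lemma Jseg_const (k a b : C) : Jseg (fun _ => k) a b = (k * (b - a))%C.
Proof.
  unfold Jseg. rewrite (RInt_const (V := C_R_CompleteNormedModule)), scal_R_Cmult, RtoC_minus. ring.
Qed.

Lemma seg_cont_id (a b : C) : seg_cont (fun w => w) a b.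
Proof. intros s _. apply ccont_id. Qed.

(** No antiderivative is used: reversing the segment gives the same mean value, and the two
    integrands add up to the constant [a + b]. *)
Lemma Jseg_id (a b : C) : Jseg (fun w => w) a b = ((b - a) * (a + b) / 2)%C.
Proof.
  destruct (classic (a = b)) as [->|N].
  { unfold Jseg. replace (b - b)%C with (RtoC 0) by ring. field. }
  assert (E := Jseg_swap (fun w => w) a b (seg_cont_id a b)).
  unfold Jseg in *.
  set (I := CRInt (fun s : R => a + s * (b - a))%C 0 1) in *.
  set (I' := CRInt (fun s : R => b + s * (a - b))%C 0 1) in *.
  assert (S : (I + I' = a + b)%C).
  { assert (K := RInt_plus (V := C_R_CompleteNormedModule) (fun s : R => a + s * (b - a))%C
      (fun s : R => b + s * (a - b))%C 0 1
      (seg_cont_ex_RInt _ a b 0 1 (seg_cont_id a b) ltac:(lra) ltac:(lra))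
      (seg_cont_ex_RInt _ b a 0 1 (seg_cont_id b a) ltac:(lra) ltac:(lra))).
    fold I I' in K. change (plus I I') with (I + I')%C in K. rewrite <- K.
    rewrite (RInt_ext (V := C_R_CompleteNormedModule) _ (fun _ => (a + b)%C)).
    - rewrite (RInt_const (V := C_R_CompleteNormedModule)), scal_R_Cmult, RtoC_minus. ring.
    - intros s _. change (@eq C ((a + s * (b - a)) + (b + s * (a - b)))%C (a + b)%C). ring. }
  assert (E2 : I = I').
  { apply (Cmult_cancel_l (b - a)%C).
    - apply Csub_neq0. auto.
    - transitivity (- ((a - b) * I'))%C; [rewrite E; ring|ring]. }
  rewrite <- E2 in S. 
  replace (a + b)%C with (I + I)%C by exact S. field.
Qed.

Lemma seg_cont_affine (u v a b : C) : seg_cont (fun w => u + v * w)%C a b.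
Proof.
  intros s _. apply ccont_plus; [apply ccont_const|]. apply ccont_mult; [apply ccont_const|apply ccont_id].
Qed.

Lemma Jseg_affine (u v a b : C) :
  Jseg (fun w => u + v * w)%C a b = (u * (b - a) + v * ((b - a) * (a + b) / 2))%C.
Proof.
  rewrite Jseg_plus.
  - rewrite Jseg_const, Jseg_scal, Jseg_id; auto. apply seg_cont_id.
  - intros s _. apply ccont_const.
  - intros s _. apply ccont_mult; [apply ccont_const|apply ccont_id].
Qed.

Lemma seg_dist (a b z : C) (s d : R) :
  0 <= s <= 1 -> Cmod (a - z) <= d -> Cmod (b - z) <= d -> Cmod (a + s * (b - a) - z) <= d.
Proof.
  intros Hs Ha Hb.
  replace (a + s * (b - a) - z)%C with (RtoC (1 - s) * (a - z) + RtoC s * (b - z))%C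
    by (rewrite RtoC_minus; ring).
  eapply Rle_trans; [apply Cmod_triangle|].
  rewrite !Cmod_mult, !Cmod_R, !Rabs_pos_eq by lra. nra.
Qed.

(** The affine part of [f] at [z] has integral zero around the triangle. What is left is
    [(phi w - l) * (w - z)], of size at most [eps * r] on the sides. *)
Lemma Tri_near_der (f : C -> C) (z l : C) (eps : R) :
  cder f z l -> 0 < eps -> exists d, 0 < d /\ forall a b c r, r < d ->
    Cmod (a - z) <= r -> Cmod (b - z) <= r -> Cmod (c - z) <= r ->
    seg_cont f a b -> seg_cont f b c -> seg_cont f c a ->
    Cmod (Tri f (a, b, c)) <= tsize (a, b, c) * (eps * r).
Proof.
  intros (phi & Hphi & El & Hf) He. destruct (Hphi eps He) as (d & Hd & Hc).
  exists d. split; auto. intros a b c r Hr Ha Hb Hcz Cab Cbc Cca.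
  set (E := fun w => (f w + ((- (f z) + l * z) + - l * w))%C).
  assert (HE : forall w, E w = ((phi w - l) * (w - z))%C).
  { intros w. unfold E. rewrite (Hf w). ring. }
  assert (CE : forall x y, seg_cont f x y -> seg_cont E x y).
  { intros x y H s Hs. apply ccont_plus; [apply H; auto|]. apply seg_cont_affine with (a := x) (b := y); auto. }
  assert (JE : forall x y, seg_cont f x y -> 
     Jseg E x y = (Jseg f x y + ((- (f z) + l * z) * (y - x) + - l * ((y - x) * (x + y) / 2)))%C).
  { intros x y H. unfold E. rewrite Jseg_plus; auto. rewrite Jseg_affine; auto. apply seg_cont_affine. }
  assert (BE : forall x y, seg_cont f x y -> Cmod (x - z) <= r -> Cmod (y - z) <= r ->
     Cmod (Jseg E x y) <= Cmod (y - x) * (eps * r)).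
  { intros x y H Hx Hy. apply Jseg_bound; auto. intros s Hs. rewrite HE, Cmod_mult.
    assert (K := seg_dist x y z s r Hs Hx Hy). 
    apply Rmult_le_compat; try apply Cmod_ge_0; auto.
    rewrite <- El. left. apply Hc. lra. }
  replace (Tri f (a, b, c)) with (Tri E (a, b, c)).
  - simpl. eapply Rle_trans; [apply Cmod_triangle|].
    eapply Rle_trans; [apply Rplus_le_compat_r, Cmod_triangle|].
    assert (K1 := BE a b Cab Ha Hb). assert (K2 := BE b c Cbc Hb Hcz). assert (K3 := BE c a Cca Hcz Ha).
    lra.
  - simpl. rewrite !JE by auto. field.
Qed.

Lemma Tri_goursat (f : C -> C) (p q h : R) (T : C * C * C) :
  (forall z, halfplane p q h z -> exists l, cder f z l) ->
  tri_in (halfplane p q h) T -> Tri f T = 0%C.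
Proof.
  intros Hf HT.
  set (X := fun k => Nat.iter k (tnext f) T).
  assert (XS : forall k, X (S k) = tnext f (X k)) by reflexivity.
  assert (Xin : forall k, tri_in (halfplane p q h) (X k)).
  { induction k; [exact HT|]. rewrite XS. now apply tnext_in. }
  assert (Xsize : forall k, tsize (X k) = tsize T * (/ 2) ^ k).
  { induction k; [simpl; unfold X; simpl; ring|]. rewrite XS, tnext_size, IHk. simpl. ring. }
  assert (Xbig : forall k, Cmod (Tri f T) * (/ 4) ^ k <= Cmod (Tri f (X k))).
  { induction k; [simpl; unfold X; simpl; lra|].
    assert (K := tnext_large f p q h Hf (X k) (Xin k)). rewrite <- XS in K. simpl pow. lra. }
  destruct (geom_limit (fun k => tfst (X k)) (tsize T)) as [z Hz].
  { intros k. rewrite XS. eapply Rle_trans; [apply tnext_fst|]. rewrite Xsize. lra. }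
  assert (Hin : halfplane p q h z).
  { apply (halfplane_closed p q h (fun k => tfst (X k)) z (2 * tsize T)); auto.
    intros k. specialize (Xin k). destruct (X k) as [[a b] c]. apply Xin. }
  destruct (Hf z Hin) as [l Hl].
  assert (Hs : 0 <= tsize T).
  { destruct T as [[a b] c]. simpl. assert (P1 := Cmod_ge_0 (b - a)). assert (P2 := Cmod_ge_0 (c - b)). assert (P3 := Cmod_ge_0 (a - c)). lra. }
  apply Cmod_eq_0, Rle_antisym; [|apply Cmod_ge_0].
  apply le_epsilon. intros e He. rewrite Rplus_0_l.
  set (S := tsize T) in *.
  (* The [k]-th triangle has perimeter [S / 2^k] and its vertices lie within [3 S / 2^k] of the
     limit point: [2 S / 2^k] from the geometric rate and [S / 2^k] from the perimeter. The
     resulting upper bound [3 S^2 / 4^k] times this constant meets the lower bound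
     [|Tri f T| / 4^k]. *)
  assert (He' : 0 < e / (3 * S * S + 1)) by (apply Rdiv_lt_0_compat; nra).
  destruct (Tri_near_der f z l _ Hl He') as (d & Hd & H).
  destruct (half_pow_small (3 * S) d Hd) as [k Hk].
  specialize (Xin k). specialize (Xsize k). specialize (Xbig k). specialize (Hz k).
  destruct (X k) as [[a b] c]. destruct Xin as (Ia & Ib & Ic). unfold tfst in Hz. simpl in Hz.
  assert (P1 := Cmod_ge_0 (b - a)). assert (P2 := Cmod_ge_0 (c - b)). assert (P3 := Cmod_ge_0 (a - c)).
  simpl in Xsize.
  assert (Zb : Cmod (b - z) <= 3 * S * (/ 2) ^ k).
  { replace (b - z)%C with ((b - a) + (a - z))%C by ring. eapply Rle_trans; [apply Cmod_triangle|]. lra. }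
  assert (Zc : Cmod (c - z) <= 3 * S * (/ 2) ^ k).
  { replace (c - z)%C with (- (a - c) + (a - z))%C by ring. eapply Rle_trans; [apply Cmod_triangle|].
    rewrite Cmod_opp. lra. }
  assert (H2k : 0 < (/ 2) ^ k) by (apply pow_lt; lra).
  specialize (H a b c (3 * S * (/ 2) ^ k) Hk ltac:(nra) Zb Zc
    ltac:(now apply (halfplane_seg_cont f p q h)) ltac:(now apply (halfplane_seg_cont f p q h)) ltac:(now apply (halfplane_seg_cont f p q h))).
  simpl in H, Xbig. rewrite Xsize in H.
  assert (E4 : (/ 4) ^ k = (/ 2) ^ k * (/ 2) ^ k).
  { rewrite <- Rpow_mult_distr. f_equal. lra. }
  rewrite E4 in Xbig.
  assert (Q : Cmod (Tri f T) * ((/ 2) ^ k * (/ 2) ^ k) <=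
    (3 * S * S) * (e / (3 * S * S + 1)) * ((/ 2) ^ k * (/ 2) ^ k)).
  { eapply Rle_trans; [apply Xbig|]. eapply Rle_trans; [apply H|]. right. ring. }
  apply Rmult_le_reg_r in Q; [|now apply Rmult_lt_0_compat].
  eapply Rle_trans; [apply Q|].
  apply Rmult_le_reg_r with (3 * S * S + 1); [nra|].
  replace (3 * S * S * (e / (3 * S * S + 1)) * (3 * S * S + 1)) with (3 * S * S * e) by (field; nra).
  nra.
Qed.

(** Cutting off a small triangle at [v] leaves two triangles in a half-plane that misses [v], where
    Goursat's theorem applies. The small triangle contributes at most its perimeter times a local
    bound for [g]. The functional given by [p] and [q] separates [v] from [b] and [c]. *)
Lemma Tri_vertex (g : C -> C) (v b c : C) (p q : R) :
  ccont g v -> (forall w, w <> v -> exists l, cder g w l) ->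
  0 < p * fst (b - v)%C + q * snd (b - v)%C -> 0 < p * fst (c - v)%C + q * snd (c - v)%C ->
  Tri g (v, b, c) = 0%C.
Proof.
  intros Cv Hg Hb Hc.
  assert (Cg : forall x y, seg_cont g x y).
  { intros x y s _. destruct (classic ((x + s * (y - x))%C = v)) as [->|N]; auto.
    destruct (Hg _ N) as [l Hl]. eapply cder_ccont; apply Hl. }
  set (S := Cmod (b - v) + Cmod (c - b) + Cmod (v - c)).
  assert (P1 := Cmod_ge_0 (b - v)). assert (P2 := Cmod_ge_0 (c - b)). assert (P3 := Cmod_ge_0 (v - c)).
  destruct (ccont_bounded g v Cv) as (d & Hd & HM). set (M := Cmod (g v) + 1) in *.
  assert (HM0 : 0 < M) by (assert (K := Cmod_ge_0 (g v)); unfold M; lra).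
  apply Cmod_eq_0, Rle_antisym; [|apply Cmod_ge_0].
  apply le_epsilon. intros e He. rewrite Rplus_0_l.
  assert (exists eps, 0 < eps /\ eps <= 1 /\ eps * S < d /\ eps * S * M <= e) as (eps & E0 & E1 & E2 & E3).
  { exists (Rmin 1 (Rmin (d / (S + 1)) (e / (S * M + 1)))).
    assert (A1 : 0 < d / (S + 1)) by (apply Rdiv_lt_0_compat; unfold S; lra).
    assert (A2 : 0 < e / (S * M + 1)) by (apply Rdiv_lt_0_compat; unfold S; nra).
    assert (L1 := Rmin_l 1 (Rmin (d / (S + 1)) (e / (S * M + 1)))).
    assert (L2 := Rmin_r 1 (Rmin (d / (S + 1)) (e / (S * M + 1)))).
    assert (L3 := Rmin_l (d / (S + 1)) (e / (S * M + 1))).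
    assert (L4 := Rmin_r (d / (S + 1)) (e / (S * M + 1))).
    set (m := Rmin 1 (Rmin (d / (S + 1)) (e / (S * M + 1)))) in *.
    assert (0 < m) by (repeat apply Rmin_pos; lra).
    assert (HS : 0 <= S) by (unfold S; lra).
    assert (Q1 : m * (S + 1) <= d).
    { replace d with (d / (S + 1) * (S + 1)) by (field; lra). apply Rmult_le_compat_r; lra. }
    assert (Q2 : m * (S * M + 1) <= e).
    { replace e with (e / (S * M + 1) * (S * M + 1)) by (field; nra). apply Rmult_le_compat_r; nra. }
    repeat split; auto; nra. }
  set (b' := (v + eps * (b - v))%C). set (c' := (v + eps * (c - v))%C).
  set (db := p * fst (b - v)%C + q * snd (b - v)%C) in *.
  set (dc := p * fst (c - v)%C + q * snd (c - v)%C) in *.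
  (* The level of the cutting line: [b], [c], [b'] and [c'] lie on or above it, [v] strictly
     below. *)
  set (h := p * fst v + q * snd v + eps * Rmin db dc).
  assert (Hm := Rmin_pos _ _ Hb Hc). assert (Hm1 := Rmin_l db dc). assert (Hm2 := Rmin_r db dc).
  assert (Hh : forall z, halfplane p q h z -> exists l, cder g z l).
  { intros z Hz. apply Hg. intros ->. unfold halfplane, h in Hz. nra. }
  assert (Ib : halfplane p q h b).
  { unfold halfplane, h. replace (p * fst b + q * snd b) with (p * fst v + q * snd v + db)
      by (unfold db; simpl; ring). nra. }
  assert (Ic : halfplane p q h c).
  { unfold halfplane, h. replace (p * fst c + q * snd c) with (p * fst v + q * snd v + dc)
      by (unfold dc; simpl; ring). nra. }
  assert (Ib' : halfplane p q h b').
  { unfold halfplane, h. replace (p * fst b' + q * snd b') with (p * fst v + q * snd v + eps * db)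
      by (unfold b', db; simpl; ring). nra. }
  assert (Ic' : halfplane p q h c').
  { unfold halfplane, h. replace (p * fst c' + q * snd c') with (p * fst v + q * snd v + eps * dc)
      by (unfold c', dc; simpl; ring). nra. }
  assert (T1 := Tri_goursat g p q h (b', b, c') Hh (conj Ib' (conj Ib Ic'))).
  assert (T2 := Tri_goursat g p q h (c', b, c) Hh (conj Ic' (conj Ib Ic))).
  assert (E : Tri g (v, b, c) = (Tri g (v, b', c') + Tri g (b', b, c') + Tri g (c', b, c))%C).
  { simpl. rewrite (Jseg_swap g v c), (Jseg_swap g v c'), (Jseg_swap g b' c'), (Jseg_swap g b c'),
      (Jseg_swap g c' c) by auto.
    rewrite (Jseg_split g v b eps), (Jseg_split g v c eps) by (auto; lra).
    fold b' c'. ring. }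
  rewrite E, T1, T2, !Cplus_0_r. 
  assert (Eb : (b' - v = eps * (b - v))%C) by (unfold b'; ring).
  assert (Ec : (v - c' = eps * (v - c))%C) by (unfold c'; ring).
  assert (Ebc : (c' - b' = eps * (c - b))%C) by (unfold b', c'; ring).
  assert (Nb : Cmod (b' - v) = eps * Cmod (b - v)) by (rewrite Eb, Cmod_mult, Cmod_R, Rabs_pos_eq; lra).
  assert (Nc : Cmod (v - c') = eps * Cmod (v - c)) by (rewrite Ec, Cmod_mult, Cmod_R, Rabs_pos_eq; lra).
  assert (Nbc : Cmod (c' - b') = eps * Cmod (c - b)) by (rewrite Ebc, Cmod_mult, Cmod_R, Rabs_pos_eq; lra).
  assert (Dv : Cmod (v - v) <= eps * S) by (rewrite Cmod_self_sub; unfold S; nra).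
  assert (Db : Cmod (b' - v) <= eps * S) by (rewrite Nb; unfold S; nra).
  assert (Dc : Cmod (c' - v) <= eps * S) by (rewrite Cmod_sub_sym, Nc; unfold S; nra).
  assert (Bd : forall x y, Cmod (x - v) <= eps * S -> Cmod (y - v) <= eps * S ->
     Cmod (Jseg g x y) <= Cmod (y - x) * M).
  { intros x y Hx Hy. apply Jseg_bound; auto. intros s Hs. apply HM.
    assert (K := seg_dist x y v s _ Hs Hx Hy). lra. }
  assert (B1 := Bd v b' Dv Db). assert (B2 := Bd b' c' Db Dc). assert (B3 := Bd c' v Dc Dv).
  simpl. eapply Rle_trans; [apply Cmod_triangle|].
  eapply Rle_trans; [apply Rplus_le_compat_r, Cmod_triangle|].
  rewrite Nb in B1. rewrite Nc in B3. rewrite Nbc in B2. unfold S in E3. nra.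
Qed.

(** * Cauchy integrals over a square, and dividing a zero out of an entire function *)

Definition Nsq (f : C -> C) : C :=
  (Jseg f (1, -1) (1, 1) + Jseg f (1, 1) (-1, 1) + Jseg f (-1, 1) (-1, -1)
   + Jseg f (-1, -1) (1, -1))%C.

Definition sqbd (w : C) : Prop :=
  -1 <= fst w <= 1 /\ -1 <= snd w <= 1 /\
  (fst w = 1 \/ fst w = -1 \/ snd w = 1 \/ snd w = -1).

Lemma sqbd_sides (s : R) : 0 <= s <= 1 ->
  sqbd ((1, -1) + s * ((1, 1) - (1, -1)))%C /\ sqbd ((1, 1) + s * ((-1, 1) - (1, 1)))%C /\
  sqbd ((-1, 1) + s * ((-1, -1) - (-1, 1)))%C /\ sqbd ((-1, -1) + s * ((1, -1) - (-1, -1)))%C.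
Proof. intros Hs. unfold sqbd. simpl. repeat split; try lra. Qed.

Lemma sqbd_Cmod (w : C) : sqbd w -> 1 <= Cmod w <= 2.
Proof.
  intros (H1 & H2 & H3). split.
  - assert (K := Rmax_Cmod w). assert (K1 := Rmax_l (Rabs (fst w)) (Rabs (snd w))).
    assert (K2 := Rmax_r (Rabs (fst w)) (Rabs (snd w))).
    assert (1 <= Rabs (fst w) \/ 1 <= Rabs (snd w)).
    { assert (L : forall x, x = 1 \/ x = -1 -> 1 <= Rabs x).
      { intros x [->| ->]; unfold Rabs; destruct Rcase_abs; lra. }
      destruct H3 as [H|[H|[H|H]]]; auto. }
    lra.
  - replace w with (RtoC (fst w) + Ci * RtoC (snd w))%C
      by (apply injective_projections; simpl; ring).
    eapply Rle_trans; [apply Cmod_triangle|]. rewrite Cmod_mult, Cmod_Ci, !Cmod_R.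
    assert (Rabs (fst w) <= 1) by (apply Rabs_le; lra).
    assert (Rabs (snd w) <= 1) by (apply Rabs_le; lra). lra.
Qed.

Definition sq_cont (f : C -> C) : Prop := forall w, sqbd w -> ccont f w.

Lemma sq_cont_sides (f : C -> C) : sq_cont f ->
  seg_cont f (1, -1) (1, 1) /\ seg_cont f (1, 1) (-1, 1) /\
  seg_cont f (-1, 1) (-1, -1) /\ seg_cont f (-1, -1) (1, -1).
Proof. intros H. repeat split; intros s Hs; apply H; apply sqbd_sides; auto. Qed.

Lemma Nsq_ext (f g : C -> C) : (forall w, sqbd w -> f w = g w) -> Nsq f = Nsq g.
Proof.
  intros H. unfold Nsq. f_equal; [f_equal; [f_equal|]|];
    apply Jseg_ext; intros s Hs; apply H; apply sqbd_sides; auto.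
Qed.

Lemma Nsq_plus (f g : C -> C) : sq_cont f -> sq_cont g ->
  Nsq (fun w => f w + g w)%C = (Nsq f + Nsq g)%C.
Proof.
  intros Hf Hg. destruct (sq_cont_sides f Hf) as (F1 & F2 & F3 & F4).
  destruct (sq_cont_sides g Hg) as (G1 & G2 & G3 & G4).
  unfold Nsq. rewrite !Jseg_plus by auto. ring.
Qed.

Lemma Nsq_scal (k : C) (f : C -> C) : sq_cont f ->
  Nsq (fun w => k * f w)%C = (k * Nsq f)%C.
Proof.
  intros Hf. destruct (sq_cont_sides f Hf) as (F1 & F2 & F3 & F4).
  unfold Nsq. rewrite !Jseg_scal by auto. ring.
Qed.

Lemma Nsq_bound (f : C -> C) (M : R) : sq_cont f ->
  (forall w, sqbd w -> Cmod (f w) <= M) -> Cmod (Nsq f) <= 8 * M.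
Proof.
  intros Hf HM. destruct (sq_cont_sides f Hf) as (F1 & F2 & F3 & F4). unfold Nsq.
  assert (L : forall x : R, Cmod (x, 0) = Rabs x) by (intros; apply Cmod_R).
  assert (L' : forall x : R, Cmod (0, x) = Rabs x).
  { intros x. replace (0, x) with (Ci * RtoC x)%C by (apply injective_projections; simpl; ring).
    rewrite Cmod_mult, Cmod_Ci, Cmod_R. ring. }
  assert (B1 : Cmod (Jseg f (1, -1) (1, 1)) <= 2 * M).
  { eapply Rle_trans; [apply (Jseg_bound _ _ _ M F1); intros s Hs; apply HM, sqbd_sides; auto|].
    right. f_equal. replace ((1, 1) - (1, -1))%C with (0, 2) by (apply injective_projections; simpl; ring).
    rewrite L'. apply Rabs_pos_eq. lra. }
  assert (B2 : Cmod (Jseg f (1, 1) (-1, 1)) <= 2 * M).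
  { eapply Rle_trans; [apply (Jseg_bound _ _ _ M F2); intros s Hs; apply HM, sqbd_sides; auto|].
    right. f_equal. replace ((-1, 1) - (1, 1))%C with (-2, 0) by (apply injective_projections; simpl; ring).
    rewrite L. unfold Rabs. destruct Rcase_abs; lra. }
  assert (B3 : Cmod (Jseg f (-1, 1) (-1, -1)) <= 2 * M).
  { eapply Rle_trans; [apply (Jseg_bound _ _ _ M F3); intros s Hs; apply HM, sqbd_sides; auto|].
    right. f_equal. replace ((-1, -1) - (-1, 1))%C with (0, -2) by (apply injective_projections; simpl; ring).
    rewrite L'. unfold Rabs. destruct Rcase_abs; lra. }
  assert (B4 : Cmod (Jseg f (-1, -1) (1, -1)) <= 2 * M).
  { eapply Rle_trans; [apply (Jseg_bound _ _ _ M F4); intros s Hs; apply HM, sqbd_sides; auto|].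
    right. f_equal. replace ((1, -1) - (-1, -1))%C with (2, 0) by (apply injective_projections; simpl; ring).
    rewrite L. apply Rabs_pos_eq. lra. }
  eapply Rle_trans; [apply Cmod_triangle|].
  eapply Rle_trans; [apply Rplus_le_compat_r, Cmod_triangle|].
  eapply Rle_trans; [apply Rplus_le_compat_r, Rplus_le_compat_r, Cmod_triangle|]. lra.
Qed.

(** Joining [v] to the corners splits the square into four triangles with apex [v], each of which
    has integral zero; the inner sides cancel in pairs. This is why the contour is a square: its
    sides are segments. *)
Lemma Nsq_removable (g : C -> C) (v : C) : Cmod v <= / 2 ->
  ccont g v -> (forall w, w <> v -> exists l, cder g w l) -> Nsq g = 0%C.
Proof.
  intros Hv Cv Hg.
  assert (Cg : forall x y, seg_cont g x y).
  { intros x y s _. destruct (classic ((x + s * (y - x))%C = v)) as [->|N]; auto.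
    destruct (Hg _ N) as [l Hl]. eapply cder_ccont; apply Hl. }
  assert (K := Rmax_Cmod v). assert (K1 := Rmax_l (Rabs (fst v)) (Rabs (snd v))).
  assert (K2 := Rmax_r (Rabs (fst v)) (Rabs (snd v))).
  assert (A1 := Rabs_def2 (fst v) 1 ltac:(lra)). assert (A2 := Rabs_def2 (snd v) 1 ltac:(lra)).
  assert (T1 := Tri_vertex g v (1, -1) (1, 1) 1 0 Cv Hg ltac:(simpl; lra) ltac:(simpl; lra)).
  assert (T2 := Tri_vertex g v (1, 1) (-1, 1) 0 1 Cv Hg ltac:(simpl; lra) ltac:(simpl; lra)).
  assert (T3 := Tri_vertex g v (-1, 1) (-1, -1) (-1) 0 Cv Hg ltac:(simpl; lra) ltac:(simpl; lra)).
  assert (T4 := Tri_vertex g v (-1, -1) (1, -1) 0 (-1) Cv Hg ltac:(simpl; lra) ltac:(simpl; lra)).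
  simpl in T1, T2, T3, T4.
  rewrite (Jseg_swap g v) in T1, T2, T3, T4 by auto.
  assert (E := f_equal2 Cplus (f_equal2 Cplus T1 T2) (f_equal2 Cplus T3 T4)).
  rewrite !Cplus_0_r in E. rewrite <- E. unfold Nsq. ring.
Qed.

Lemma sq_cont_entire (f : C -> C) : (forall z, exists l, cder f z l) -> sq_cont f.
Proof. intros H w _. destruct (H w) as [l Hl]. eapply cder_ccont; apply Hl. Qed.

Lemma sq_cont_mult (f g : C -> C) : sq_cont f -> sq_cont g -> sq_cont (fun w => f w * g w)%C.
Proof. intros Hf Hg w Hw. apply ccont_mult; auto. Qed.

Lemma sqbd_sub (w v : C) : sqbd w -> Cmod v <= / 2 -> / 2 <= Cmod (w - v).
Proof.
  intros Hw Hv. assert (K := Cmod_triangle_rev w v). assert (L := sqbd_Cmod w Hw). lra.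
Qed.

Lemma sqbd_neq (w v : C) : sqbd w -> Cmod v <= / 2 -> (w - v)%C <> 0.
Proof. intros Hw Hv. apply Cmod_gt_0. assert (K := sqbd_sub w v Hw Hv). lra. Qed.

Lemma sq_cont_kernel (v : C) : Cmod v <= / 2 -> sq_cont (fun w => / (w - v))%C.
Proof.
  intros Hv w Hw. apply (ccont_inv (fun w => w - v)%C).
  - now apply sqbd_neq.
  - apply ccont_plus; [apply ccont_id|apply ccont_const].
Qed.

Lemma Cmod_0_le_half : Cmod 0 <= / 2.
Proof. rewrite Cmod_0. lra. Qed.

(** The Cauchy integral without the factor [1 / (2 pi i)]. The normalization is replaced by division
    by the Cauchy integral of the constant 1. *)
Definition cauchy_sq (F : C -> C) (v : C) : C := Nsq (fun w => F w * / (w - v))%C.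

Lemma sq_cont_div (F : C -> C) : sq_cont F -> sq_cont (fun w => F w * / (w - 0))%C.
Proof. intros HF. apply sq_cont_mult; auto. apply sq_cont_kernel, Cmod_0_le_half. Qed.

(** From [1 / (w - v) = 1 / w + v / (w (w - v))]: the slope of a Cauchy integral at 0 is the Cauchy
    integral of [F w / w], so continuity of Cauchy integrals already yields their differentiability
    at 0. *)
Lemma cauchy_sq_expand (F : C -> C) (v : C) : sq_cont F -> Cmod v <= / 2 ->
  cauchy_sq F v = (cauchy_sq F 0 + cauchy_sq (fun w => F w * / (w - 0)) v * (v - 0))%C.
Proof.
  intros HF Hv. unfold cauchy_sq.
  transitivity (Nsq (fun w => F w * / (w - 0) + v * (F w * / (w - 0) * / (w - v)))%C).
  - apply Nsq_ext. intros w Hw. assert (K := sqbd_neq w v Hw Hv).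
    assert (K0 := sqbd_neq w 0 Hw Cmod_0_le_half).
    assert (w <> 0%C) by (intros ->; apply K0; ring). field. auto.
  - rewrite Nsq_plus, Nsq_scal.
    + ring.
    + apply sq_cont_mult; [now apply sq_cont_div|now apply sq_cont_kernel].
    + now apply sq_cont_div.
    + apply sq_cont_mult; [intros w _; apply ccont_const|].
      apply sq_cont_mult; [now apply sq_cont_div|now apply sq_cont_kernel].
Qed.

Lemma cder_intro_loc (f phi : C -> C) (z : C) (d : R) : 0 < d ->
  (forall w, Cmod (w - z) < d -> f w = (f z + phi w * (w - z))%C) ->
  ccont phi z -> cder f z (phi z).
Proof.
  intros Hd H Hp. apply (cder_ext_loc (fun w => f z + phi w * (w - z))%C f z _ d); auto.
  - intros w Hw. symmetry. auto.
  - exists phi. repeat split; auto. intros w. ring.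
Qed.

Lemma cauchy_sq_ccont (F : C -> C) (M : R) : sq_cont F ->
  (forall w, sqbd w -> Cmod (F w) <= M) -> ccont (cauchy_sq F) 0.
Proof.
  intros HF HM e He.
  assert (HM0 : 0 <= M).
  { assert (K := HM (1, 1)). assert (K' := Cmod_ge_0 (F (1, 1))).
    assert (sqbd (1, 1)) by (unfold sqbd; simpl; lra). specialize (K H). lra. }
  exists (Rmin (/ 2) (e / (16 * M + 1))). split.
  { apply Rmin_pos; [lra|]. apply Rdiv_lt_0_compat; lra. }
  intros w Hw. assert (L1 := Rmin_l (/ 2) (e / (16 * M + 1))).
  assert (L2 := Rmin_r (/ 2) (e / (16 * M + 1))).
  replace (w - 0)%C with w in Hw by ring.
  rewrite (cauchy_sq_expand F w HF ltac:(lra)).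
  replace (cauchy_sq F 0 + cauchy_sq (fun w0 => F w0 * / (w0 - 0)) w * (w - 0) - cauchy_sq F 0)%C
    with (cauchy_sq (fun w0 => F w0 * / (w0 - 0)) w * w)%C by ring.
  rewrite Cmod_mult.
  assert (B : Cmod (cauchy_sq (fun w0 => F w0 * / (w0 - 0))%C w) <= 8 * (2 * M)).
  { unfold cauchy_sq. apply Nsq_bound.
    - apply sq_cont_mult; [now apply sq_cont_div|]. apply sq_cont_kernel. lra.
    - intros x Hx. assert (K := sqbd_sub x w Hx ltac:(lra)).
      assert (K0 := sqbd_neq x 0 Hx Cmod_0_le_half). assert (L := sqbd_Cmod x Hx).
      rewrite !Cmod_mult, !Cmod_inv by (auto; apply sqbd_neq; auto; lra).
      replace (x - 0)%C with x in * by ring.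
      assert (I1 : / Cmod x <= 1) by (rewrite <- Rinv_1; apply Rinv_le_contravar; lra).
      assert (I2 : / Cmod (x - w) <= 2) by (rewrite <- (Rinv_inv 2); apply Rinv_le_contravar; lra).
      assert (0 < / Cmod x) by (apply Rinv_0_lt_compat; lra).
      assert (0 < / Cmod (x - w)) by (apply Rinv_0_lt_compat; lra).
      specialize (HM x Hx). assert (Q := Cmod_ge_0 (F x)).
      assert (Cmod (F x) * / Cmod x <= M) by nra. 
      assert (0 <= Cmod (F x) * / Cmod x) by nra. nra. }
  assert (W := Cmod_ge_0 w).
  assert (W2 : Cmod w * (16 * M + 1) < e).
  { replace e with (e / (16 * M + 1) * (16 * M + 1)) by (field; lra).
    apply Rmult_lt_compat_r; lra. }
  nra.
Qed.

Lemma cauchy_sq_cder (F : C -> C) (M : R) : sq_cont F ->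
  (forall w, sqbd w -> Cmod (F w) <= M) -> exists l, cder (cauchy_sq F) 0 l.
Proof.
  intros HF HM. eexists. apply (cder_intro_loc _ (cauchy_sq (fun w => F w * / (w - 0))%C) 0 (/ 2)).
  - lra.
  - intros w Hw. replace (w - 0)%C with w in Hw by ring. apply cauchy_sq_expand; auto. lra.
  - apply (cauchy_sq_ccont _ M); [now apply sq_cont_div|].
    intros w Hw. assert (K0 := sqbd_neq w 0 Hw Cmod_0_le_half). assert (L := sqbd_Cmod w Hw).
    rewrite Cmod_mult, Cmod_inv by auto. replace (w - 0)%C with w in * by ring.
    assert (I1 : / Cmod w <= 1) by (rewrite <- Rinv_1; apply Rinv_le_contravar; lra).
    assert (0 < / Cmod w) by (apply Rinv_0_lt_compat; lra).
    specialize (HM w Hw). assert (Q := Cmod_ge_0 (F w)). nra.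
Qed.

Lemma seg_cont_bounded (f : C -> C) (a b : C) : seg_cont f a b ->
  exists M, forall s : R, 0 <= s <= 1 -> Cmod (f (a + s * (b - a))%C) <= M.
Proof.
  intros H.
  destruct (continuity_ab_maj (fun s : R => Cmod (f (a + s * (b - a))%C)) 0 1 ltac:(lra)) as (s0 & Hs & _).
  2:{ eexists. intros s Hs0. apply Hs. lra. }
  intros s Hs e He. destruct (H s Hs e He) as (d & Hd & Hf).
  assert (Q := Cmod_ge_0 (b - a)).
  exists (d / (Cmod (b - a) + 1)). split; [apply Rdiv_lt_0_compat; lra|].
  intros y [_ Hy]. simpl in *. unfold R_dist in *.
  assert (Hw : Cmod (a + y * (b - a) - (a + s * (b - a))) < d).
  { replace (a + y * (b - a) - (a + s * (b - a)))%C with ((y - s)%R * (b - a))%C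
      by (rewrite RtoC_minus; ring).
    rewrite Cmod_mult, Cmod_R.
    apply Rle_lt_trans with (Rabs (y - s) * (Cmod (b - a) + 1)).
    { apply Rmult_le_compat_l; [apply Rabs_pos|lra]. }
    apply Rlt_le_trans with (d / (Cmod (b - a) + 1) * (Cmod (b - a) + 1)).
    { apply Rmult_lt_compat_r; lra. }
    right. field. lra. }
  specialize (Hf _ Hw). apply Rabs_def1.
  - eapply Rle_lt_trans; [apply Cmod_triangle_rev|]. auto.
  - rewrite Cmod_sub_sym in Hf.
    assert (K := Cmod_triangle_rev (f (a + s * (b - a))%C) (f (a + y * (b - a))%C)). lra.
Qed.

Lemma sq_cont_bounded (F : C -> C) : sq_cont F -> exists M, forall w, sqbd w -> Cmod (F w) <= M.
Proof.
  intros HF. destruct (sq_cont_sides F HF) as (F1 & F2 & F3 & F4).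
  destruct (seg_cont_bounded _ _ _ F1) as [M1 H1]. destruct (seg_cont_bounded _ _ _ F2) as [M2 H2].
  destruct (seg_cont_bounded _ _ _ F3) as [M3 H3]. destruct (seg_cont_bounded _ _ _ F4) as [M4 H4].
  exists (Rmax (Rmax M1 M2) (Rmax M3 M4)). intros [x y] (Hx & Hy & Hs). simpl in Hx, Hy, Hs.
  assert (A1 := Rmax_l (Rmax M1 M2) (Rmax M3 M4)). assert (A2 := Rmax_r (Rmax M1 M2) (Rmax M3 M4)).
  assert (B1 := Rmax_l M1 M2). assert (B2 := Rmax_r M1 M2). 
  assert (B3 := Rmax_l M3 M4). assert (B4 := Rmax_r M3 M4).
  destruct Hs as [Hs|[Hs|[Hs|Hs]]].
  - specialize (H1 ((y + 1) / 2) ltac:(lra)).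
    replace ((1, -1) + ((y + 1) / 2)%R * ((1, 1) - (1, -1)))%C with ((x, y) : C) in H1
      by (apply injective_projections; simpl; lra). lra.
  - specialize (H3 ((1 - y) / 2) ltac:(lra)).
    replace ((-1, 1) + ((1 - y) / 2)%R * ((-1, -1) - (-1, 1)))%C with ((x, y) : C) in H3
      by (apply injective_projections; simpl; lra). lra.
  - specialize (H2 ((1 - x) / 2) ltac:(lra)).
    replace ((1, 1) + ((1 - x) / 2)%R * ((-1, 1) - (1, 1)))%C with ((x, y) : C) in H2
      by (apply injective_projections; simpl; lra). lra.
  - specialize (H4 ((x + 1) / 2) ltac:(lra)).
    replace ((-1, -1) + ((x + 1) / 2)%R * ((1, -1) - (-1, -1)))%C with ((x, y) : C) in H4
      by (apply injective_projections; simpl; lra). lra.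
Qed.

(** The form [dw / w] is invariant under multiplication by [Ci]. If the segment meets 0, both
    integrands vanish there by the convention [/ 0 = 0]. *)
Lemma Jseg_inv_rotate (a b : C) :
  seg_cont (fun w => / w)%C a b ->
  Jseg (fun w => / w)%C (Ci * a) (Ci * b) = Jseg (fun w => / w)%C a b.
Proof.
  intros H. unfold Jseg.
  assert (Ci2 : (Ci * Ci = - (1))%C) by (apply injective_projections; simpl; ring).
  assert (Ci0 : Ci <> 0%C) by (intros E; apply (f_equal snd) in E; simpl in E; lra).
  rewrite (RInt_ext (V := C_R_CompleteNormedModule) (fun s : R => / (Ci * a + s * (Ci * b - Ci * a)))%C
    (fun s : R => (- Ci) * / (a + s * (b - a)))%C).
  - rewrite (C_RInt_mult_l (- Ci) (fun s : R => / (a + s * (b - a)))%C).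
    + transitivity ((- (Ci * Ci)) * ((b - a) * CRInt (fun s : R => / (a + s * (b - a)))%C 0 1))%C; [ring|].
      rewrite Ci2. ring.
    + apply (seg_cont_ex_RInt (fun w => / w)%C); auto; lra.
  - intros s _. match goal with |- ?l = ?r => change (@eq C l r) end.
    replace (Ci * a + s * (Ci * b - Ci * a))%C with (Ci * (a + s * (b - a)))%C by ring.
    destruct (classic (a + s * (b - a) = 0)%C) as [E|E].
    + rewrite E. rewrite Cmult_0_r.
      assert (I0 : (/ 0 = 0)%C) by (apply injective_projections; simpl; unfold Rdiv; ring).
      rewrite I0. ring.
    + apply (Cmult_cancel_l (Ci * (a + s * (b - a)))); [now apply Cmult_neq_0|].
      rewrite Cinv_r by (now apply Cmult_neq_0).
      transitivity (- (Ci * Ci))%C; [rewrite Ci2; ring|]. field. auto.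
Qed.

(** By rotation the four sides contribute equally, and on the right side the real part of
    [1 / (1 + i (2 s - 1))] is at least [1 / 2], so the imaginary part of the integral is positive.
    The exact value [2 pi i] is never computed. *)
Lemma Nsq_inv_neq0 : Nsq (fun w => / (w - 0))%C <> 0%C.
Proof.
  rewrite (Nsq_ext _ (fun w => / w)%C) by (intros; f_equal; ring).
  assert (Hc : sq_cont (fun w => / w)%C).
  { intros w Hw. apply ccont_inv; [|apply ccont_id].
    apply Cmod_gt_0. assert (L := sqbd_Cmod w Hw). lra. }
  destruct (sq_cont_sides _ Hc) as (F1 & F2 & F3 & F4).
  unfold Nsq.
  assert (R1 : Jseg (fun w => / w)%C (1, 1) (-1, 1) = Jseg (fun w => / w)%C (1, -1) (1, 1)).
  { rewrite <- (Jseg_inv_rotate (1, -1) (1, 1)) by auto. f_equal; apply injective_projections; simpl; ring. }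
  assert (R2 : Jseg (fun w => / w)%C (-1, 1) (-1, -1) = Jseg (fun w => / w)%C (1, 1) (-1, 1)).
  { rewrite <- (Jseg_inv_rotate (1, 1) (-1, 1)) by auto. f_equal; apply injective_projections; simpl; ring. }
  assert (R3 : Jseg (fun w => / w)%C (-1, -1) (1, -1) = Jseg (fun w => / w)%C (-1, 1) (-1, -1)).
  { rewrite <- (Jseg_inv_rotate (-1, 1) (-1, -1)) by auto. f_equal; apply injective_projections; simpl; ring. }
  rewrite R3, R2, R1. 
  assert (P : 0 < Im (Jseg (fun w => / w)%C (1, -1) (1, 1))).
  { unfold Jseg. 
    assert (K := RInt_correct (V := C_R_CompleteNormedModule) _ _ _
       (seg_cont_ex_RInt _ _ _ 0 1 F1 ltac:(lra) ltac:(lra))).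
    set (l := CRInt _ 0 1) in *.
    apply (is_RInt_fct_extend_fst (U := R_NormedModule) (V := R_NormedModule)) in K.
    assert (Q : / 2 <= fst l).
    { apply (is_RInt_le (fun _ => / 2) (fun t : R => fst (/ ((1, -1) + t * ((1, 1) - (1, -1))))%C) 0 1);
        [lra| |exact K|].
      - assert (Kc := is_RInt_const 0 1 (/ 2)). unfold scal in Kc. simpl in Kc. unfold mult in Kc. simpl in Kc.
        replace ((1 - 0) * / 2) with (/ 2) in Kc by ring. exact Kc.
      - intros s Hs. simpl.
        replace (1 + (s * (1 + - (1)) - 0 * (1 + - (-1)))) with 1 by ring.
        replace (-1 + (s * (1 + - (-1)) + 0 * (1 + - (1)))) with (2 * s - 1) by ring.
        assert (B : 0 <= (2 * s - 1) * (2 * s - 1) <= 1) by (split; [apply Rle_0_sqr|nra]).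
        unfold Rdiv. rewrite !Rmult_1_l, !Rmult_1_r. apply Rinv_le_contravar; lra. }
    clearbody l. destruct l as [x y]. unfold Im. simpl in *. lra. }
  revert P. generalize (Jseg (fun w => / w)%C (1, -1) (1, 1)). intros [x y] P E.
  apply (f_equal Im) in E. unfold Im in *. simpl in *. lra.
Qed.

Lemma ccont_eq_punctured (f g : C -> C) (z : C) (d : R) : 0 < d ->
  (forall w, w <> z -> Cmod (w - z) < d -> f w = g w) -> ccont f z -> ccont g z -> f z = g z.
Proof.
  intros Hd H Hf Hg. apply NNPP. intros N.
  assert (Hp := Cmod_sub_pos _ _ N).
  destruct (Hf (Cmod (f z - g z) / 2) ltac:(lra)) as (d1 & D1 & H1).
  destruct (Hg (Cmod (f z - g z) / 2) ltac:(lra)) as (d2 & D2 & H2).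
  set (m := Rmin d (Rmin d1 d2) / 2).
  assert (Hm : 0 < Rmin d (Rmin d1 d2)) by (repeat apply Rmin_pos; auto).
  assert (L1 := Rmin_l d (Rmin d1 d2)). assert (L2 := Rmin_r d (Rmin d1 d2)).
  assert (L3 := Rmin_l d1 d2). assert (L4 := Rmin_r d1 d2).
  assert (E : Cmod (z + m - z) = m).
  { replace (z + m - z)%C with (RtoC m) by ring. rewrite Cmod_R. apply Rabs_pos_eq. unfold m. lra. }
  assert (Hw : Cmod (z + m - z) < Rmin d (Rmin d1 d2)) by (rewrite E; unfold m; lra).
  specialize (H1 (z + m)%C ltac:(lra)). specialize (H2 (z + m)%C ltac:(lra)).
  rewrite H in H1; [|intros E'; rewrite E', Cmod_self_sub in E; unfold m in E; lra|lra].
  rewrite Cmod_sub_sym in H1.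
  assert (K := Cmod_triangle (f z - g (z + m)%C) (g (z + m)%C - g z)).
  replace (f z - g (z + m)%C + (g (z + m)%C - g z))%C with (f z - g z)%C in K by ring. lra.
Qed.

(** Cauchy's formula in unnormalized form reads [Phi v = A v * W v], with [Phi] and [W] the Cauchy
    integrals of [A] and of 1. Expanding both at 0 and cancelling [w] gives
    [phi w * W w = Phi1 w - A 0 * W1 w] for [w <> 0], and [W 0 <> 0]. So near 0 the slope [phi] is a
    quotient of functions differentiable at 0. *)
Lemma cder_slope_0 (A phi : C -> C) :
  (forall z, exists l, cder A z l) -> ccont phi 0 ->
  (forall w, A w = (A 0 + phi w * (w - 0))%C) -> exists m, cder phi 0 m.
Proof.
  intros HA Hphi Hs.
  assert (CA := sq_cont_entire A HA).
  assert (C1 : sq_cont (fun _ => RtoC 1)) by (intros w _; apply ccont_const).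
  destruct (sq_cont_bounded A CA) as [M HM].
  assert (M1 : forall w, sqbd w -> Cmod 1 <= 1) by (intros; rewrite Cmod_1; lra).
  set (W := cauchy_sq (fun _ => RtoC 1)). set (Phi := cauchy_sq A).
  assert (CF : forall v, Cmod v <= / 2 -> Phi v = (A v * W v)%C).
  { intros v Hv. destruct (HA v) as (l & psi & Cpsi & _ & Hpsi).
    assert (Z := Nsq_removable psi v Hv Cpsi).
    assert (E : Nsq psi = (Phi v - A v * W v)%C).
    { transitivity (Nsq (fun w => A w * / (w - v) + (- A v) * (1 * / (w - v)))%C).
      - apply Nsq_ext. intros w Hw. rewrite (Hpsi w). assert (K := sqbd_neq w v Hw Hv). field. auto.
      - rewrite Nsq_plus, Nsq_scal.
        + unfold Phi, W, cauchy_sq. ring.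
        + apply sq_cont_mult; auto. now apply sq_cont_kernel.
        + apply sq_cont_mult; auto. now apply sq_cont_kernel.
        + apply (sq_cont_mult (fun _ => - A v)%C); [intros w _; apply ccont_const|].
          apply sq_cont_mult; auto. now apply sq_cont_kernel. }
    rewrite Z in E.
    - replace (Phi v) with (Phi v - A v * W v + A v * W v)%C by ring. rewrite <- E. ring.
    - intros w Hw. destruct (HA w) as [a Ha].
      destruct (cder_inv (fun u => u - v)%C w (1 + 0)%C) as [b Hb].
      + now apply Csub_neq0.
      + apply cder_plus; [apply cder_id|apply cder_const].
      + eexists. apply (cder_ext_loc (fun u => (A u + - A v) * / (u - v))%C psi w _ (Cmod (w - v))).
        * now apply Cmod_sub_pos.
        * intros u Hu. rewrite (Hpsi u). field. apply Csub_neq0. intros ->.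
          rewrite Cmod_sub_sym in Hu. lra.
        * apply cder_mult; [|exact Hb]. apply cder_plus; [exact Ha|apply cder_const]. }
  set (W1 := cauchy_sq (fun w => 1 * / (w - 0))%C). set (Phi1 := cauchy_sq (fun w => A w * / (w - 0))%C).
  assert (EW : forall v, Cmod v <= / 2 -> W v = (W 0 + W1 v * (v - 0))%C)
    by (intros v Hv; apply cauchy_sq_expand; auto).
  assert (EP : forall v, Cmod v <= / 2 -> Phi v = (Phi 0 + Phi1 v * (v - 0))%C)
    by (intros v Hv; apply cauchy_sq_expand; auto).
  destruct (sq_cont_bounded _ (sq_cont_div A CA)) as [M' HM'].
  destruct (sq_cont_bounded _ (sq_cont_div _ C1)) as [M1' HM1'].
  destruct (cauchy_sq_cder _ M' (sq_cont_div A CA) HM') as [lP DP]. fold Phi1 in DP.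
  destruct (cauchy_sq_cder _ M1' (sq_cont_div _ C1) HM1') as [lW DW]. fold W1 in DW.
  destruct (cauchy_sq_cder _ 1 C1 M1) as [lV DV]. fold W in DV.
  assert (W0 : W 0 <> 0%C).
  { unfold W, cauchy_sq. rewrite (Nsq_ext _ (fun w => / (w - 0))%C) by (intros; ring). apply Nsq_inv_neq0. }
  destruct (cder_inv W 0 lV W0 DV) as [lI DI].
  assert (exists lR, cder (fun v => (Phi1 v + (- A 0) * W1 v) * / W v)%C 0 lR) as [lR DR].
  { eexists. eapply (cder_mult (fun v => Phi1 v + (- A 0) * W1 v)%C (fun v => / W v)%C); [|exact DI].
    eapply (cder_plus Phi1 (fun v => (- A 0) * W1 v)%C); [exact DP|].
    eapply (cder_mult (fun _ => - A 0)%C W1); [apply cder_const|exact DW]. }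
  destruct (cder_ccont _ _ _ DV (Cmod (W 0)) (proj1 (Cmod_gt_0 _) W0)) as (d & Hd & HW).
  assert (Hd' : 0 < Rmin d (/ 2)) by (apply Rmin_pos; lra).
  assert (L1 := Rmin_l d (/ 2)). assert (L2 := Rmin_r d (/ 2)).
  assert (E : forall w : C, w <> 0%C -> Cmod (w - 0) < Rmin d (/ 2) ->
     ((Phi1 w + - A 0 * W1 w) * / W w = phi w)%C).
  { intros w Hw0 Hw. specialize (HW w ltac:(lra)).
    assert (Ww : W w <> 0%C).
    { intros Z. rewrite Z, Cmod_sub_sym in HW. replace (W 0 - 0)%C with (W 0) in HW by ring. lra. }
    assert (Ew : (w - 0)%C = w) by ring. rewrite Ew in Hw.
    assert (H1 := CF w ltac:(lra)). assert (H0 := CF 0%C Cmod_0_le_half).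
    assert (Q : ((Phi1 w + - A 0 * W1 w) = phi w * W w)%C).
    { apply (Cmult_cancel_l w); [exact Hw0|].
      assert (H2 := EP w ltac:(lra)). assert (H3 := EW w ltac:(lra)).
      rewrite (Hs w) in H1.
      transitivity (Phi w - Phi 0 - A 0 * (W w - W 0))%C; [rewrite H2, H3; ring|].
      rewrite H1, H0. ring. }
    rewrite Q. field. auto. }
  eexists. eapply (cder_ext_loc _ phi 0 _ _ Hd'); [|exact DR].
  intros w Hw. destruct (classic (w = 0%C)) as [->|N]; [|now apply E].
  apply (ccont_eq_punctured (fun v => (Phi1 v + (- A 0) * W1 v) * / W v)%C phi 0 _ Hd'); auto.
  eapply cder_ccont, DR.
Qed.

(* The only consequence of analyticity of [A] that is needed. *)
Lemma cder_slope (A phi : C -> C) (t : C) :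
  (forall z, exists l, cder A z l) -> ccont phi t ->
  (forall w, A w = (A t + phi w * (w - t))%C) -> exists m, cder phi t m.
Proof.
  intros HA Hphi Hs.
  assert (Sh : forall f z l, cder f (z + t)%C l -> cder (fun w => f (w + t)%C) z l).
  { intros f z l (p & Hp & El & Hf). exists (fun w => p (w + t)%C). split; [|split]; auto.
    - intros e He. destruct (Hp e He) as (d & Hd & H). exists d. split; auto. intros w Hw. apply H.
      replace (w + t - (z + t))%C with (w - z)%C by ring. auto.
    - intros w. rewrite (Hf (w + t)%C). ring. }
  destruct (cder_slope_0 (fun w => A (w + t)%C) (fun w => phi (w + t)%C)) as [m Hm].
  - intros z. destruct (HA (z + t)%C) as [l Hl]. exists l. now apply Sh.
  - intros e He. destruct (Hphi e He) as (d & Hd & H). exists d. split; auto. intros w Hw.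
    replace (0 + t)%C with t by ring. apply H.
    replace (w + t - t)%C with (w - 0)%C by ring. auto.
  - intros w. rewrite Hs. replace (0 + t)%C with t by ring. ring.
  - exists m. destruct Hm as (p & Hp & El & Hf). exists (fun w => p (w - t)%C). split; [|split].
    + intros e He. destruct (Hp e He) as (d & Hd & H). exists d. split; auto. intros w Hw.
      replace (t - t)%C with (RtoC 0) by ring. apply H.
      replace (w - t - 0)%C with (w - t)%C by ring. auto.
    + replace (t - t)%C with (RtoC 0) by ring. auto.
    + intros w. specialize (Hf (w - t)%C). replace (w - t + t)%C with w in Hf by ring.
      replace (0 + t)%C with t in Hf by ring. rewrite Hf. ring.
Qed.

(** * Complex series and Cauchy transforms *)

Lemma ex_series_dom (a b : nat -> R) :
  (forall n, 0 <= a n <= b n) -> ex_series b -> ex_series a.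
Proof.
  intros H. apply (ex_series_le (K := R_AbsRing) (V := R_CompleteNormedModule)).
  intros n. change (Rabs (a n) <= b n). rewrite Rabs_pos_eq; apply H.
Qed.

Lemma Series_0 (a : nat -> R) : (forall n, a n = 0) -> Series a = 0.
Proof.
  intros H. rewrite (Series_ext a (fun n => 0 * a n)) by (intros n; rewrite H; ring).
  rewrite Series_scal_l. ring.
Qed.

Lemma ex_series_Rscal (k : R) (a : nat -> R) : ex_series a -> ex_series (fun n => k * a n).
Proof. exact (ex_series_scal (K := R_AbsRing) (V := R_NormedModule) k a). Qed.

Lemma ex_series_Rplus (a b : nat -> R) : ex_series a -> ex_series b -> ex_series (fun n => a n + b n).
Proof. exact (ex_series_plus (K := R_AbsRing) (V := R_NormedModule) a b). Qed.

Lemma ex_series_Rext (a b : nat -> R) : (forall n, a n = b n) -> ex_series a -> ex_series b.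
Proof. apply ex_series_ext. Qed.

Lemma Series_nonneg (a : nat -> R) : (forall n, 0 <= a n) -> ex_series a -> 0 <= Series a.
Proof.
  intros H E. rewrite <- (Series_0 (fun _ => 0)) by auto. apply Series_le; auto.
  intros n. split; [lra|apply H].
Qed.

Lemma sum_n_le_Series (a : nat -> R) (N : nat) :
  (forall n, 0 <= a n) -> ex_series a -> sum_n a N <= Series a.
Proof.
  intros H E. rewrite (Series_incr_n a (S N)); [|lia|auto].
  rewrite <- sum_n_Reals. simpl pred.
  assert (0 <= Series (fun k => a (S N + k)%nat)); [|lra].
  apply Series_nonneg; [intros; apply H|].
  now apply (ex_series_incr_n (K := R_AbsRing) (V := R_NormedModule)).
Qed.

Lemma term_le_Series (a : nat -> R) (n : nat) :
  (forall n, 0 <= a n) -> ex_series a -> a n <= Series a.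
Proof.
  intros H E. eapply Rle_trans; [|apply (sum_n_le_Series a n H E)].
  destruct n; [rewrite sum_O; lra|]. rewrite sum_Sn.
  change (a (S n) <= sum_n a n + a (S n)).
  assert (0 <= sum_n a n); [|lra].
  induction n; [rewrite sum_O; apply H|]. rewrite sum_Sn. change (0 <= sum_n a n + a (S n)).
  specialize (H (S n)). lra.
Qed.

(** Phrased through dominated sequences that vanish on a prefix, so that tails can be used without
    shifting indices. *)
Lemma Series_tail (a : nat -> R) (eps : R) :
  (forall n, 0 <= a n) -> ex_series a -> 0 < eps ->
  exists N, forall b : nat -> R, (forall n, 0 <= b n <= a n) ->
    (forall n, (n < N)%nat -> b n = 0) -> Series b < eps.
Proof.
  intros H E He.
  assert (L := Series_correct _ E). apply is_series_Reals in L.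
  destruct (L eps He) as [N HN]. exists (S N). intros b Hb Z.
  specialize (HN N (le_n N)). unfold Rdist in HN.
  assert (Eb : ex_series b) by (apply (ex_series_dom b a); auto).
  rewrite (Series_incr_n b (S N)); [|lia|auto]. simpl pred.
  rewrite (Series_incr_n a (S N)) in HN; [|lia|auto]. simpl pred in HN.
  apply Rabs_def2 in HN.
  assert (Zs : sum_f_R0 b N = 0).
  { rewrite <- (sum_eq_R0 (fun _ => 0) N) by auto. apply sum_eq. intros i Hi. apply Z. lia. }
  rewrite Zs.
  assert (Series (fun k => b (S N + k)%nat) <= Series (fun k => a (S N + k)%nat)); [|lra].
  apply Series_le; [intros; apply Hb|].
  now apply (ex_series_incr_n (K := R_AbsRing) (V := R_NormedModule)).
Qed.

Definition summ (u : nat -> C) : Prop := ex_series (fun n => Cmod (u n)).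

(** Built from the total function [Series] on both coordinates, so that equations between sums can
    be written down before convergence is known. *)
Definition Csum (u : nat -> C) : C := (Series (fun n => fst (u n)), Series (fun n => snd (u n))).

Lemma fst_le_Cmod (z : C) : Rabs (fst z) <= Cmod z.
Proof. eapply Rle_trans; [|apply Rmax_Cmod]. apply Rmax_l. Qed.

Lemma snd_le_Cmod (z : C) : Rabs (snd z) <= Cmod z.
Proof. eapply Rle_trans; [|apply Rmax_Cmod]. apply Rmax_r. Qed.

Lemma summ_dom (u : nat -> C) (b : nat -> R) :
  (forall n, Cmod (u n) <= b n) -> ex_series b -> summ u.
Proof. intros H. apply ex_series_dom. intros n. split; [apply Cmod_ge_0|apply H]. Qed.

Lemma summ_fst (u : nat -> C) : summ u -> ex_series (fun n => fst (u n)).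
Proof.
  apply (ex_series_le (K := R_AbsRing) (V := R_CompleteNormedModule)).
  intros n. apply fst_le_Cmod.
Qed.

Lemma summ_snd (u : nat -> C) : summ u -> ex_series (fun n => snd (u n)).
Proof.
  apply (ex_series_le (K := R_AbsRing) (V := R_CompleteNormedModule)).
  intros n. apply snd_le_Cmod.
Qed.

Notation csum_n := (sum_n (G := C_AbelianMonoid)).

Lemma sum_n_pair (u : nat -> C) (n : nat) :
  csum_n u n = (sum_n (fun k => fst (u k)) n, sum_n (fun k => snd (u k)) n).
Proof.
  induction n as [|n IH]; [rewrite !sum_O; now destruct (u O)|].
  rewrite !sum_Sn, IH. reflexivity.
Qed.

Lemma Csum_is_series (u : nat -> C) : summ u ->
  @is_series C_AbsRing C_NormedModule u (Csum u).
Proof.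
  intros H. assert (H1 := Series_correct _ (summ_fst u H)). assert (H2 := Series_correct _ (summ_snd u H)).
  apply filterlim_locally. intros e.
  assert (F1 := proj1 (filterlim_locally _ _) H1 e). assert (F2 := proj1 (filterlim_locally _ _) H2 e).
  generalize (filter_and _ _ F1 F2). apply filter_imp.
  intros n [B1 B2].
  match goal with |- ball _ _ ?x => replace x with (csum_n u n) by reflexivity end.
  rewrite sum_n_pair. split; assumption.
Qed.

Lemma is_series_Csum (u : nat -> C) (l : C) :
  @is_series C_AbsRing C_NormedModule u l -> l = Csum u.
Proof.
  intros H. unfold is_series in H.
  assert (F : forall e : posreal, eventually (fun n => ball (l : C_UniformSpace) e (csum_n u n))).
  { intros e. exact (proj1 (filterlim_locally _ _) H e). }
  apply injective_projections; symmetry; apply is_series_unique; apply filterlim_locally; intros e;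
    generalize (F e); apply filter_imp; intros n B; rewrite sum_n_pair in B; apply B.
Qed.

Lemma Csum_ext (u v : nat -> C) : (forall n, u n = v n) -> Csum u = Csum v.
Proof. intros H. unfold Csum. f_equal; apply Series_ext; intros; now rewrite H. Qed.

Lemma summ_ext (u v : nat -> C) : (forall n, u n = v n) -> summ u -> summ v.
Proof. intros H. apply ex_series_ext. intros n. now rewrite H. Qed.

Lemma summ_plus (u v : nat -> C) : summ u -> summ v -> summ (fun n => u n + v n)%C.
Proof.
  intros Hu Hv. apply (summ_dom _ (fun n => Cmod (u n) + Cmod (v n))).
  - intros n. apply Cmod_triangle.
  - apply ex_series_Rplus; auto.
Qed.

Lemma summ_scal (k : C) (u : nat -> C) : summ u -> summ (fun n => k * u n)%C.
Proof.
  intros Hu. apply (summ_dom _ (fun n => Cmod k * Cmod (u n))).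
  - intros n. rewrite Cmod_mult. lra.
  - apply ex_series_Rscal; auto.
Qed.

Lemma Csum_plus (u v : nat -> C) : summ u -> summ v ->
  Csum (fun n => u n + v n)%C = (Csum u + Csum v)%C.
Proof.
  intros Hu Hv. unfold Csum. simpl.
  apply injective_projections; simpl; apply Series_plus; auto using summ_fst, summ_snd.
Qed.

Lemma Csum_scal (k : C) (u : nat -> C) : summ u -> Csum (fun n => k * u n)%C = (k * Csum u)%C.
Proof.
  intros Hu. assert (H1 := summ_fst u Hu). assert (H2 := summ_snd u Hu).
  unfold Csum. apply injective_projections; simpl.
  - rewrite Series_minus by now apply ex_series_Rscal. now rewrite !Series_scal_l.
  - rewrite Series_plus by now apply ex_series_Rscal. rewrite !Series_scal_l. ring.
Qed.

(** Multiplying by the unimodular [k] makes the sum real and nonnegative; it is then bounded through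
    the real parts of the terms. *)
Lemma Csum_bound (u : nat -> C) : summ u -> Cmod (Csum u) <= Series (fun n => Cmod (u n)).
Proof.
  intros Hu. destruct (classic (Csum u = 0)%C) as [E|E].
  { rewrite E, Cmod_0. apply Series_nonneg; auto. intros; apply Cmod_ge_0. }
  set (S := Csum u) in *. assert (Hp := proj1 (Cmod_gt_0 S) E).
  set (k := (Cconj S / Cmod S)%C).
  assert (HS : RtoC (Cmod S) <> 0%C) by (intros Z; apply RtoC_inj in Z; lra).
  assert (Ek : (k * S)%C = RtoC (Cmod S)).
  { unfold k. replace (Cconj S / Cmod S * S)%C with ((S * Cconj S) / Cmod S)%C by (field; auto).
    rewrite <- Cmod2_conj. rewrite RtoC_pow. simpl. field. auto. }
  assert (Nk : Cmod k = 1).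
  { unfold k. rewrite Cmod_div, Cmod_conj, Cmod_R, Rabs_pos_eq by (auto; lra). field. lra. }
  assert (Q := Csum_scal k u Hu). fold S in Q. rewrite Ek in Q.
  apply (f_equal fst) in Q. simpl in Q. rewrite <- Q.
  apply Rle_trans with (Series (fun n => Rabs (fst (k * u n)%C))).
  - eapply Rle_trans; [apply Rle_abs|]. apply Series_Rabs.
    apply (ex_series_dom _ (fun n => Cmod (k * u n)%C)); [|now apply summ_scal].
    intros n. split; [apply Rabs_pos|apply fst_le_Cmod].
  - apply Series_le; auto. intros n. split; [apply Rabs_pos|].
    eapply Rle_trans; [apply fst_le_Cmod|]. rewrite Cmod_mult, Nk. lra.
Qed.

Lemma Csum_dom (u : nat -> C) (b : nat -> R) :
  (forall n, Cmod (u n) <= b n) -> ex_series b -> Cmod (Csum u) <= Series b.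
Proof.
  intros H Hb. eapply Rle_trans; [apply Csum_bound, (summ_dom u b); auto|].
  apply Series_le; auto. intros n. split; [apply Cmod_ge_0|apply H].
Qed.

Lemma Csum_0 (u : nat -> C) : (forall n, u n = 0%C) -> Csum u = 0%C.
Proof.
  intros H. unfold Csum. apply injective_projections; simpl; apply Series_0; intros n; now rewrite H.
Qed.

Lemma is_series_single (j : nat) (x : R) : is_series (fun n => if Nat.eqb n j then x else 0) x.
Proof.
  assert (Q : forall n, sum_n (fun n => if Nat.eqb n j then x else 0) n = if Nat.leb j n then x else 0).
  { induction n as [|n IH].
    - rewrite sum_O. destruct j; reflexivity.
    - rewrite sum_Sn, IH. change plus with Rplus.
      destruct (Nat.eqb_spec (S n) j), (Nat.leb_spec j n), (Nat.leb_spec j (S n)); try lia; lra. }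
  assert (L : is_lim_seq (sum_n (fun n => if Nat.eqb n j then x else 0)) (Finite x)); [|exact L].
  apply (is_lim_seq_ext_loc (fun _ => x)); [|apply is_lim_seq_const].
  exists j. intros n Hn. rewrite Q. destruct (Nat.leb_spec j n); [auto|lia].
Qed.

Lemma summ_single (j : nat) (x : C) : summ (fun n => if Nat.eqb n j then x else 0%C).
Proof.
  apply (ex_series_ext (fun n => if Nat.eqb n j then Cmod x else 0)).
  - intros n. destruct (Nat.eqb n j); auto. now rewrite Cmod_0.
  - eexists. apply is_series_single.
Qed.

Lemma Csum_single (j : nat) (x : C) : Csum (fun n => if Nat.eqb n j then x else 0%C) = x.
Proof.
  unfold Csum. apply injective_projections; simpl; apply is_series_unique;
  [apply (is_series_ext (fun n => if Nat.eqb n j then fst x else 0))|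
   apply (is_series_ext (fun n => if Nat.eqb n j then snd x else 0))];
  try apply is_series_single; intros n; now destruct (Nat.eqb n j).
Qed.

Definition drop (j : nat) (u : nat -> C) (n : nat) : C := if Nat.eqb n j then 0%C else u n.

Lemma drop_le (j : nat) (u : nat -> C) (n : nat) : Cmod (drop j u n) <= Cmod (u n).
Proof. unfold drop. destruct (Nat.eqb n j); [rewrite Cmod_0; apply Cmod_ge_0|lra]. Qed.

Lemma summ_drop (j : nat) (u : nat -> C) : summ u -> summ (drop j u).
Proof. intros H. apply (summ_dom _ _ (drop_le j u)). exact H. Qed.

Lemma Csum_drop (j : nat) (u : nat -> C) : summ u -> Csum u = (u j + Csum (drop j u))%C.
Proof.
  intros H. rewrite <- (Csum_single j (u j)) at 1.
  rewrite <- Csum_plus by (auto using summ_drop, summ_single).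
  apply Csum_ext. intros n. unfold drop. destruct (Nat.eqb_spec n j); subst; ring.
Qed.

Lemma ex_series_eventually_0 (a : nat -> R) (N : nat) :
  (forall n, (N <= n)%nat -> a n = 0) -> ex_series a.
Proof.
  intros H. apply (ex_series_incr_n (K := R_AbsRing) (V := R_NormedModule) a N).
  apply (ex_series_ext (fun _ => 0)); [intros n; symmetry; apply H; lia|].
  exists 0. assert (L : is_lim_seq (sum_n (fun _ => 0)) (Finite 0)); [|exact L].
  apply (is_lim_seq_ext (fun _ => 0)); [|apply is_lim_seq_const].
  intros n. rewrite sum_n_const. ring.
Qed.

(** * Cauchy transforms away from their poles *)

Definition CT (t c : nat -> C) (z : C) : C := Csum (fun n => c n / (z - t n))%C.

(** Absolute convergence of [CT t c] off the poles, as a condition on the coefficients alone; for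
    [c n = a n * sqrt (mu n)] it follows from the summability condition on [mu]. *)
Definition adm (t c : nat -> C) : Prop := ex_series (fun n => Cmod (c n) / Cmod (t n)).

(* [z] keeps a distance [d] from the poles of [CT t c]; it may be a [t n] with [c n = 0]. *)
Definition away (t c : nat -> C) (z : C) (d : R) : Prop :=
  forall n, c n = 0%C \/ d <= Cmod (z - t n).

Section Cauchy_transform.

Variable t : nat -> C.
Hypothesis t_inj : forall n m, t n = t m -> n = m.
Hypothesis t_lim : is_lim_seq (fun n => Cmod (t n)) p_infty.
Hypothesis t_ge2 : forall n, 2 <= Cmod (t n).

Lemma t_eventually (M : R) : exists N, forall n, (N <= n)%nat -> M < Cmod (t n).
Proof. apply is_lim_seq_spec in t_lim. destruct (t_lim M) as [N HN]. exists N. auto. Qed.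

Lemma dist_min_prefix (z : C) (P : nat -> Prop) (N : nat) :
  (forall n, P n -> z <> t n) ->
  exists d, 0 < d /\ forall n, (n < N)%nat -> P n -> d <= Cmod (z - t n).
Proof.
  intros HP. induction N as [|N (d & Hd & IH)].
  { exists 1. split; [lra|]. lia. }
  destruct (classic (P N)) as [p|p].
  - exists (Rmin d (Cmod (z - t N))). split.
    { apply Rmin_pos; auto. now apply Cmod_sub_pos, HP. }
    intros n Hn Pn. assert (L1 := Rmin_l d (Cmod (z - t N))). assert (L2 := Rmin_r d (Cmod (z - t N))).
    destruct (Nat.eq_dec n N) as [->|Ne]; auto. specialize (IH n ltac:(lia) Pn). lra.
  - exists d. split; auto. intros n Hn Pn. apply IH; auto.
    assert (n <> N) by (intros ->; auto). lia.
Qed.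

Lemma t_dist_pos (z : C) (P : nat -> Prop) :
  (forall n, P n -> z <> t n) -> exists d, 0 < d /\ forall n, P n -> d <= Cmod (z - t n).
Proof.
  intros HP. destruct (t_eventually (Cmod z + 1)) as [N HN].
  destruct (dist_min_prefix z P N HP) as (d & Hd & H).
  exists (Rmin d 1). split; [apply Rmin_pos; lra|]. intros n Pn.
  assert (L1 := Rmin_l d 1). assert (L2 := Rmin_r d 1).
  destruct (Nat.lt_ge_cases n N) as [L|L].
  - specialize (H n L Pn). lra.
  - specialize (HN n L). rewrite Cmod_sub_sym. assert (K := Cmod_triangle_rev (t n) z). lra.
Qed.

Lemma away_off (c : nat -> C) (z : C) : (forall n, z <> t n) -> exists d, 0 < d /\ away t c z d.
Proof.
  intros H. destruct (t_dist_pos z (fun _ => True)) as (d & Hd & K); [auto|].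
  exists d. split; auto. intros n. right. apply K; auto.
Qed.

Lemma away_neq (c : nat -> C) (z : C) :
  (forall n, c n <> 0%C -> z <> t n) -> exists d, 0 < d /\ away t c z d.
Proof.
  intros H. destruct (t_dist_pos z (fun n => c n <> 0%C)) as (d & Hd & K); [auto|].
  exists d. split; auto. intros n. destruct (classic (c n = 0%C)); auto.
Qed.

Lemma away_near (c : nat -> C) (z w : C) (d : R) :
  away t c z d -> Cmod (w - z) < d / 2 -> away t c w (d / 2).
Proof.
  intros H Hw n. destruct (H n) as [E|E]; auto. right.
  replace (z - t n)%C with ((w - t n) - (w - z))%C in E by ring.
  assert (K := Cmod_triangle_sub (w - t n) (w - z)). lra.
Qed.

(** From [|t n| <= |z - t n| + |z|] and [|z| <= (|z| / d) |z - t n|]. *)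
Lemma CT_term_bound (c : nat -> C) (z : C) (d : R) (n : nat) : 0 < d -> away t c z d ->
  Cmod (c n / (z - t n)) <= (1 + Cmod z / d) * (Cmod (c n) / Cmod (t n)).
Proof.
  intros Hd H. specialize (t_ge2 n). assert (Hz := Cmod_ge_0 z).
  assert (Hzd : 0 <= Cmod z / d) by (apply Rmult_le_pos; [auto|left; now apply Rinv_0_lt_compat]).
  destruct (H n) as [E|E].
  { rewrite E. unfold Cdiv. rewrite Cmult_0_l, Cmod_0. unfold Rdiv. lra. }
  assert (N : (z - t n)%C <> 0%C) by (apply Cmod_gt_0; lra).
  rewrite Cmod_div by auto. unfold Rdiv at 1.
  replace ((1 + Cmod z / d) * (Cmod (c n) / Cmod (t n)))
    with (Cmod (c n) * ((1 + Cmod z / d) / Cmod (t n))) by (field; lra).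
  apply Rmult_le_compat_l; [apply Cmod_ge_0|].
  apply Rmult_le_reg_r with (Cmod (z - t n) * Cmod (t n)).
  { apply Rmult_lt_0_compat; lra. }
  replace (/ Cmod (z - t n) * (Cmod (z - t n) * Cmod (t n))) with (Cmod (t n)) by (field; lra).
  replace ((1 + Cmod z / d) / Cmod (t n) * (Cmod (z - t n) * Cmod (t n)))
    with (Cmod (z - t n) + Cmod z / d * Cmod (z - t n)) by (field; lra).
  assert (K := Cmod_triangle_rev (t n) z). rewrite Cmod_sub_sym in K.
  assert (Cmod z <= Cmod z / d * Cmod (z - t n)); [|lra].
  replace (Cmod z) with (Cmod z / d * d) at 1 by (field; lra).
  apply Rmult_le_compat_l; auto.
Qed.

Lemma summ_CT (c : nat -> C) (z : C) (d : R) : adm t c -> 0 < d -> away t c z d ->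
  summ (fun n => c n / (z - t n))%C.
Proof.
  intros Hc Hd H. eapply summ_dom.
  - intros n. apply (CT_term_bound c z d n Hd H).
  - apply ex_series_Rscal. exact Hc.
Qed.

Lemma CT_bound (c : nat -> C) (z : C) (d : R) : adm t c -> 0 < d -> away t c z d ->
  Cmod (CT t c z) <= (1 + Cmod z / d) * Series (fun n => Cmod (c n) / Cmod (t n)).
Proof.
  intros Hc Hd H. rewrite <- Series_scal_l. apply Csum_dom.
  - intros n. now apply CT_term_bound.
  - apply ex_series_Rscal. exact Hc.
Qed.

Lemma CT_ext (c c' : nat -> C) (z : C) : (forall n, c n = c' n) -> CT t c z = CT t c' z.
Proof. intros H. apply Csum_ext. intros n. now rewrite H. Qed.

Lemma CT_0 (c : nat -> C) (z : C) : (forall n, c n = 0%C) -> CT t c z = 0%C.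
Proof. intros H. apply Csum_0. intros n. rewrite H. unfold Cdiv. ring. Qed.

Lemma adm_dom (c c' : nat -> C) (K : R) :
  (forall n, Cmod (c' n) <= K * Cmod (c n)) -> adm t c -> adm t c'.
Proof.
  intros H. unfold adm. intros Hc.
  apply (ex_series_dom _ (fun n => K * (Cmod (c n) / Cmod (t n)))).
  - intros n. specialize (H n). specialize (t_ge2 n). split.
    + apply Rmult_le_pos; [apply Cmod_ge_0|]. left. apply Rinv_0_lt_compat. lra.
    + unfold Rdiv. rewrite <- Rmult_assoc. apply Rmult_le_compat_r; auto.
      left. apply Rinv_0_lt_compat. lra.
  - apply ex_series_Rscal. exact Hc.
Qed.

Lemma adm_0_finite (c : nat -> C) (N : nat) : (forall n, (N <= n)%nat -> c n = 0%C) -> adm t c.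
Proof.
  intros H. apply (ex_series_eventually_0 _ N). intros n Hn. rewrite H, Cmod_0 by auto.
  unfold Rdiv. ring.
Qed.

Lemma CT_neq_of_away (c : nat -> C) (z : C) (d : R) (n : nat) : 0 < d -> away t c z d ->
  c n = 0%C \/ (z - t n)%C <> 0%C.
Proof. intros Hd H. destruct (H n); auto. right. apply Cmod_gt_0. lra. Qed.

(** Partial fractions, term by term. The last term drops out when [w] is a zero of the transform.
    The point [w] may also be some [t n] with [c n = 0]; then the correction is a new pole at
    [t n]. *)
Lemma CT_mobius (c : nat -> C) (p q z w : C) (d e : R) :
  adm t c -> 0 < d -> away t c z d -> 0 < e -> away t c w e -> z <> w ->
  CT t (fun n => c n * ((p * t n + q) / (t n - w)))%C z =
  ((p * z + q) / (z - w) * CT t c z - (p * w + q) / (z - w) * CT t c w)%C.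
Proof.
  intros Hc Hd Az He Aw Hzw. assert (N := Csub_neq0 _ _ Hzw).
  assert (Sz := summ_CT c z d Hc Hd Az). assert (Sw := summ_CT c w e Hc He Aw).
  unfold CT at 2 3. 
  transitivity (Csum (fun n => (p * z + q) / (z - w) * (c n / (z - t n))
     + (- ((p * w + q) / (z - w))) * (c n / (w - t n))))%C.
  - apply Csum_ext. intros n.
    destruct (CT_neq_of_away c z d n Hd Az) as [E|E]; [rewrite E; unfold Cdiv; ring|].
    destruct (CT_neq_of_away c w e n He Aw) as [E'|E']; [rewrite E'; unfold Cdiv; ring|].
    assert ((t n - w)%C <> 0%C).
    { intros Z. apply E'. replace (w - t n)%C with (- (t n - w))%C by ring. rewrite Z. ring. }
    field. auto.
  - rewrite Csum_plus, !Csum_scal by auto using summ_scal. ring.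
Qed.

(** The factor equals [p + (p w + q) / (t n - w)], and the denominator is at least [e] wherever
    [c n] does not vanish. *)
Lemma mobius_factor_bounded (c : nat -> C) (p q w : C) (e : R) : 0 < e -> away t c w e ->
  exists K, 0 <= K /\ forall n, Cmod (c n * ((p * t n + q) / (t n - w)))%C <= K * Cmod (c n).
Proof.
  intros He Aw.
  exists (Cmod p + Cmod (p * w + q) / e).
  assert (K1 := Cmod_ge_0 p). assert (K2 := Cmod_ge_0 (p * w + q)).
  assert (K3 : 0 <= Cmod (p * w + q) / e) by (apply Rmult_le_pos; [auto|left; now apply Rinv_0_lt_compat]).
  split; [lra|]. intros n. destruct (Aw n) as [E|E].
  { rewrite E, Cmult_0_l, Cmod_0. lra. }
  assert (N : (t n - w)%C <> 0%C) by (apply Cmod_gt_0; rewrite Cmod_sub_sym; lra).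
  rewrite Cmod_mult, Rmult_comm. apply Rmult_le_compat_r; [apply Cmod_ge_0|].
  replace ((p * t n + q) / (t n - w))%C with (p + (p * w + q) / (t n - w))%C by (field; auto).
  eapply Rle_trans; [apply Cmod_triangle|]. apply Rplus_le_compat_l.
  rewrite Cmod_div by auto. apply Rmult_le_compat_l; auto.
  apply Rinv_le_contravar; auto. rewrite Cmod_sub_sym. auto.
Qed.

Lemma CT_drop (c : nat -> C) (z : C) (d : R) (j : nat) : adm t c -> 0 < d -> away t c z d ->
  CT t c z = (c j / (z - t j) + CT t (drop j c) z)%C.
Proof.
  intros Hc Hd H. unfold CT. rewrite (Csum_drop j) by (now apply (summ_CT c z d)).
  f_equal. apply Csum_ext. intros n. unfold drop. destruct (Nat.eqb n j); auto. unfold Cdiv; ring.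
Qed.

Lemma adm_drop (c : nat -> C) (j : nat) : adm t c -> adm t (drop j c).
Proof. apply (adm_dom _ _ 1). intros n. rewrite Rmult_1_l. apply drop_le. Qed.

Lemma away_drop_t (c : nat -> C) (j : nat) : exists d, 0 < d /\ away t (drop j c) (t j) d.
Proof.
  apply away_neq. intros n Hn. unfold drop in Hn. destruct (Nat.eqb_spec n j); [easy|].
  intros E. apply t_inj in E. auto.
Qed.

(** The difference quotient of a Cauchy transform is itself a Cauchy transform, with coefficients
    [- c n / (z - t n)]. Continuity, differentiability and Lipschitz bounds all follow from bounds
    on this second transform. *)
Lemma CT_difference (c : nat -> C) (z w : C) (d e : R) :
  adm t c -> 0 < d -> away t c z d -> 0 < e -> away t c w e ->
  CT t c w = (CT t c z + CT t (fun n => - (1) * (c n / (z - t n))) w * (w - z))%C.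
Proof.
  intros Hc Hd Az He Aw.
  assert (Sz := summ_CT c z d Hc Hd Az). assert (Sw := summ_CT c w e Hc He Aw).
  unfold CT.
  assert (Ss : summ (fun n => - (1) * (c n / (z - t n)) / (w - t n))%C).
  { apply (summ_dom _ (fun n => / e * Cmod (c n / (z - t n)))).
    * intros n. destruct (Aw n) as [E|E].
      { rewrite E. unfold Cdiv. rewrite !Cmult_0_l, Cmult_0_r, Cmult_0_l, Cmod_0. lra. }
      assert (N : (w - t n)%C <> 0%C) by (apply Cmod_gt_0; lra).
      rewrite Cmod_div, Cmod_mult, Cmod_m1 by auto. unfold Rdiv. rewrite Rmult_1_l, Rmult_comm.
      apply Rmult_le_compat_r; [apply Cmod_ge_0|]. apply Rinv_le_contravar; auto.
    * apply ex_series_Rscal. exact Sz. }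
  replace (Csum (fun n => c n / (w - t n)))%C with
   (Csum (fun n => c n / (z - t n) + (w - z) * (- (1) * (c n / (z - t n)) / (w - t n))))%C.
  - rewrite Csum_plus, Csum_scal; auto using summ_scal. ring.
  - apply Csum_ext. intros n.
    destruct (CT_neq_of_away c z d n Hd Az) as [E|E]; [rewrite E; unfold Cdiv; ring|].
    destruct (CT_neq_of_away c w e n He Aw) as [E'|E']; [rewrite E'; unfold Cdiv; ring|].
    field. auto.
Qed.

Lemma adm_slope (c : nat -> C) (z : C) (d : R) : adm t c -> 0 < d -> away t c z d ->
  adm t (fun n => - (1) * (c n / (z - t n)))%C.
Proof.
  intros Hc Hd Az. apply (adm_dom c _ (/ d)); auto. intros n.
  destruct (Az n) as [E|E].
  { rewrite E. unfold Cdiv. rewrite Cmult_0_l, Cmult_0_r, Cmod_0. lra. }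
  assert (N : (z - t n)%C <> 0%C) by (apply Cmod_gt_0; lra).
  rewrite Cmod_mult, Cmod_m1, Cmod_div by auto. unfold Rdiv. rewrite Rmult_1_l, Rmult_comm.
  apply Rmult_le_compat_r; [apply Cmod_ge_0|]. apply Rinv_le_contravar; auto.
Qed.

Lemma away_slope (c : nat -> C) (z w : C) (d : R) : away t c w d ->
  away t (fun n => - (1) * (c n / (z - t n)))%C w d.
Proof. intros H n. destruct (H n) as [E|E]; auto. left. rewrite E. unfold Cdiv. ring. Qed.

Lemma CT_bounded_near (c : nat -> C) (z : C) (d : R) : adm t c -> 0 < d -> away t c z d ->
  exists K, 0 < K /\ forall w, Cmod (w - z) < d / 2 -> Cmod (CT t c w) <= K.
Proof.
  intros Hc Hd Az. set (S := Series (fun n => Cmod (c n) / Cmod (t n))).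
  assert (HS : 0 <= S).
  { apply Series_nonneg; auto. intros n. specialize (t_ge2 n). 
    apply Rmult_le_pos; [apply Cmod_ge_0|]. left. apply Rinv_0_lt_compat. lra. }
  assert (Hz := Cmod_ge_0 z).
  assert (Hq : 0 <= (Cmod z + d) / (d / 2)).
  { apply Rmult_le_pos; [lra|]. left. apply Rinv_0_lt_compat. lra. }
  exists ((1 + (Cmod z + d) / (d / 2)) * S + 1). split; [nra|].
  intros w Hw. eapply Rle_trans; [apply (CT_bound c w (d / 2)); auto; [lra|now apply (away_near c z)]|].
  fold S.
  assert (Cmod w <= Cmod z + d).
  { assert (K := Cmod_triangle_rev w z). lra. }
  assert (Cmod w / (d / 2) <= (Cmod z + d) / (d / 2)).
  { apply Rmult_le_compat_r; auto. left. apply Rinv_0_lt_compat. lra. }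
  nra.
Qed.

Lemma CT_ccont (c : nat -> C) (z : C) (d : R) : adm t c -> 0 < d -> away t c z d ->
  ccont (CT t c) z.
Proof.
  intros Hc Hd Az.
  destruct (CT_bounded_near _ z d (adm_slope c z d Hc Hd Az) Hd (away_slope c z z d Az)) as (K & HK & H).
  intros e He. exists (Rmin (d / 2) (e / K)). split.
  { apply Rmin_pos; [lra|]. now apply Rdiv_lt_0_compat. }
  intros w Hw. assert (L1 := Rmin_l (d / 2) (e / K)). assert (L2 := Rmin_r (d / 2) (e / K)).
  assert (Aw := away_near c z w d Az ltac:(lra)).
  rewrite (CT_difference c z w d (d / 2) Hc Hd Az ltac:(lra) Aw).
  match goal with |- Cmod (?x + ?y - ?x) < _ => replace (x + y - x)%C with y by ring end.
  rewrite Cmod_mult. specialize (H w ltac:(lra)).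
  apply Rle_lt_trans with (K * Cmod (w - z)); [apply Rmult_le_compat_r; [apply Cmod_ge_0|auto]|].
  replace e with (K * (e / K)) by (field; lra). apply Rmult_lt_compat_l; lra.
Qed.

Lemma CT_cder (c : nat -> C) (z : C) (d : R) : adm t c -> 0 < d -> away t c z d ->
  exists l, cder (CT t c) z l.
Proof.
  intros Hc Hd Az. eexists.
  apply (cder_intro_loc _ (CT t (fun n => - (1) * (c n / (z - t n)))%C) z (d / 2)); [lra| |].
  - intros w Hw. apply (CT_difference c z w d (d / 2)); auto; [lra|]. apply (away_near c z w d); auto.
  - apply (CT_ccont _ z d); auto; [now apply (adm_slope c z d)|now apply away_slope].
Qed.

Lemma near_t_off (j : nat) : exists d, 0 < d /\
  forall z, z <> t j -> Cmod (z - t j) < d -> forall n, z <> t n.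
Proof.
  destruct (t_dist_pos (t j) (fun n => n <> j)) as (d & Hd & H).
  { intros n Hn E. apply Hn. symmetry. now apply t_inj. }
  exists d. split; auto. intros z Hz Hzd n ->.
  destruct (Nat.eq_dec n j) as [->|N]; [easy|]. specialize (H n N). rewrite Cmod_sub_sym in H. lra.
Qed.

(** Close to [t j] the other terms stay bounded while [c j / (z - t j)] blows up unless
    [c j = 0]. *)
Lemma CT_eq0 (c : nat -> C) : adm t c -> (forall z, (forall n, z <> t n) -> CT t c z = 0%C) ->
  forall n, c n = 0%C.
Proof.
  intros Hc H j. apply NNPP. intros N. assert (Hp := proj1 (Cmod_gt_0 _) N).
  destruct (away_drop_t c j) as (d & Hd & Ad).
  destruct (CT_bounded_near _ _ d (adm_drop c j Hc) Hd Ad) as (K & HK & HB).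
  destruct (near_t_off j) as (e & He & Hoff).
  set (m := Rmin (Rmin (d / 2) e) (Cmod (c j) / K) / 2).
  assert (H0 : 0 < Rmin (Rmin (d / 2) e) (Cmod (c j) / K)).
  { repeat apply Rmin_pos; auto; [lra|]. now apply Rdiv_lt_0_compat. }
  assert (L1 := Rmin_l (Rmin (d / 2) e) (Cmod (c j) / K)). assert (L2 := Rmin_r (Rmin (d / 2) e) (Cmod (c j) / K)).
  assert (L3 := Rmin_l (d / 2) e). assert (L4 := Rmin_r (d / 2) e).
  set (z := (t j + m)%C).
  assert (Ez : (z - t j = RtoC m)%C) by (unfold z; ring).
  assert (Em : Cmod (z - t j) = m) by (rewrite Ez, Cmod_R; apply Rabs_pos_eq; unfold m; lra).
  assert (Nz : z <> t j) by (intros E; rewrite E, Cmod_self_sub in Em; unfold m in Em; lra).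
  assert (Off := Hoff z Nz ltac:(rewrite Em; unfold m; lra)).
  destruct (away_off c z Off) as (d' & Hd' & Az).
  assert (E := H z Off). rewrite (CT_drop c z d' j Hc Hd' Az) in E.
  assert (E2 : c j = (- (CT t (drop j c) z * (z - t j)))%C).
  { assert (Nz' := Csub_neq0 _ _ Nz). apply (f_equal (fun x => x * (z - t j))%C) in E.
    replace ((c j / (z - t j) + CT t (drop j c) z) * (z - t j))%C
     with (c j + CT t (drop j c) z * (z - t j))%C in E by (field; auto).
    replace (c j) with (c j + CT t (drop j c) z * (z - t j) - CT t (drop j c) z * (z - t j))%C by ring.
    rewrite E. ring. }
  assert (E3 := f_equal Cmod E2). rewrite Cmod_opp, Cmod_mult, Em in E3.
  specialize (HB z ltac:(rewrite Em; unfold m; lra)).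
  assert (K * m < Cmod (c j)).
  { apply Rlt_le_trans with (K * (Cmod (c j) / K)); [apply Rmult_lt_compat_l; unfold m; lra|].
    right. field. lra. }
  assert (Cmod (CT t (drop j c) z) * m <= K * m) by (apply Rmult_le_compat_r; unfold m; lra).
  lra.
Qed.

(** From [z / (z - t n) = 1 + t n / (z - t n)]; the constant that splits off is the moment of order
    zero. *)
Lemma CT_times (c : nat -> C) (z : C) (d : R) : adm t c -> summ c -> 0 < d -> away t c z d ->
  (z * CT t c z)%C = (Csum c + CT t (fun n => c n * t n)%C z)%C.
Proof.
  intros Hc Sc Hd Az. assert (Sz := summ_CT c z d Hc Hd Az). unfold CT.
  rewrite <- Csum_scal by auto.
  replace (Csum (fun n => c n * t n / (z - t n)))%C with
    (Csum (fun n => z * (c n / (z - t n)) + (- (1)) * c n))%C.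
  - rewrite Csum_plus, (Csum_scal (- (1))) by (auto using summ_scal). ring.
  - apply Csum_ext. intros n.
    destruct (CT_neq_of_away c z d n Hd Az) as [E|E]; [rewrite E; unfold Cdiv; ring|]. field. auto.
Qed.

End Cauchy_transform.

(** * Elements of the space and their zeros *)

Definition l2 (a : nat -> C) : Prop := ex_series (fun n => Cmod (a n) ^ 2).

Definition coef (mu : nat -> R) (a : nat -> C) (n : nat) : C := (a n * RtoC (sqrt (mu n)))%C.

(* The zero set of [A z * CT t c z], without reference to [A]: at [t n] the simple zero of [A]
   cancels the pole. *)
Definition zero_of (t c : nat -> C) (z : C) : Prop :=
  ((forall n, z <> t n) /\ CT t c z = 0%C) \/ exists n, z = t n /\ c n = 0%C.

Definition localized (t c : nat -> C) (r : nat -> R) : Prop :=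
  finite_set (fun z => zero_of t c z /\ forall n, ~ Defs.disc (t n) (r n) z) /\
  finite_set (fun n => ~ exists! z : C, Defs.disc (t n) (r n) z /\ zero_of t c z).

Lemma amgm (x y : R) : 2 * (x * y) <= x ^ 2 + y ^ 2.
Proof. assert (H := Rle_0_sqr (x - y)). unfold Rsqr in H. simpl. lra. Qed.

Section Space.

Variables (t : nat -> C) (A : C -> C) (mu : nat -> R).
Hypothesis hH : CdB_data t A mu.
Hypothesis t_ge2 : forall n, 2 <= Cmod (t n).

Let t_inj := CdB_distinct _ _ _ hH.
Let t_lim := CdB_infty _ _ _ hH.

Lemma Cmod_coef (a : nat -> C) (n : nat) : Cmod (coef mu a n) = Cmod (a n) * sqrt (mu n).
Proof. unfold coef. rewrite Cmod_mult, Cmod_R, Rabs_pos_eq; auto. apply sqrt_pos. Qed.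

(** By the inequality between arithmetic and geometric means, with [|t n| >= 2] turning
    [|t n|^2 + 1] into at most [2 |t n|^2]. *)
Lemma coef_adm (a : nat -> C) : l2 a -> adm t (coef mu a).
Proof.
  intros Ha. apply (ex_series_dom _ (fun n => Cmod (a n) ^ 2 + 2 * (mu n / (Cmod (t n) ^ 2 + 1)))).
  - intros n. rewrite Cmod_coef. specialize (t_ge2 n). assert (Hm := CdB_mu_pos _ _ _ hH n).
    assert (Q := amgm (Cmod (a n)) (sqrt (mu n) / Cmod (t n))).
    replace ((sqrt (mu n) / Cmod (t n)) ^ 2) with (mu n / Cmod (t n) ^ 2) in Q.
    2:{ unfold Rdiv. rewrite Rpow_mult_distr, pow2_sqrt, pow_inv by lra. auto. }
    assert (Q2 : mu n / Cmod (t n) ^ 2 <= 2 * (mu n / (Cmod (t n) ^ 2 + 1))).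
    { assert (4 <= Cmod (t n) ^ 2) by (simpl; nra).
      replace (2 * (mu n / (Cmod (t n) ^ 2 + 1))) with (mu n * / ((Cmod (t n) ^ 2 + 1) / 2)) by (field; lra).
      apply Rmult_le_compat_l; [lra|]. apply Rinv_le_contravar; lra. }
    assert (P1 := Cmod_ge_0 (a n)). assert (P2 := sqrt_pos (mu n)).
    assert (P3 : 0 < / Cmod (t n)) by (apply Rinv_0_lt_compat; lra).
    assert (P4 : 0 <= sqrt (mu n) / Cmod (t n)) by (apply Rmult_le_pos; lra).
    unfold Rdiv at 1 2. rewrite Rmult_assoc. fold (sqrt (mu n) / Cmod (t n)).
    split; [now apply Rmult_le_pos|].
    assert (0 <= Cmod (a n) * (sqrt (mu n) / Cmod (t n))) by (now apply Rmult_le_pos). lra.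
  - apply ex_series_Rplus; [exact Ha|].
    apply ex_series_Rscal, (CdB_mu_sum _ _ _ hH).
Qed.

Lemma coef_0 (a : nat -> C) (n : nat) : coef mu a n = 0%C <-> a n = 0%C.
Proof.
  unfold coef. split; intros E.
  - apply NNPP. intros N. apply (Cmult_neq_0 (a n) (sqrt (mu n)) N); auto.
    intros Z. apply RtoC_inj in Z. assert (H := sqrt_lt_R0 _ (CdB_mu_pos _ _ _ hH n)). lra.
  - rewrite E. ring.
Qed.

Lemma A_cder (z : C) : exists l, cder A z l.
Proof. apply ex_derive_cder, (CdB_entire _ _ _ hH). Qed.

Lemma A_zero_t (n : nat) : A (t n) = 0%C.
Proof. apply (CdB_zeros _ _ _ hH). eauto. Qed.

Lemma A_neq0 (z : C) : (forall n, z <> t n) -> A z <> 0%C.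
Proof. intros H E. apply (CdB_zeros _ _ _ hH) in E. destruct E as [n E]. now apply (H n). Qed.

Lemma A_local (j : nat) : exists phi, ccont phi (t j) /\ phi (t j) = C_derive A (t j) /\
  (forall w, A w = (phi w * (w - t j))%C) /\ exists m, cder phi (t j) m.
Proof.
  assert (H : is_derive (K := C_AbsRing) (V := C_NormedModule) A (t j) (C_derive A (t j))).
  { apply C_derive_correct; [exact (t j)|]. apply (CdB_entire _ _ _ hH). }
  apply is_derive_cder in H. destruct H as (phi & Hp & El & Hf).
  exists phi. repeat split; auto.
  - intros w. rewrite (Hf w), A_zero_t. ring.
  - apply (cder_slope A phi (t j)); auto. apply A_cder.
Qed.

(** The zero of [A] cancels the pole at [t j]. The right-hand side also makes sense at [t j], and
    with the slope of [A] from [A_local] as [phi] it is differentiable there. *)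
Lemma local_form (c : nat -> C) (phi : C -> C) (j : nat) (z : C) : adm t c ->
  (forall n, z <> t n) -> (forall w, A w = (phi w * (w - t j))%C) ->
  (A z * CT t c z = phi z * (c j + (z - t j) * CT t (drop j c) z))%C.
Proof.
  intros Hc Hz Hphi. destruct (away_off t t_lim c z Hz) as (d & Hd & Az).
  rewrite (CT_drop t t_ge2 c z d j Hc Hd Az), (Hphi z). field. now apply Csub_neq0.
Qed.

Lemma drop_ccont (c : nat -> C) (j : nat) : adm t c -> ccont (CT t (drop j c)) (t j).
Proof.
  intros Hc. destruct (away_drop_t t t_inj t_lim c j) as (d & Hd & Ad).
  apply (CT_ccont t t_ge2 _ _ d); auto. now apply adm_drop.
Qed.

(** Continuity forces the value at [t j]. As the zeros of [A] are simple, [F] vanishes at [t j]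
    exactly when [c j = 0], which is the second alternative in [zero_of]. *)
Lemma space_values (F : C -> C) (c : nat -> C) : adm t c -> entire F ->
  (forall z, (forall n, z <> t n) -> F z = (A z * CT t c z)%C) ->
  forall j, F (t j) = (C_derive A (t j) * c j)%C.
Proof.
  intros Hc HF E j. destruct (A_local j) as (phi & Cp & Ep & Hp & _).
  destruct (near_t_off t t_inj t_lim j) as (e & He & Hoff).
  rewrite (ccont_eq_punctured F (fun z => phi z * (c j + (z - t j) * CT t (drop j c) z))%C (t j) e He).
  - rewrite Ep. ring.
  - intros w Hw Hwe. rewrite E by (apply Hoff; auto). apply local_form; auto.
  - destruct (proj1 (ex_derive_cder _ _) (HF (t j))) as [l Hl]. eapply cder_ccont, Hl.
  - apply ccont_mult; auto. apply ccont_plus; [apply ccont_const|].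
    apply ccont_mult; [|now apply drop_ccont]. apply ccont_plus; [apply ccont_id|apply ccont_const].
Qed.

Lemma zeros_zero_of (F : C -> C) (c : nat -> C) : adm t c -> entire F ->
  (forall z, (forall n, z <> t n) -> F z = (A z * CT t c z)%C) ->
  forall z, zeros F z <-> zero_of t c z.
Proof.
  intros Hc HF E z. unfold zeros, zero_of. assert (V := space_values F c Hc HF E). split.
  - intros Z. destruct (classic (exists n, z = t n)) as [[n ->]|N].
    + right. exists n. split; auto. rewrite V in Z. apply NNPP. intros Nc.
      apply (Cmult_neq_0 _ _ (CdB_simple _ _ _ hH n) Nc Z).
    + left. assert (Off : forall n, z <> t n) by (intros n En; apply N; eauto).
      split; auto. rewrite E in Z by auto. apply NNPP. intros Nc.
      apply (Cmult_neq_0 _ _ (A_neq0 z Off) Nc Z).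
  - intros [[Off Z]|(n & -> & Z)].
    + rewrite E, Z by auto. ring.
    + rewrite V, Z. ring.
Qed.

Lemma space_coef (F : C -> C) : CdB_space t A mu F -> exists a, l2 a /\
  forall z, (forall n, z <> t n) -> F z = (A z * CT t (coef mu a) z)%C.
Proof.
  intros (HF & a & Ha & H). exists a. split; auto. intros z Hz.
  destruct (H z Hz) as (S & HS & E). rewrite E. f_equal.
  now apply (is_series_Csum _ _ HS).
Qed.

Definition element (c : nat -> C) (z : C) : C :=
  match excluded_middle_informative (exists n, z = t n) with
  | left H => let n := proj1_sig (constructive_indefinite_description _ H) in
              (C_derive A (t n) * c n)%C
  | right _ => (A z * CT t c z)%C
  end.

Lemma element_off (c : nat -> C) (z : C) : (forall n, z <> t n) -> element c z = (A z * CT t c z)%C.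
Proof.
  intros H. unfold element. destruct excluded_middle_informative as [[n E]|N]; auto.
  now destruct (H n).
Qed.

Lemma element_t (c : nat -> C) (j : nat) : element c (t j) = (C_derive A (t j) * c j)%C.
Proof.
  unfold element. destruct excluded_middle_informative as [H|N].
  - destruct (constructive_indefinite_description _ H) as [n E]. simpl. now rewrite (t_inj _ _ E).
  - destruct N. eauto.
Qed.

Lemma element_entire (c : nat -> C) : adm t c -> entire (element c).
Proof.
  intros Hc z. apply ex_derive_cder.
  destruct (classic (exists n, z = t n)) as [[j ->]|N].
  - destruct (A_local j) as (phi & Cp & Ep & Hp & m & Dp).
    destruct (near_t_off t t_inj t_lim j) as (e & He & Hoff).
    destruct (away_drop_t t t_inj t_lim c j) as (d & Hd & Ad).
    destruct (CT_cder t t_ge2 _ _ d (adm_drop t t_ge2 c j Hc) Hd Ad) as [l Dl].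
    eexists. apply (cder_ext_loc (fun z => phi z * (c j + (z + - t j) * CT t (drop j c) z))%C _ _ _ e He).
    + intros w Hw. destruct (classic (w = t j)) as [->|Nw].
      * rewrite element_t, Ep. ring.
      * rewrite element_off by now apply Hoff. symmetry. apply local_form; auto.
    + eapply cder_mult; [exact Dp|]. eapply cder_plus; [apply cder_const|].
      eapply (cder_mult (fun z => z + - t j)%C); [|exact Dl]. eapply cder_plus; [apply cder_id|apply cder_const].
  - assert (Off : forall n, z <> t n) by (intros n En; apply N; eauto).
    destruct (away_off t t_lim c z Off) as (d & Hd & Az).
    destruct (CT_cder t t_ge2 _ _ d Hc Hd Az) as [l Dl]. destruct (A_cder z) as [k Dk].
    destruct (t_dist_pos t t_lim z (fun _ => True)) as (e & He & Hoff); [auto|].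
    eexists. eapply (cder_ext_loc (fun w => A w * CT t c w)%C _ _ _ e He); [|eapply cder_mult; eauto].
    intros w Hw. symmetry. apply element_off. intros n ->. specialize (Hoff n I).
    rewrite Cmod_sub_sym in Hw. lra.
Qed.

Lemma element_space (a : nat -> C) : l2 a -> CdB_space t A mu (element (coef mu a)).
Proof.
  intros Ha. assert (Hc := coef_adm a Ha). split; [now apply element_entire|].
  exists a. split; auto. intros z Hz. exists (CT t (coef mu a) z). split; [|now apply element_off].
  destruct (away_off t t_lim (coef mu a) z Hz) as (d & Hd & Az).
  apply Csum_is_series. now apply (summ_CT t t_ge2 (coef mu a) z d).
Qed.

Lemma finite_set_iff {X : Type} (P Q : X -> Prop) :
  (forall x, P x <-> Q x) -> finite_set P -> finite_set Q.
Proof. intros H [l Hl]. exists l. intros x Hx. apply Hl, H, Hx. Qed.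

Lemma localized_zeros (F : C -> C) (c : nat -> C) (r : nat -> R) :
  (forall z, zeros F z <-> zero_of t c z) ->
  (finite_set (fun z => zeros F z /\ forall n : nat, ~ Defs.disc (t n) (r n) z) /\
   finite_set (fun n => ~ exists! z : C, Defs.disc (t n) (r n) z /\ zeros F z)) <-> localized t c r.
Proof.
  intros E. unfold localized.
  assert (E1 : forall z, (zeros F z /\ forall n : nat, ~ Defs.disc (t n) (r n) z) <->
     (zero_of t c z /\ forall n : nat, ~ Defs.disc (t n) (r n) z)) by (intros z; now rewrite E).
  assert (E2 : forall n, (~ exists! z : C, Defs.disc (t n) (r n) z /\ zeros F z) <->
     ~ exists! z : C, Defs.disc (t n) (r n) z /\ zero_of t c z).
  { intros n. unfold unique. setoid_rewrite E. reflexivity. }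
  split; intros [H1 H2]; split; eapply finite_set_iff; try eassumption.
  - exact E1.
  - exact E2.
  - intros z. symmetry. apply E1.
  - intros n. symmetry. apply E2.
Qed.

(** Elements correspond to coefficient sequences, and uniqueness of the coefficients of a Cauchy
    transform matches nonzero elements with nonzero sequences. From here on zeros are described by
    [zero_of] and the values of [A] no longer matter. *)
Lemma strong_localization_coef :
  strong_localization t A mu <->
  exists r : nat -> R,
    (forall n, 0 < r n) /\
    (forall n m, n <> m -> forall z, ~ (Defs.disc (t n) (r n) z /\ Defs.disc (t m) (r m) z)) /\
    is_lim_seq r 0 /\
    forall a, l2 a -> (exists n, a n <> 0%C) -> localized t (coef mu a) r.
Proof.
  split; intros (r & Hr & Hd & Hl & H); exists r; repeat (split; [assumption|]).
  - intros a Ha [n Hn]. assert (Hc := coef_adm a Ha).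
    assert (E := zeros_zero_of _ _ Hc (element_entire _ Hc) (element_off _)).
    apply (localized_zeros _ _ r E). apply H; [now apply element_space|].
    apply NNPP. intros N. apply Hn, coef_0.
    apply (CT_eq0 t t_inj t_lim t_ge2 (coef mu a) Hc).
    intros z Hz. apply NNPP. intros Nz. apply N. exists z. rewrite element_off by auto.
    apply Cmult_neq_0; auto. now apply A_neq0.
  - intros F HF [z0 Hz0]. destruct (space_coef F HF) as (a & Ha & E).
    assert (Hc := coef_adm a Ha).
    apply (localized_zeros F (coef mu a) r (zeros_zero_of F _ Hc (proj1 HF) E)).
    apply H; auto. apply NNPP. intros N. apply Hz0.
    assert (Z : forall n, coef mu a n = 0%C).
    { intros n. apply coef_0. apply NNPP. eauto. }
    apply (zeros_zero_of F _ Hc (proj1 HF) E). unfold zero_of.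
    destruct (classic (exists n, z0 = t n)) as [[n ->]|Nn].
    + right. exists n. split; auto.
    + left. split; [|now apply CT_0]. intros n En. apply Nn. eauto.
Qed.

End Space.

(** * A fixed point principle, zeros in bounded regions, and moments *)

Lemma infinite_set_fresh {X : Type} (P : X -> Prop) (l : list X) :
  ~ finite_set P -> exists x, P x /\ ~ In x l.
Proof.
  intros H. apply NNPP. intros N. apply H. exists l. intros x Hx. apply NNPP. intros Nx.
  apply N. eauto.
Qed.

Lemma finite_set_sub {X : Type} (P Q : X -> Prop) :
  (forall x, P x -> Q x) -> finite_set Q -> finite_set P.
Proof. intros H [l Hl]. exists l. auto. Qed.

Lemma finite_set_of_bounded (P : nat -> Prop) (N : nat) :
  (forall n, P n -> (n < N)%nat) -> finite_set P.
Proof. intros H. exists (seq 0 N). intros n Hn. apply in_seq. specialize (H n Hn). lia. Qed.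

Lemma Cinv_neq_0 (x : C) : x <> 0%C -> (/ x)%C <> 0%C.
Proof.
  intros H E. apply C1_nz. rewrite <- (Cinv_r x H), E. ring.
Qed.

(** Banach's principle on an open disc: as [Phi] maps the disc into the closed disc of half the
    radius, the limit of the iterates cannot escape to the boundary. *)
Lemma contraction_fixpoint (Phi : C -> C) (c : C) (r : R) : 0 < r ->
  (forall z, Defs.disc c r z -> Cmod (Phi z - c) <= r / 2) ->
  (forall z w, Defs.disc c r z -> Defs.disc c r w -> Cmod (Phi z - Phi w) <= / 2 * Cmod (z - w)) ->
  exists! z, Defs.disc c r z /\ Phi z = z.
Proof.
  unfold Defs.disc. intros Hr Hm Hc.
  set (x := fun k => Nat.iter k Phi c).
  assert (X0 : forall k, Cmod (x k - c) <= r / 2).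
  { induction k; [unfold x; simpl; rewrite Cmod_self_sub; lra|].
    change (x (S k)) with (Phi (x k)). apply Hm. lra. }
  assert (XS : forall k, Cmod (x (S k) - x k) <= r / 2 * (/ 2) ^ k).
  { induction k.
    - change (x 1%nat) with (Phi c). change (x O) with c. simpl. rewrite Rmult_1_r. apply Hm.
      rewrite Cmod_self_sub. lra.
    - change (x (S (S k))) with (Phi (x (S k))). change (x (S k)) with (Phi (x k)) at 2.
      eapply Rle_trans; [apply Hc|].
      + specialize (X0 (S k)). lra.
      + specialize (X0 k). lra.
      + simpl pow. lra. }
  destruct (geom_limit x (r / 2) XS) as [l Hl].
  assert (Ll : Cmod (l - c) < r).
  { destruct (half_pow_small (2 * (r / 2)) (r / 2) ltac:(lra)) as [k Hk].
    specialize (Hl k). specialize (X0 k). rewrite Cmod_sub_sym in Hl.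
    replace (l - c)%C with ((l - x k) + (x k - c))%C by ring.
    eapply Rle_lt_trans; [apply Cmod_triangle|]. lra. }
  assert (El : Phi l = l).
  { apply NNPP. intros N. assert (Hp := Cmod_sub_pos _ _ N).
    destruct (half_pow_small (2 * (r / 2)) (Cmod (Phi l - l) / 2) ltac:(lra)) as [k Hk].
    assert (H1 := Hl k). assert (H2 := Hl (S k)). assert (H3 := X0 k).
    change (x (S k)) with (Phi (x k)) in H2.
    assert (H4 := Hc (x k) l ltac:(lra) Ll). simpl pow in H2.
    assert (T := Cmod_triangle (- (Phi (x k) - Phi l)) (Phi (x k) - l)). rewrite Cmod_opp in T.
    replace (- (Phi (x k) - Phi l) + (Phi (x k) - l))%C with (Phi l - l)%C in T by ring. lra. }
  exists l. split; [split; auto|].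
  intros w [Hw Ew]. assert (H := Hc l w Ll Hw). rewrite Ew in H.
  apply NNPP. intros N. assert (Hp := Cmod_sub_pos _ _ N).
  rewrite El in H. lra.
Qed.

Lemma ex_series_term_small (a : nat -> R) (eps : R) : (forall n, 0 <= a n) -> ex_series a -> 0 < eps ->
  exists N, forall n, (N <= n)%nat -> a n < eps.
Proof.
  intros H0 H He. assert (L := ex_series_lim_0 a H). apply is_lim_seq_spec in L.
  destruct (L (mkposreal eps He)) as [N HN]. exists N. intros n Hn. specialize (HN n Hn).
  simpl in HN. rewrite Rminus_0_r, Rabs_pos_eq in HN; auto.
Qed.

Section Separated.

Variable t : nat -> C.
Hypothesis t_inj : forall n m, t n = t m -> n = m.
Hypothesis t_lim : is_lim_seq (fun n => Cmod (t n)) p_infty.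
Hypothesis t_ge2 : forall n, 2 <= Cmod (t n).

Section Finite_zeros.

Variables (c : nat -> C) (P : C -> Prop) (B : R).
Hypothesis c_adm : adm t c.
Hypothesis P_zero : forall z, P z -> (forall n, z <> t n) /\ CT t c z = 0%C /\ Cmod z <= B.
Hypothesis P_inf : ~ finite_set P.
Hypothesis B_pos : 0 < B.

(** Each of the first [n0] poles is cancelled by a zero from [P], with the factor
    [(z - t n) / (z - w)]. The list [l] records the zeros spent; elsewhere off [T] the zeros are
    unchanged. *)
Lemma swap_prefix (n0 : nat) : exists c' l, adm t c' /\ (forall n, (n < n0)%nat -> c' n = 0%C) /\
  (forall z, In z l -> P z) /\
  (forall z, (forall n, z <> t n) -> ~ In z l -> (CT t c z = 0%C <-> CT t c' z = 0%C)).
Proof.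
  induction n0 as [|n0 (c' & l & Ha & Hz & Hl & Hi)].
  { exists c, nil. split; [auto|]. split; [lia|]. split; [easy|]. tauto. }
  destruct (infinite_set_fresh P l P_inf) as (w & Pw & Nw).
  destruct (P_zero w Pw) as (Ow & Zw & _).
  destruct (away_off t t_lim c' w Ow) as (e & He & Aw).
  exists (fun n => c' n * ((1 * t n + - t n0) / (t n - w)))%C, (w :: l).
  destruct (mobius_factor_bounded t c' 1 (- t n0) w e He Aw) as (K & _ & HK).
  split; [|split; [|split]].
  - now apply (adm_dom t t_ge2 c' _ K).
  - intros n Hn. destruct (Nat.eq_dec n n0) as [->|Ne].
    + unfold Cdiv. ring.
    + rewrite Hz by lia. ring.
  - intros z [<-|Hin]; auto.
  - intros z Oz Nz. simpl in Nz.
    destruct (away_off t t_lim c' z Oz) as (d & Hd & Az).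
    assert (Nzw : z <> w) by (intros E; apply Nz; auto).
    rewrite Hi by tauto. apply Hi in Zw; auto.
    rewrite (CT_mobius t t_ge2 c' 1 (- t n0) z w d e) by auto.
    rewrite Zw. split.
    + intros ->. ring.
    + intros E. rewrite Cmult_0_r in E. 
      apply NNPP. intros N. apply (Cmult_neq_0 ((1 * z + - t n0) / (z - w)) (CT t c' z)).
      * apply Cmult_neq_0; [|apply Cinv_neq_0; now apply Csub_neq0].
        intros E'. apply (Oz n0). replace z with ((1 * z + - t n0) + t n0)%C by ring. rewrite E'. ring.
      * exact N.
      * rewrite <- E. ring.
Qed.

(** An algebraic form of Schwarz's lemma. Once the poles of modulus up to [3 B] are removed,
    dividing by [z - w] for a zero with [|w| <= B] shrinks every coefficient by [2 B], while the
    value at a point with [|z| <= B / 2] is divided by at most [3 B / 2]. After [k] divisions the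
    original value is at most a constant times [(3 / 4)^k]. *)
Lemma CT_vanishes_near_0 (z : C) : (forall n, z <> t n) -> Cmod z <= B / 2 -> CT t c z = 0%C.
Proof.
  intros Oz Hz.
  destruct (t_eventually t t_lim (3 * B)) as [n0 Hn0].
  destruct (swap_prefix n0) as (c' & l & Ha & Hp & Hl & Hi).
  destruct (classic (In z l)) as [Iz|Nz]; [apply P_zero, Hl, Iz|].
  apply Hi; auto.
  set (S := Series (fun n => Cmod (c' n) / Cmod (t n))).
  assert (J : forall k, exists c2 l2, adm t c2 /\ (forall n, Cmod (c2 n) <= Cmod (c' n) * (/ (2 * B)) ^ k) /\
    (forall x, P x -> ~ In x l -> ~ In x l2 -> CT t c2 x = 0%C) /\
    (~ In z l2 -> Cmod (CT t c' z) <= (3 / 2 * B) ^ k * Cmod (CT t c2 z)) /\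
    (forall x, In x l2 -> P x)).
  { induction k as [|k (c2 & l2 & A2 & B2 & Z2 & E2 & P2)].
    - exists c', nil. split; auto. split; [intros; simpl; lra|]. split; [|split; [intros; simpl; lra|easy]].
      intros x Px Nx _. apply Hi; auto; now apply P_zero.
    - destruct (infinite_set_fresh P (l ++ l2) P_inf) as (w & Pw & Nw).
      rewrite in_app_iff in Nw. destruct (P_zero w Pw) as (Ow & Zw & Bw).
      destruct (away_off t t_lim c2 w Ow) as (e & He & Aw).
      exists (fun n => c2 n * ((0 * t n + 1) / (t n - w)))%C, (w :: l2).
      destruct (mobius_factor_bounded t c2 0 1 w e He Aw) as (K & _ & HK).
      assert (Z2w : CT t c2 w = 0%C) by (apply Z2; tauto).
      assert (M : forall x, (forall n, x <> t n) -> x <> w ->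
        CT t (fun n => c2 n * ((0 * t n + 1) / (t n - w)))%C x = (/ (x - w) * CT t c2 x)%C).
      { intros x Ox Nx. destruct (away_off t t_lim c2 x Ox) as (d & Hd & Ax).
        rewrite (CT_mobius t t_ge2 c2 0 1 x w d e) by auto. rewrite Z2w.
        assert (Nxw := Csub_neq0 _ _ Nx). field. auto. }
      split; [now apply (adm_dom t t_ge2 c2 _ K)|]. split; [|split; [|split]].
      + intros n. destruct (Nat.lt_ge_cases n n0) as [L|L].
        { assert (Z : c2 n = 0%C).
          { apply Cmod_eq_0. specialize (B2 n). rewrite (Hp n L), Cmod_0, Rmult_0_l in B2.
            apply Rle_antisym; auto. apply Cmod_ge_0. }
          rewrite Z, Cmult_0_l, (Hp n L), Cmod_0. lra. }
        specialize (Hn0 n L). assert (K1 := Cmod_triangle_rev (t n) w).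
        assert (Nn : (t n - w)%C <> 0%C) by (apply Cmod_gt_0; lra).
        rewrite Cmod_mult, Cmod_div by auto.
        replace (0 * t n + 1)%C with (RtoC 1) by ring. rewrite Cmod_1.
        simpl pow. rewrite (Rmult_comm (/ (2 * B))), <- Rmult_assoc.
        apply Rmult_le_compat; [apply Cmod_ge_0| |apply B2|].
        * unfold Rdiv. rewrite Rmult_1_l. left. apply Rinv_0_lt_compat. lra.
        * unfold Rdiv. rewrite Rmult_1_l. apply Rinv_le_contravar; lra.
      + intros x Px Nx N2. simpl in N2. rewrite M, Z2 by (try tauto; try apply P_zero, Px; intros ->; tauto).
        ring.
      + intros N2. simpl in N2. assert (Nzw : z <> w) by (intros ->; tauto).
        rewrite M by auto. rewrite Cmod_mult, Cmod_inv by now apply Csub_neq0.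
        eapply Rle_trans; [apply E2; tauto|].
        assert (Hp0 := Cmod_sub_pos _ _ Nzw).
        assert (K1 := Cmod_triangle_sub z w). simpl pow.
        replace (3 / 2 * B * (3 / 2 * B) ^ k * (/ Cmod (z - w) * Cmod (CT t c2 z)))
         with ((3 / 2 * B) ^ k * (Cmod (CT t c2 z) * (3 / 2 * B / Cmod (z - w)))) by (field; lra).
        apply Rmult_le_compat_l; [apply pow_le; lra|].
        rewrite <- (Rmult_1_r (Cmod (CT t c2 z))) at 1.
        apply Rmult_le_compat_l; [apply Cmod_ge_0|].
        apply Rmult_le_reg_r with (Cmod (z - w)); auto.
        replace (3 / 2 * B / Cmod (z - w) * Cmod (z - w)) with (3 / 2 * B) by (field; lra). lra.
      + intros x [<-|Hin]; auto. }
  destruct (t_dist_pos t t_lim z (fun _ => True)) as (d & Hd & Dz); [auto|].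
  assert (HS : 0 <= S).
  { apply Series_nonneg; [|exact Ha]. intros n. specialize (t_ge2 n).
    apply Rmult_le_pos; [apply Cmod_ge_0|]. left. apply Rinv_0_lt_compat. lra. }
  apply Cmod_eq_0, Rle_antisym; [|apply Cmod_ge_0]. apply le_epsilon. intros eps Heps.
  rewrite Rplus_0_l.
  set (M := (1 + Cmod z / d) * S).
  assert (HM : 0 <= M).
  { apply Rmult_le_pos; auto. assert (0 <= Cmod z / d); [|lra].
    apply Rmult_le_pos; [apply Cmod_ge_0|left; now apply Rinv_0_lt_compat]. }
  destruct (pow_lt_1_zero (3 / 4) ltac:(rewrite Rabs_pos_eq; lra) (eps / (M + 1))
    ltac:(apply Rdiv_lt_0_compat; lra)) as [k Hk].
  specialize (Hk k (le_n k)). rewrite Rabs_pos_eq in Hk by (apply pow_le; lra).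
  destruct (J k) as (c2 & l2 & A2 & B2 & _ & E2 & P2).
  destruct (classic (In z l2)) as [I2|N2].
  { assert (Z : CT t c' z = 0%C) by (apply Hi; auto; apply P_zero, P2, I2).
    rewrite Z, Cmod_0. lra. }
  assert (Q : Cmod (CT t c2 z) <= (/ (2 * B)) ^ k * M).
  { eapply Rle_trans; [apply (CT_bound t t_ge2 c2 z d A2 Hd)|].
    - intros n. right. apply Dz; auto.
    - unfold M. replace ((/ (2 * B)) ^ k * ((1 + Cmod z / d) * S)) with ((1 + Cmod z / d) * ((/ (2 * B)) ^ k * S)) by ring.
      apply Rmult_le_compat_l.
      { assert (0 <= Cmod z / d); [|lra].
        apply Rmult_le_pos; [apply Cmod_ge_0|left; now apply Rinv_0_lt_compat]. }
      unfold S. rewrite <- Series_scal_l. apply Series_le; [|apply ex_series_Rscal; exact Ha].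
      intros n. specialize (t_ge2 n). assert (0 < / Cmod (t n)) by (apply Rinv_0_lt_compat; lra). split.
      + apply Rmult_le_pos; [apply Cmod_ge_0|lra].
      + unfold Rdiv. rewrite <- Rmult_assoc. apply Rmult_le_compat_r; [lra|]. rewrite Rmult_comm. apply B2. }
  eapply Rle_trans; [apply (E2 N2)|].
  apply Rle_trans with ((3 / 2 * B) ^ k * ((/ (2 * B)) ^ k * M)).
  { apply Rmult_le_compat_l; auto. apply pow_le; lra. }
  rewrite <- Rmult_assoc, <- Rpow_mult_distr.
  replace (3 / 2 * B * / (2 * B)) with (3 / 4) by (field; lra).
  apply Rle_trans with (eps / (M + 1) * M); [apply Rmult_le_compat_r; lra|].
  apply Rmult_le_reg_r with (M + 1); [lra|].
  replace (eps / (M + 1) * M * (M + 1)) with (eps * M) by (field; lra). nra.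
Qed.

End Finite_zeros.

Lemma CT_zeros_finite (c : nat -> C) (B : R) : adm t c -> (exists n, c n <> 0%C) ->
  finite_set (fun z => (forall n, z <> t n) /\ CT t c z = 0%C /\ Cmod z <= B).
Proof.
  intros Hc [n0 Hn0]. apply NNPP. intros Inf. apply Hn0.
  apply (CT_eq0 t t_inj t_lim t_ge2 c Hc). intros z Oz.
  (* Large enough to contain the given disc and to have [z] in the inner half. *)
  set (B' := Rabs B + 2 * Cmod z + 1).
  assert (Hz := Cmod_ge_0 z). assert (HB := Rabs_pos B). assert (HB2 := Rle_abs B).
  apply (CT_vanishes_near_0 c
    (fun z => (forall n, z <> t n) /\ CT t c z = 0%C /\ Cmod z <= B') B' Hc); auto.
  - intros F. apply Inf. revert F. apply finite_set_sub. intros x (H1 & H2 & H3).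
    repeat split; auto. unfold B'. lra.
  - unfold B'. lra.
  - unfold B'. lra.
Qed.

Definition tpow (c : nat -> C) (k : nat) (n : nat) : C := (c n * Cpow (t n) k)%C.

Lemma tpow_Cmod (c : nat -> C) (k n : nat) : Cmod (tpow c k n) = Cmod (c n) * Cmod (t n) ^ k.
Proof. unfold tpow. now rewrite Cmod_mult, Cmod_pow. Qed.

Definition rapid (c : nat -> C) : Prop := forall k, ex_series (fun n => Cmod (c n) * Cmod (t n) ^ k).

Lemma rapid_summ (c : nat -> C) (k : nat) : rapid c -> summ (tpow c k).
Proof. intros H. apply (summ_dom _ (fun n => Cmod (c n) * Cmod (t n) ^ k)); auto.
  intros n. rewrite tpow_Cmod. lra. Qed.

Lemma rapid_tpow (c : nat -> C) (j : nat) : rapid c -> rapid (tpow c j).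
Proof.
  intros H k. apply (ex_series_Rext (fun n => Cmod (c n) * Cmod (t n) ^ (j + k))); auto.
  intros n. rewrite tpow_Cmod, pow_add. ring.
Qed.

Lemma rapid_adm (c : nat -> C) : rapid c -> adm t c.
Proof.
  intros H. apply (ex_series_dom _ (fun n => Cmod (c n) * Cmod (t n) ^ 0)); auto.
  intros n. specialize (t_ge2 n). assert (K := Cmod_ge_0 (c n)).
  assert (0 < / Cmod (t n)) by (apply Rinv_0_lt_compat; lra). split; [apply Rmult_le_pos; lra|].
  apply Rmult_le_compat_l; auto. simpl. rewrite <- Rinv_1. apply Rinv_le_contravar; lra.
Qed.

(** A vanishing moment removes the constant that multiplication by [z] produces, so the powers of
    [z] pass entirely onto the coefficients. *)
Lemma CT_moments (c : nat -> C) (K : nat) (z : C) (d : R) : rapid c ->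
  0 < d -> away t c z d -> (forall k, (k < K)%nat -> Csum (tpow c k) = 0%C) ->
  (Cpow z K * CT t c z)%C = CT t (tpow c K) z.
Proof.
  intros Hc Hd Az H. induction K as [|K IH].
  - simpl. rewrite Cmult_1_l. apply CT_ext. intros n. unfold tpow. simpl. ring.
  - simpl. rewrite <- Cmult_assoc, IH by (intros; apply H; lia).
    rewrite (CT_times t t_ge2 (tpow c K) z d); auto.
    + rewrite H by lia. rewrite Cplus_0_l. apply CT_ext. intros n. unfold tpow. simpl. ring.
    + now apply rapid_adm, rapid_tpow.
    + now apply rapid_summ.
    + intros n. destruct (Az n) as [E|E]; auto. left. unfold tpow. rewrite E. ring.
Qed.

End Separated.

(** * A nonzero moment forces localization *)

(** Power separation with a natural exponent. The normalizations [c0 <= 1] and [1 <= N] make the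
    radii derived from it tend to zero and stay below [1 / 8]. *)
Definition separated (t : nat -> C) (c0 : R) (N : nat) : Prop :=
  0 < c0 <= 1 /\ (1 <= N)%nat /\
  forall n m : nat, m <> n -> c0 / Cmod (t n) ^ N <= Cmod (t n - t m).

Lemma power_separated_nat (t : nat -> C) : (forall n, 2 <= Cmod (t n)) ->
  power_separated t -> exists c0 N, separated t c0 N.
Proof.
  intros t_ge2 (c & nu & Hc & Hnu & H).
  destruct (INR_unbounded nu) as [N HN].
  exists (Rmin c 1), (S N). assert (L1 := Rmin_l c 1). assert (L2 := Rmin_r c 1).
  assert (Hm : 0 < Rmin c 1) by (apply Rmin_pos; lra).
  split; [lra|]. split; [lia|]. intros n m Hnm. eapply Rle_trans; [|apply (H n m Hnm)].
  specialize (t_ge2 n). unfold Rdiv.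
  assert (P : 0 < Cmod (t n) ^ S N) by (apply pow_lt; lra).
  apply Rmult_le_compat; try lra; [left; now apply Rinv_0_lt_compat|].
  rewrite <- Rpower_pow, <- Rpower_Ropp by lra.
  apply Rle_Rpower; [lra|]. rewrite S_INR. lra.
Qed.

(** A quarter of the separation: the discs are disjoint, and outside a disc the pole at its centre
    costs only a power of [t n]. *)
Definition sep_radius (t : nat -> C) (c0 : R) (N : nat) (n : nat) : R := c0 / 4 / Cmod (t n) ^ N.

Section Power_separated.

Variable t : nat -> C.
Hypothesis t_inj : forall n m, t n = t m -> n = m.
Hypothesis t_lim : is_lim_seq (fun n => Cmod (t n)) p_infty.
Hypothesis t_ge2 : forall n, 2 <= Cmod (t n).
Variables (c0 : R) (N : nat).
Hypothesis t_sep : separated t c0 N.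

Notation rad := (sep_radius t c0 N).

Lemma t_pow_ge1 (k n : nat) : 1 <= Cmod (t n) ^ k.
Proof. apply pow_R1_Rle. specialize (t_ge2 n). lra. Qed.

Lemma t_pow_mono (j k n : nat) : (j <= k)%nat -> Cmod (t n) ^ j <= Cmod (t n) ^ k.
Proof. intros H. apply Rle_pow; auto. specialize (t_ge2 n). lra. Qed.

Lemma rad_pos (n : nat) : 0 < rad n.
Proof.
  destruct t_sep as (Hc & _). unfold sep_radius. apply Rdiv_lt_0_compat; [lra|].
  assert (K := t_pow_ge1 N n). lra.
Qed.

Lemma rad_le (n : nat) : rad n <= / 4 / Cmod (t n).
Proof.
  destruct t_sep as (Hc & HN & _). assert (K := t_pow_mono 1 N n HN). specialize (t_ge2 n).
  rewrite pow_1 in K. unfold sep_radius, Rdiv.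
  apply Rmult_le_compat; [lra|left; apply Rinv_0_lt_compat; lra|lra|].
  apply Rinv_le_contravar; lra.
Qed.

Lemma rad_le_eighth (n : nat) : rad n <= / 8.
Proof.
  eapply Rle_trans; [apply rad_le|]. specialize (t_ge2 n).
  replace (/ 8) with (/ 4 * / 2) by field. apply Rmult_le_compat_l; [lra|].
  apply Rinv_le_contravar; lra.
Qed.

Lemma rad_lim : is_lim_seq rad 0.
Proof.
  apply is_lim_seq_spec. intros eps. destruct (t_eventually t t_lim (/ eps)) as [n0 H].
  exists n0. intros n Hn. specialize (H n Hn). assert (He := cond_pos eps).
  assert (K := rad_pos n). assert (K2 := rad_le n). rewrite Rminus_0_r, Rabs_pos_eq by lra.
  assert (Hi : 0 < / eps) by now apply Rinv_0_lt_compat.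
  assert (/ Cmod (t n) < eps).
  { rewrite <- (Rinv_inv eps). apply Rinv_lt_contravar; [|auto].
    apply Rmult_lt_0_compat; auto. lra. }
  unfold Rdiv in K2. lra.
Qed.

Lemma rad_disjoint (n m : nat) : n <> m -> forall z,
  ~ (Defs.disc (t n) (rad n) z /\ Defs.disc (t m) (rad m) z).
Proof.
  intros Hnm z [H1 H2]. unfold Defs.disc in *. destruct t_sep as (Hc & _ & Hs).
  assert (S1 := Hs n m ltac:(auto)). assert (S2 := Hs m n ltac:(auto)).
  rewrite (Cmod_sub_sym (t m)) in S2.
  assert (T := Cmod_triangle_sub (z - t m) (z - t n)).
  replace (z - t m - (z - t n))%C with (t n - t m)%C in T by ring.
  unfold sep_radius in *.
  assert (E : forall k, c0 / 4 / Cmod (t k) ^ N = c0 / Cmod (t k) ^ N / 4).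
  { intros k. assert (K := t_pow_ge1 N k). field. lra. }
  rewrite E in H1, H2. assert (P := Cmod_ge_0 (t n - t m)). lra.
Qed.

Lemma not_disc_inv (m : nat) (z : C) : ~ Defs.disc (t m) (rad m) z ->
  0 < Cmod (z - t m) /\ / Cmod (z - t m) <= 4 / c0 * Cmod (t m) ^ N.
Proof.
  intros H. unfold Defs.disc in H. apply Rnot_lt_le in H. assert (K := rad_pos m).
  split; [lra|]. destruct t_sep as (Hc & _). assert (K1 := t_pow_ge1 N m).
  replace (4 / c0 * Cmod (t m) ^ N) with (/ rad m) by (unfold sep_radius; field; lra).
  now apply Rinv_le_contravar.
Qed.

Lemma not_disc_ratio (m : nat) (z : C) : ~ Defs.disc (t m) (rad m) z ->
  Cmod z * / Cmod (z - t m) <= (1 + 4 / c0) * Cmod (t m) ^ (S N).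
Proof.
  intros H. destruct (not_disc_inv m z H) as [Hp Hi]. destruct t_sep as (Hc & _).
  assert (T := Cmod_triangle_rev z (t m)).
  assert (Q : Cmod z * / Cmod (z - t m) <= 1 + Cmod (t m) * / Cmod (z - t m)).
  { apply Rmult_le_reg_r with (Cmod (z - t m)); auto.
    replace (Cmod z * / Cmod (z - t m) * Cmod (z - t m)) with (Cmod z) by (field; lra).
    replace ((1 + Cmod (t m) * / Cmod (z - t m)) * Cmod (z - t m)) with (Cmod (z - t m) + Cmod (t m)) by (field; lra).
    lra. }
  eapply Rle_trans; [apply Q|]. assert (K1 := t_pow_ge1 (S N) m).
  assert (K2 : Cmod (t m) * / Cmod (z - t m) <= Cmod (t m) * (4 / c0 * Cmod (t m) ^ N)).
  { apply Rmult_le_compat_l; auto. apply Cmod_ge_0. }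
  simpl pow in *. nra.
Qed.

Lemma small_disc_norm (n : nat) (z : C) : Defs.disc (t n) (rad n) z -> Cmod (t n) - / 8 < Cmod z.
Proof.
  unfold Defs.disc. intros H. assert (K := rad_le_eighth n).
  assert (T := Cmod_triangle_rev (t n) z). rewrite Cmod_sub_sym in T. lra.
Qed.

Section Nonzero_moment.

Variables (c : nat -> C) (K : nat).
Hypothesis c_rapid : rapid t c.
Hypothesis moments0 : forall k, (k < K)%nat -> Csum (tpow t c k) = 0%C.
Hypothesis momentK : Csum (tpow t c K) <> 0%C.

Let m := Csum (tpow t c K).
Let d := tpow t c (S K).

Let d_rapid : rapid t d := rapid_tpow t c (S K) c_rapid.

Let d_adm : adm t d := rapid_adm t t_ge2 d d_rapid.

Lemma d_0 (n : nat) : d n = 0%C <-> c n = 0%C.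
Proof.
  unfold d, tpow. split; intros E.
  - apply NNPP. intros Nc. apply (Cmult_neq_0 (c n) (Cpow (t n) (S K)) Nc); auto.
    apply Cmod_gt_0. rewrite Cmod_pow. assert (Q := t_pow_ge1 (S K) n). lra.
  - rewrite E. ring.
Qed.

(** [K] multiplications by [z] produce no constant, and the next one splits off the first nonzero
    moment [m]. The zeros are those of a perturbed nonzero constant. *)
Lemma CT_main_term (z : C) : (forall n, z <> t n) ->
  (Cpow z (S K) * CT t c z)%C = (m + CT t d z)%C.
Proof.
  intros Oz. destruct (away_off t t_lim c z Oz) as (e & He & Az).
  simpl. rewrite <- Cmult_assoc, (CT_moments t t_ge2 c K z e c_rapid He Az moments0).
  rewrite (CT_times t t_ge2 (tpow t c K) z e); auto.
  - f_equal. apply CT_ext. intros n. unfold d, tpow. simpl. ring.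
  - now apply rapid_adm, rapid_tpow.
  - now apply rapid_summ.
  - intros n. destruct (Az n) as [E|E]; auto. left. unfold tpow. rewrite E. ring.
Qed.

Let C1 := Series (fun n => (1 + 4 / c0) * (Cmod (d n) * Cmod (t n) ^ (S N))).

(** Outside the discs each term of [z * CT t e z] loses at most the power [|t n|^(N + 1)], which
    rapid decay absorbs, so the remainder is of order [1 / |z|]. A general [e] is allowed because
    inside a disc the entry of that disc has to be dropped. *)
Lemma remainder_bound (e : nat -> C) (z : C) :
  (forall n, Cmod (e n) <= Cmod (d n)) ->
  (forall n, e n = 0%C \/ ~ Defs.disc (t n) (rad n) z) ->
  Cmod z * Cmod (CT t e z) <= C1.
Proof.
  intros He Hz. assert (Hzp := Cmod_ge_0 z). destruct t_sep as (Hc & _).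
  assert (Q : forall n, Cmod (z * (e n / (z - t n))) <= (1 + 4 / c0) * (Cmod (d n) * Cmod (t n) ^ (S N))).
  { intros n. destruct (Hz n) as [E|E].
    - rewrite E. unfold Cdiv. rewrite Cmult_0_l, Cmult_0_r, Cmod_0.
      assert (0 < 4 / c0) by (apply Rdiv_lt_0_compat; lra). assert (G := t_pow_ge1 (S N) n).
      apply Rmult_le_pos; [lra|]. apply Rmult_le_pos; [apply Cmod_ge_0|lra].
    - destruct (not_disc_inv n z E) as [Hp _]. assert (R := not_disc_ratio n z E).
      assert (Nz : (z - t n)%C <> 0%C) by (now apply Cmod_gt_0).
      rewrite Cmod_mult, Cmod_div by auto. unfold Rdiv at 1.
      replace (Cmod z * (Cmod (e n) * / Cmod (z - t n))) with (Cmod (e n) * (Cmod z * / Cmod (z - t n))) by ring.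
      replace ((1 + 4 / c0) * (Cmod (d n) * Cmod (t n) ^ S N)) with (Cmod (d n) * ((1 + 4 / c0) * Cmod (t n) ^ S N)) by ring.
      apply Rmult_le_compat; auto; [apply Cmod_ge_0|].
      apply Rmult_le_pos; auto. left. now apply Rinv_0_lt_compat. }
  rewrite <- Cmod_mult. unfold CT.
  destruct (classic (z = 0%C)) as [->|Nz].
  { rewrite Cmult_0_l, Cmod_0. unfold C1. apply Series_nonneg.
    - intros n. eapply Rle_trans; [apply Cmod_ge_0|apply (Q n)].
    - apply ex_series_Rscal, d_rapid. }
  assert (Sm : summ (fun n => z * (e n / (z - t n)))%C).
  { apply (summ_dom _ _ Q). apply ex_series_Rscal, d_rapid. }
  rewrite <- Csum_scal.
  - unfold C1. apply Csum_dom; auto. apply ex_series_Rscal, d_rapid.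
  - apply (summ_ext (fun n => / z * (z * (e n / (z - t n))))%C).
    + intros n. unfold Cdiv. rewrite !Cmult_assoc, Cinv_l by auto. ring.
    + now apply summ_scal.
Qed.

Lemma C1_nonneg : 0 <= C1.
Proof.
  apply Series_nonneg; [|apply ex_series_Rscal, d_rapid].
  intros n. destruct t_sep as (Hc & _). assert (0 < 4 / c0) by (apply Rdiv_lt_0_compat; lra).
  assert (G := t_pow_ge1 (S N) n).
  apply Rmult_le_pos; [lra|]. apply Rmult_le_pos; [apply Cmod_ge_0|lra].
Qed.

Lemma zeros_outside_bounded (z : C) :
  zero_of t c z -> (forall n, ~ Defs.disc (t n) (rad n) z) ->
  (forall n, z <> t n) /\ CT t c z = 0%C /\ Cmod z <= C1 / Cmod m.
Proof.
  intros Hz Ho. assert (Hm := proj1 (Cmod_gt_0 _) momentK). fold m in Hm.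
  assert (Oz : forall n, z <> t n).
  { intros n ->. apply (Ho n). unfold Defs.disc. rewrite Cmod_self_sub. apply rad_pos. }
  destruct Hz as [[_ Z]|(n & E & _)]; [|now destruct (Oz n)].
  repeat split; auto.
  assert (M := CT_main_term z Oz). rewrite Z, Cmult_0_r in M.
  assert (B := remainder_bound d z (fun n => Rle_refl _) (fun n => or_intror (Ho n))).
  assert (E : CT t d z = (- m)%C).
  { replace (CT t d z) with (m + CT t d z - m)%C by ring. rewrite <- M. ring. }
  rewrite E, Cmod_opp in B.
  apply Rmult_le_reg_r with (Cmod m); auto.
  replace (C1 / Cmod m * Cmod m) with C1 by (field; lra). exact B.
Qed.

(* Inside the disc around [t j] the zeros are the fixed points of
   [z |-> t j - d j / (m + CT t (drop j d) z)], a contraction for large [j]. *)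
Lemma zero_equation (j : nat) (z : C) : Defs.disc (t j) (rad j) z ->
  (zero_of t c z <-> ((z - t j) * (m + CT t (drop j d) z) + d j)%C = 0%C).
Proof.
  intros Hz.
  destruct (classic (z = t j)) as [->|Nz].
  - replace (t j - t j)%C with (RtoC 0) by ring. rewrite Cmult_0_l, Cplus_0_l, d_0.
    split.
    + intros [[O _]|(n & E & Z)]; [now destruct (O j)|]. now rewrite (t_inj _ _ E).
    + intros Z. right. eauto.
  - assert (Oz : forall n, z <> t n).
    { intros n E. destruct (Nat.eq_dec n j) as [->|Nn]; [easy|].
      apply (rad_disjoint n j Nn z). split; auto. rewrite E. unfold Defs.disc.
      rewrite Cmod_self_sub. apply rad_pos. }
    assert (M := CT_main_term z Oz). assert (Nz' := Csub_neq0 _ _ Nz).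
    destruct (away_off t t_lim d z Oz) as (e & He & Az).
    rewrite (CT_drop t t_ge2 d z e j d_adm He Az) in M.
    assert (Z0 : Cpow z (S K) <> 0%C).
    { apply Cmod_gt_0. rewrite Cmod_pow. apply pow_lt. assert (Q := small_disc_norm j z Hz).
      assert (G2 := t_ge2 j). lra. }
    split.
    + intros [[_ Z]|(n & E & _)]; [|now destruct (Oz n)].
      rewrite Z, Cmult_0_r in M.
      transitivity ((z - t j) * (m + (d j / (z - t j) + CT t (drop j d) z)))%C; [field; auto|].
      rewrite <- M. ring.
    + intros E. left. split; auto. apply NNPP. intros Nc.
      apply (Cmult_neq_0 _ _ Z0 Nc). rewrite M.
      transitivity (((z - t j) * (m + CT t (drop j d) z) + d j) / (z - t j))%C; [field; auto|].
      rewrite E. unfold Cdiv. ring.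
Qed.

Let C2 := Series (fun n => (4 / c0) * (4 / c0) * (Cmod (d n) * Cmod (t n) ^ (N + N))).

Lemma disc_exclusive (j n : nat) (z : C) : Defs.disc (t j) (rad j) z -> n <> j ->
  ~ Defs.disc (t n) (rad n) z.
Proof. intros Hz Hn H. apply (rad_disjoint n j Hn z). auto. Qed.

Lemma disc_away_drop (j : nat) (z : C) : Defs.disc (t j) (rad j) z ->
  exists e, 0 < e /\ away t (drop j d) z e.
Proof.
  intros Hz. apply away_neq; auto. intros n Hn E. unfold drop in Hn.
  destruct (Nat.eqb_spec n j); [easy|].
  apply (disc_exclusive j n z Hz); auto. rewrite E. unfold Defs.disc.
  rewrite Cmod_self_sub. apply rad_pos.
Qed.

(** The slope carries two denominators, [z - t n] and [w - t n], each costing [|t n|^N]; hence the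
    exponent [N + N] in [C2]. *)
Lemma remainder_lipschitz (j : nat) (z w : C) :
  Defs.disc (t j) (rad j) z -> Defs.disc (t j) (rad j) w ->
  Cmod (CT t (drop j d) z - CT t (drop j d) w) <= C2 * Cmod (z - w).
Proof.
  intros Hz Hw. destruct (disc_away_drop j z Hz) as (e & He & Az).
  destruct (disc_away_drop j w Hw) as (e' & He' & Aw).
  assert (Ad := adm_drop t t_ge2 d j d_adm).
  rewrite (CT_difference t t_ge2 (drop j d) w z e' e Ad He' Aw He Az).
  match goal with |- Cmod (?x + ?y - ?x) <= _ => replace (x + y - x)%C with y by ring end.
  rewrite Cmod_mult. apply Rmult_le_compat_r; [apply Cmod_ge_0|].
  unfold CT, C2. destruct t_sep as (Hc & _). assert (G0 : 0 < 4 / c0) by (apply Rdiv_lt_0_compat; lra).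
  apply Csum_dom; [|apply ex_series_Rscal, d_rapid].
  intros n. assert (G := t_pow_ge1 (N + N) n). assert (Gd := Cmod_ge_0 (d n)).
  unfold drop. destruct (Nat.eqb_spec n j) as [E|E].
  - unfold Cdiv. rewrite Cmult_0_l, Cmult_0_r, Cmult_0_l, Cmod_0. 
    apply Rmult_le_pos; [nra|]. apply Rmult_le_pos; lra.
  - destruct (not_disc_inv n z (disc_exclusive j n z Hz E)) as [Pz Iz].
    destruct (not_disc_inv n w (disc_exclusive j n w Hw E)) as [Pw Iw].
    assert (N1 : (z - t n)%C <> 0%C) by now apply Cmod_gt_0.
    assert (N2 : (w - t n)%C <> 0%C) by now apply Cmod_gt_0.
    rewrite !Cmod_div, Cmod_mult, Cmod_m1, Cmod_div by auto.
    rewrite pow_add. unfold Rdiv at 1 2.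
    replace (4 / c0 * (4 / c0) * (Cmod (d n) * (Cmod (t n) ^ N * Cmod (t n) ^ N))) with
      (Cmod (d n) * (4 / c0 * Cmod (t n) ^ N) * (4 / c0 * Cmod (t n) ^ N)) by ring.
    rewrite Rmult_1_l.
    assert (0 < / Cmod (z - t n)) by now apply Rinv_0_lt_compat.
    assert (0 < / Cmod (w - t n)) by now apply Rinv_0_lt_compat.
    apply Rmult_le_compat; auto; [apply Rmult_le_pos; lra|lra|].
    apply Rmult_le_compat_l; auto.
Qed.

Lemma C2_nonneg : 0 <= C2.
Proof.
  apply Series_nonneg; [|apply ex_series_Rscal, d_rapid].
  intros n. destruct t_sep as (Hc & _). assert (0 < 4 / c0) by (apply Rdiv_lt_0_compat; lra).
  assert (G := t_pow_ge1 (N + N) n).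
  apply Rmult_le_pos; [nra|]. apply Rmult_le_pos; [apply Cmod_ge_0|lra].
Qed.

Lemma unique_zero_in_disc : exists n0, forall j, (n0 <= j)%nat ->
  exists! z, Defs.disc (t j) (rad j) z /\ zero_of t c z.
Proof.
  assert (Hm := proj1 (Cmod_gt_0 _) momentK). fold m in Hm.
  set (M := Cmod m) in *. assert (HC2 := C2_nonneg). assert (HC1 := C1_nonneg).
  destruct t_sep as (Hc & _).
  (* With [|m + CT|] at least [M / 2], the bound [e1] keeps the displacement [|d j| / (M / 2)]
     within half the radius, and [e2] keeps the Lipschitz constant [|d j| C2 / (M / 2)^2] at most
     [1 / 2]. The [+ 1] avoids division by zero. *)
  set (e1 := M * (c0 / 16)). set (e2 := M * M / (8 * (C2 + 1))).
  assert (He1 : 0 < e1) by (unfold e1; nra).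
  assert (He2 : 0 < e2) by (unfold e2; apply Rdiv_lt_0_compat; nra).
  destruct (ex_series_term_small (fun n => Cmod (d n) * Cmod (t n) ^ N) (Rmin e1 e2)) as [n1 H1].
  { intros n. assert (G := t_pow_ge1 N n). apply Rmult_le_pos; [apply Cmod_ge_0|lra]. }
  { apply d_rapid. }
  { now apply Rmin_pos. }
  (* Past this index [|z| > 2 C1 / M] on the discs, so the remainder is at most half the moment. *)
  destruct (t_eventually t t_lim (2 * C1 / M + 1)) as [n2 H2].
  exists (n1 + n2)%nat. intros j Hj.
  specialize (H1 j ltac:(lia)). cbv beta in H1. specialize (H2 j ltac:(lia)).
  assert (L1 := Rmin_l e1 e2). assert (L2 := Rmin_r e1 e2).
  assert (G := t_pow_ge1 N j). assert (Gd := Cmod_ge_0 (d j)). assert (Hr := rad_pos j).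
  assert (Small : forall z, Defs.disc (t j) (rad j) z -> M / 2 <= Cmod (m + CT t (drop j d) z)).
  { intros z Hz. assert (Q := small_disc_norm j z Hz).
    assert (B := remainder_bound (drop j d) z (drop_le j d)).
    assert (B' : Cmod z * Cmod (CT t (drop j d) z) <= C1).
    { apply B. intros n. unfold drop. destruct (Nat.eqb_spec n j); auto. right.
      now apply (disc_exclusive j). }
    assert (P0 : 0 <= 2 * C1 / M) by (apply Rmult_le_pos; [lra|left; now apply Rinv_0_lt_compat]).
    assert (Hb : Cmod (CT t (drop j d) z) <= M / 2).
    { apply Rmult_le_reg_l with (2 * C1 / M + / 2); [lra|].
      replace ((2 * C1 / M + / 2) * (M / 2)) with (C1 + M / 4) by (field; lra).
      assert (Gc := Cmod_ge_0 (CT t (drop j d) z)). nra. }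
    assert (T := Cmod_triangle_rev m (- CT t (drop j d) z)). rewrite Cmod_opp in T.
    replace (m - - CT t (drop j d) z)%C with (m + CT t (drop j d) z)%C in T by ring.
    fold M in T. lra. }
  assert (Nz : forall z, Defs.disc (t j) (rad j) z -> (m + CT t (drop j d) z)%C <> 0%C).
  { intros z Hz. apply Cmod_gt_0. specialize (Small z Hz). lra. }
  set (Phi := fun z => (t j - d j / (m + CT t (drop j d) z))%C).
  destruct (contraction_fixpoint Phi (t j) (rad j) Hr) as (z & [Hz Ez] & Uz).
  - intros z Hz. unfold Phi.
    replace (t j - d j / (m + CT t (drop j d) z) - t j)%C with (- (d j / (m + CT t (drop j d) z)))%C by ring.
    rewrite Cmod_opp, Cmod_div by auto. specialize (Small z Hz).
    apply Rmult_le_reg_r with (Cmod (m + CT t (drop j d) z)); [lra|].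
    unfold Rdiv at 1. rewrite Rmult_assoc, Rinv_l, Rmult_1_r by lra.
    apply Rle_trans with (rad j / 2 * (M / 2)); [|apply Rmult_le_compat_l; lra].
    unfold sep_radius. 
    apply Rmult_le_reg_r with (Cmod (t j) ^ N); [lra|].
    replace (c0 / 4 / Cmod (t j) ^ N / 2 * (M / 2) * Cmod (t j) ^ N) with (M * (c0 / 16)) by (field; lra).
    change (M * (c0 / 16)) with e1. lra.
  - intros z w Hz Hw. unfold Phi.
    assert (Nz1 := Nz z Hz). assert (Nz2 := Nz w Hw).
    set (gz := CT t (drop j d) z) in *. set (gw := CT t (drop j d) w) in *.
    replace (t j - d j / (m + gz) - (t j - d j / (m + gw)))%C
      with (d j * (gz - gw) / ((m + gz) * (m + gw)))%C by (field; auto).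
    rewrite Cmod_div, !Cmod_mult by (now apply Cmult_neq_0).
    assert (S1 := Small z Hz). assert (S2 := Small w Hw). fold gz in S1. fold gw in S2.
    assert (Lp := remainder_lipschitz j z w Hz Hw). fold gz gw in Lp.
    assert (Gzw := Cmod_ge_0 (z - w)).
    assert (Pr : M / 2 * (M / 2) <= Cmod (m + gz) * Cmod (m + gw)) by (apply Rmult_le_compat; lra).
    apply Rmult_le_reg_r with (Cmod (m + gz) * Cmod (m + gw)); [nra|].
    unfold Rdiv at 1. rewrite Rmult_assoc, Rinv_l, Rmult_1_r by nra.
    apply Rle_trans with (/ 2 * Cmod (z - w) * (M / 2 * (M / 2))); [|apply Rmult_le_compat_l; lra].
    apply Rle_trans with (e2 * (C2 * Cmod (z - w))).
    + apply Rmult_le_compat; auto; try apply Cmod_ge_0. nra.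
    + unfold e2.
      replace (M * M / (8 * (C2 + 1)) * (C2 * Cmod (z - w))) with
        (Cmod (z - w) * (M * M) / 8 * (C2 / (C2 + 1))) by (field; lra).
      assert (C2 / (C2 + 1) <= 1).
      { apply Rmult_le_reg_r with (C2 + 1); [lra|]. unfold Rdiv. rewrite Rmult_assoc, Rinv_l; lra. }
      assert (0 <= Cmod (z - w) * (M * M) / 8) by nra. nra.
  - assert (Eq : forall w, Defs.disc (t j) (rad j) w -> (zero_of t c w <-> Phi w = w)).
    { intros w Hw. rewrite (zero_equation j w Hw). assert (Nw := Nz w Hw). unfold Phi. split; intros E.
      - apply (Cmult_cancel_l (m + CT t (drop j d) w)); auto.
        replace ((m + CT t (drop j d) w) * (t j - d j / (m + CT t (drop j d) w)))%C
         with ((m + CT t (drop j d) w) * w - ((w - t j) * (m + CT t (drop j d) w) + d j))%C by (field; auto).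
        rewrite E. ring.
      - rewrite <- E at 1. field. auto. }
    exists z. split.
    + split; auto. now apply Eq.
    + intros w [Hw Zw]. apply Uz. split; auto. now apply Eq.
Qed.

Lemma localized_of_moment : localized t c rad.
Proof.
  split.
  - destruct (CT_zeros_finite t t_inj t_lim t_ge2 c (C1 / Cmod m)) as [l Hl].
    + now apply rapid_adm.
    + apply NNPP. intros Nn. apply momentK. apply Csum_0. intros n. unfold tpow.
      replace (c n) with (RtoC 0); [ring|]. apply NNPP. intros E. apply Nn. exists n. auto.
    + exists l. intros z [Hz Ho]. apply Hl. now apply zeros_outside_bounded.
  - destruct unique_zero_in_disc as [n0 H]. apply (finite_set_of_bounded _ n0).
    intros n Hn. destruct (Nat.lt_ge_cases n n0); auto. exfalso. apply Hn. now apply H.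
Qed.

End Nonzero_moment.

End Power_separated.

(** * Polynomials, moments and density *)

Lemma least_nat (P : nat -> Prop) : (exists k, P k) -> exists K, P K /\ forall k, (k < K)%nat -> ~ P k.
Proof.
  intros [k Hk]. revert Hk. induction k as [k IH] using (well_founded_induction Nat.lt_wf_0). intros Hk.
  destruct (classic (exists j, (j < k)%nat /\ P j)) as [(j & Hj & Pj)|N]; [now apply (IH j)|].
  exists k. split; auto. intros j Hj Pj. apply N. eauto.
Qed.

Lemma sum_n_C_ext_zero (f : nat -> C) (d e : nat) :
  (forall k, (d < k)%nat -> f k = 0%C) -> (d <= e)%nat ->
  csum_n f e = csum_n f d.
Proof.
  intros H. induction e as [|e IH]; intros L.
  - now replace d with O by lia.
  - destruct (Nat.eq_dec d (S e)) as [->|Ne]; auto.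
    rewrite sum_Sn, IH, H by lia. change (csum_n f d + 0 = csum_n f d)%C. ring.
Qed.

Lemma sum_n_C_ext (f g : nat -> C) (d : nat) : (forall k, (k <= d)%nat -> f k = g k) ->
  csum_n f d = csum_n g d.
Proof. intros H. apply sum_n_ext_loc. auto. Qed.

Lemma polynomial_plus (p q : C -> C) : polynomial p -> polynomial q ->
  polynomial (fun z => p z + q z)%C.
Proof.
  intros (d & c & Hp) (e & b & Hq).
  exists (d + e)%nat, (fun k => (if Nat.leb k d then c k else 0) + (if Nat.leb k e then b k else 0))%C.
  intros z. rewrite Hp, Hq.
  rewrite (sum_n_C_ext (fun k => c k * z ^ k)%C (fun k => (if Nat.leb k d then c k else 0) * z ^ k)%C d).
  2:{ intros k Hk. destruct (Nat.leb_spec k d); [auto|lia]. }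
  rewrite (sum_n_C_ext (fun k => b k * z ^ k)%C (fun k => (if Nat.leb k e then b k else 0) * z ^ k)%C e).
  2:{ intros k Hk. destruct (Nat.leb_spec k e); [auto|lia]. }
  rewrite <- (sum_n_C_ext_zero (fun k => (if Nat.leb k d then c k else 0) * z ^ k)%C d (d + e)).
  2:{ intros k Hk. destruct (Nat.leb_spec k d); [lia|ring]. }
  2:{ lia. }
  rewrite <- (sum_n_C_ext_zero (fun k => (if Nat.leb k e then b k else 0) * z ^ k)%C e (d + e)).
  2:{ intros k Hk. destruct (Nat.leb_spec k e); [lia|ring]. }
  2:{ lia. }
  change (plus (csum_n (fun k => (if Nat.leb k d then c k else 0) * z ^ k)%C (d + e))
    (csum_n (fun k => (if Nat.leb k e then b k else 0) * z ^ k)%C (d + e)) =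
    csum_n (fun k => ((if Nat.leb k d then c k else 0) + (if Nat.leb k e then b k else 0)) * z ^ k)%C (d + e)).
  rewrite <- sum_n_plus. apply sum_n_C_ext. intros k _.
  change (((if Nat.leb k d then c k else 0) * z ^ k + (if Nat.leb k e then b k else 0) * z ^ k)%C =
   (((if Nat.leb k d then c k else 0) + (if Nat.leb k e then b k else 0)) * z ^ k)%C). ring.
Qed.

Lemma polynomial_scal (x : C) (p : C -> C) : polynomial p -> polynomial (fun z => x * p z)%C.
Proof.
  intros (d & c & Hp). exists d, (fun k => x * c k)%C. intros z. rewrite Hp. clear Hp.
  induction d as [|d IH].
  - rewrite !sum_O. ring.
  - rewrite !sum_Sn, <- IH.
    match goal with |- (_ * ?a)%C = ?b => 
      change (x * (csum_n (fun k => c k * z ^ k) d + c (S d) * z ^ S d) =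
       x * csum_n (fun k => c k * z ^ k) d + x * c (S d) * z ^ S d)%C end.
    ring.
Qed.

Lemma polynomial_pow (k : nat) : polynomial (fun z => z ^ k)%C.
Proof.
  exists k, (fun i => if Nat.eqb i k then 1 else 0)%C. intros z.
  destruct k as [|k].
  - rewrite sum_O. simpl. ring.
  - rewrite sum_Sn.
    rewrite (sum_n_C_ext _ (fun _ => 0%C) k).
    2:{ intros i Hi. destruct (Nat.eqb_spec i (S k)); [lia|ring]. }
    rewrite (sum_n_C_ext_zero (fun _ => RtoC 0) 0 k); [|auto|lia]. rewrite sum_O, Nat.eqb_refl.
    change (z ^ S k = 0 + 1 * z ^ S k)%C. ring.
Qed.

Section Density.

Variables (t : nat -> C) (A : C -> C) (mu : nat -> R).
Hypothesis hH : CdB_data t A mu.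
Hypothesis t_ge2 : forall n, 2 <= Cmod (t n).

Let t_inj := CdB_distinct _ _ _ hH.
Let mu_pos := CdB_mu_pos _ _ _ hH.

Lemma sqrt_mu_pos (n : nat) : 0 < sqrt (mu n).
Proof. apply sqrt_lt_R0, mu_pos. Qed.

Lemma sqrt_mu_sqr (n : nat) : sqrt (mu n) * sqrt (mu n) = mu n.
Proof. apply sqrt_sqrt. left. apply mu_pos. Qed.

Lemma coef_rapid (a : nat -> C) : subset_L2 t mu polynomial -> l2 a -> rapid t (coef mu a).
Proof.
  intros HS Ha k. assert (Hk := HS _ (polynomial_pow k)). unfold in_L2 in Hk.
  apply (ex_series_dom _ (fun n => Cmod (a n) ^ 2 + Cmod (t n ^ k) ^ 2 * mu n)).
  - intros n. rewrite Cmod_coef, Cmod_pow. assert (P1 := Cmod_ge_0 (a n)).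
    assert (P2 := sqrt_mu_pos n). assert (P3 : 0 <= Cmod (t n) ^ k) by apply pow_le, Cmod_ge_0.
    assert (P4 : 0 <= Cmod (a n) * sqrt (mu n) * Cmod (t n) ^ k).
    { apply Rmult_le_pos; auto. apply Rmult_le_pos; lra. }
    split; auto. assert (Q := amgm (Cmod (a n)) (sqrt (mu n) * Cmod (t n) ^ k)).
    assert (M := sqrt_mu_sqr n). set (s := sqrt (mu n)) in *. rewrite <- M.
    replace ((s * Cmod (t n) ^ k) ^ 2) with ((Cmod (t n) ^ k) ^ 2 * (s * s)) in Q by ring. lra.
  - apply ex_series_Rplus; auto.
Qed.

Lemma Csum_polynomial (c : nat -> C) (p : C -> C) : rapid t c -> polynomial p ->
  (forall k, Csum (tpow t c k) = 0%C) ->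
  summ (fun n => c n * p (t n))%C /\ Csum (fun n => c n * p (t n))%C = 0%C.
Proof.
  intros Hc (d & b & Hp) Hm.
  assert (E : forall n, (c n * p (t n))%C = (c n * csum_n (fun k => b k * t n ^ k)%C d)%C).
  { intros n. now rewrite Hp. }
  cut (summ (fun n => c n * csum_n (fun k => b k * t n ^ k)%C d)%C /\
    Csum (fun n => c n * csum_n (fun k => b k * t n ^ k)%C d)%C = 0%C).
  { intros [H1 H2]. split.
    - eapply summ_ext; [|apply H1]. intros n. now rewrite E.
    - rewrite <- H2. apply Csum_ext, E. }
  clear Hp E p. induction d as [|d [S1 S2]].
  - assert (E : forall n, (b O * tpow t c 0 n)%C = (c n * csum_n (fun k => b k * t n ^ k)%C 0)%C).
    { intros n. rewrite sum_O. unfold tpow. simpl. ring. }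
    assert (Q := rapid_summ t c 0 Hc). split.
    + eapply summ_ext; [apply E|]. now apply summ_scal.
    + rewrite <- (Csum_ext _ _ E), Csum_scal, Hm by auto. ring.
  - assert (E : forall n, (c n * csum_n (fun k => b k * t n ^ k) d + b (S d) * tpow t c (S d) n)%C =
       (c n * csum_n (fun k => b k * t n ^ k)%C (S d))%C).
    { intros n. rewrite sum_Sn. unfold tpow.
      change (c n * csum_n (fun k => b k * t n ^ k) d + b (S d) * (c n * t n ^ S d) =
       c n * (csum_n (fun k => b k * t n ^ k) d + b (S d) * t n ^ S d))%C. ring. }
    assert (Q := rapid_summ t c (S d) Hc). split.
    + eapply summ_ext; [apply E|]. apply summ_plus; auto. now apply summ_scal.
    + rewrite <- (Csum_ext _ _ E), Csum_plus, Csum_scal, Hm, S2; auto; [ring|now apply summ_scal].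
Qed.

Lemma in_L2_minus (g p : C -> C) : in_L2 t mu g -> in_L2 t mu p -> in_L2 t mu (fun z => g z - p z)%C.
Proof.
  unfold in_L2. intros Hg Hp.
  apply (ex_series_dom _ (fun n => 2 * (Cmod (g (t n)) ^ 2 * mu n) + 2 * (Cmod (p (t n)) ^ 2 * mu n))).
  - intros n. assert (Hm := mu_pos n). assert (T := Cmod_triangle_sub (g (t n)) (p (t n))).
    assert (P := Cmod_ge_0 (g (t n) - p (t n))). assert (Q := amgm (Cmod (g (t n))) (Cmod (p (t n)))).
    split; [apply Rmult_le_pos; [apply pow2_ge_0|lra]|].
    rewrite <- !Rmult_assoc, <- Rmult_plus_distr_r. apply Rmult_le_compat_r; [lra|]. simpl in *. nra.
  - apply ex_series_Rplus; now apply ex_series_Rscal.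
Qed.

(** Since the elements of [L^2(mu)] are represented by functions on the plane, a sequence is
    extended by zero off [T]. *)
Definition on_t (b : nat -> C) (z : C) : C :=
  match excluded_middle_informative (exists n, z = t n) with
  | left H => b (proj1_sig (constructive_indefinite_description _ H))
  | right _ => 0%C
  end.

Lemma on_t_value (b : nat -> C) (n : nat) : on_t b (t n) = b n.
Proof.
  unfold on_t. destruct excluded_middle_informative as [H|N].
  - destruct (constructive_indefinite_description _ H) as [k E]. simpl. now rewrite (t_inj _ _ E).
  - destruct N. eauto.
Qed.

(** The function [g] with [g (t n) = Cconj (a n) / sqrt (mu n)] pairs with [coef mu a] to the
    squared norm [E] of [a], whereas polynomials pair to zero. Pairing with [g - p] gives
    [E <= (E + |g - p|^2) / 2], and the last norm can be made arbitrarily small. *)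
Lemma dense_moment (a : nat -> C) :
  subset_L2 t mu polynomial -> dense_L2 t mu polynomial -> l2 a ->
  (forall k, Csum (tpow t (coef mu a) k) = 0%C) -> forall n, a n = 0%C.
Proof.
  intros HS HD Ha Hm.
  set (g := on_t (fun n => Cconj (a n) / RtoC (sqrt (mu n)))%C).
  assert (Gt : forall n, g (t n) = (Cconj (a n) / RtoC (sqrt (mu n)))%C) by (intros; apply on_t_value).
  assert (Nm : forall n, RtoC (sqrt (mu n)) <> 0%C).
  { intros n E. apply RtoC_inj in E. assert (P := sqrt_mu_pos n). lra. }
  assert (Gs : forall n, Cmod (g (t n)) ^ 2 * mu n = Cmod (a n) ^ 2).
  { intros n. rewrite Gt, Cmod_div, Cmod_conj, Cmod_R, Rabs_pos_eq by (auto using sqrt_pos).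
    assert (P := sqrt_mu_pos n). assert (M := sqrt_mu_sqr n). set (s := sqrt (mu n)) in *.
    rewrite <- M. field. lra. }
  assert (Hg : in_L2 t mu g).
  { unfold in_L2. apply (ex_series_Rext (fun n => Cmod (a n) ^ 2)); auto. }
  set (E := Series (fun n => Cmod (a n) ^ 2)).
  assert (E0 : E <= 0).
  { apply le_epsilon. intros eps He. rewrite Rplus_0_l.
    destruct (HD g (sqrt eps) Hg (sqrt_lt_R0 _ He)) as (p & Pp & Hp & Hn).
    assert (Hd := in_L2_minus g p Hg Hp).
    set (D := fun n => Cmod (g (t n) - p (t n)) ^ 2 * mu n).
    assert (HD' : ex_series D) by exact Hd.
    unfold L2_norm in Hn. fold D in Hn. apply sqrt_lt_0_alt in Hn.
    destruct (Csum_polynomial (coef mu a) p (coef_rapid a HS Ha) Pp Hm) as [S1 S2].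
    assert (Eg : forall n, (coef mu a n * g (t n))%C = RtoC (Cmod (a n) ^ 2)).
    { intros n. rewrite Gt, Cmod2_conj. unfold coef. field. auto. }
    assert (Sg : summ (fun n => coef mu a n * g (t n))%C).
    { apply (summ_dom _ (fun n => Cmod (a n) ^ 2)); auto. intros n.
      rewrite Eg, Cmod_R, Rabs_pos_eq; [lra|apply pow2_ge_0]. }
    assert (Vg : Csum (fun n => coef mu a n * g (t n))%C = RtoC E).
    { rewrite (Csum_ext _ _ Eg). unfold Csum, RtoC. simpl. f_equal. now apply Series_0. }
    assert (V : Csum (fun n => coef mu a n * g (t n) + - (1) * (coef mu a n * p (t n)))%C = RtoC E).
    { rewrite Csum_plus, (Csum_scal (- (1))), Vg, S2; auto; [ring|now apply summ_scal]. }
    assert (B : Cmod (RtoC E) <= Series (fun n => / 2 * (Cmod (a n) ^ 2 + D n))).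
    { rewrite <- V. apply Csum_dom.
      - intros n. replace (coef mu a n * g (t n) + - (1) * (coef mu a n * p (t n)))%C
          with (coef mu a n * (g (t n) - p (t n)))%C by ring.
        rewrite Cmod_mult, Cmod_coef. unfold D.
        assert (M := sqrt_mu_sqr n). set (s := sqrt (mu n)) in *. rewrite <- M.
        assert (Q := amgm (Cmod (a n)) (s * Cmod (g (t n) - p (t n)))). lra.
      - apply ex_series_Rscal. apply ex_series_Rplus; auto. }
    rewrite Series_scal_l, Series_plus in B by auto. fold E in B.
    rewrite Cmod_R in B. assert (L := Rle_abs E). lra. }
  intros n. apply Cmod_eq_0.
  assert (T := term_le_Series (fun n => Cmod (a n) ^ 2) n (fun n => pow2_ge_0 _) Ha).
  cbv beta in T. fold E in T. assert (P := Cmod_ge_0 (a n)). simpl in T. nra.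
Qed.

(** The radii come from the separation alone and so are the same for all elements; only the order
    [K] of the first nonzero moment depends on the element, and with it the finite exceptional
    sets. *)
Lemma dense_strong_localization (c0 : R) (N : nat) : separated t c0 N ->
  subset_L2 t mu polynomial -> dense_L2 t mu polynomial -> strong_localization t A mu.
Proof.
  intros Hs HS HD. apply (strong_localization_coef t A mu hH t_ge2).
  assert (t_lim := CdB_infty _ _ _ hH).
  exists (sep_radius t c0 N). split; [|split; [|split]].
  - intros n. now apply rad_pos.
  - intros n m Hnm z. now apply rad_disjoint.
  - now apply rad_lim.
  - intros a Ha [n Hn]. 
    destruct (least_nat (fun k => Csum (tpow t (coef mu a) k) <> 0%C)) as (K & HK & Hk).
    + apply NNPP. intros Nk. apply Hn. apply (dense_moment a HS HD Ha). intros k. apply NNPP. eauto.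
    + apply (localized_of_moment t t_inj t_lim t_ge2 c0 N Hs (coef mu a) K); auto.
      * now apply coef_rapid.
      * intros k Lk. apply NNPP. now apply Hk.
Qed.

End Density.

(** * Counting the points of T *)

(** The integer part, made total by the value 0 at negative arguments. *)
Definition nfl (x : R) : nat :=
  match Rle_dec 0 x with left H => proj1_sig (nfloor_ex x H) | right _ => O end.

Lemma nfl_spec (x : R) : 0 <= x -> INR (nfl x) <= x < INR (nfl x) + 1.
Proof.
  intros H. unfold nfl. destruct (Rle_dec 0 x) as [P|P]; [|easy].
  destruct (nfloor_ex x P) as [n Hn]. exact Hn.
Qed.

Definition lsum {X : Type} (g : X -> R) (l : list X) : R := fold_right (fun x s => g x + s) 0 l.

Lemma lsum_filter {X : Type} (g : X -> R) (p : X -> bool) (l : list X) :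
  lsum g l = lsum g (filter p l) + lsum g (filter (fun x => negb (p x)) l).
Proof.
  induction l as [|x l IH]; simpl; [ring|]. rewrite IH.
  destruct (p x); simpl; ring.
Qed.

Lemma lsum_le_length {X : Type} (g : X -> R) (B : R) (l : list X) :
  (forall x, In x l -> g x <= B) -> lsum g l <= INR (length l) * B.
Proof.
  induction l as [|x l IH]; intros H; [simpl; lra|].
  change (length (x :: l)) with (S (length l)). rewrite S_INR. simpl.
  assert (H1 := H x (or_introl eq_refl)).
  assert (H2 : lsum g l <= INR (length l) * B) by (apply IH; intros; apply H; now right). lra.
Qed.

(** Stated for finite lists, so that no rearrangement of series is involved: summability will follow
    from a uniform bound on finite sums. *)
Lemma lsum_by_level {X : Type} (g : X -> R) (f : X -> nat) (card w : nat -> R) (L : nat) :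
  (forall k, 0 <= w k) ->
  (forall x, g x <= w (f x)) ->
  (forall k l, NoDup l -> (forall x, In x l -> f x = k) -> INR (length l) <= card k) ->
  forall l, NoDup l -> (forall x, In x l -> (f x < L)%nat) ->
  lsum g l <= lsum (fun k => card k * w k) (seq 0 L).
Proof.
  intros Hw Hg Hc. induction L as [|L IH]; intros l Hl Hf.
  - destruct l as [|x l]; [simpl; lra|]. specialize (Hf x (or_introl eq_refl)). lia.
  - rewrite seq_S. simpl.
    assert (Ha : forall l1 k, lsum (fun k => card k * w k) (l1 ++ k :: nil) =
      lsum (fun k => card k * w k) l1 + card k * w k).
    { intros l1 k. induction l1 as [|y l1 IH1]; simpl; [ring|]. rewrite IH1. ring. }
    rewrite Ha, (lsum_filter g (fun x => Nat.eqb (f x) L) l), Rplus_comm.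
    apply Rplus_le_compat.
    + apply IH; [now apply NoDup_filter|]. intros x Hx. apply filter_In in Hx. destruct Hx as [Hx E].
      specialize (Hf x Hx). destruct (Nat.eqb_spec (f x) L); [easy|lia].
    + assert (Q : forall x, In x (filter (fun x => Nat.eqb (f x) L) l) -> f x = L).
      { intros x Hx. apply filter_In in Hx. now apply Nat.eqb_eq. }
      eapply Rle_trans; [apply (lsum_le_length g (w L))|].
      * intros x Hx. rewrite <- (Q x Hx). apply Hg.
      * apply Rmult_le_compat_r; auto. apply Hc; auto. now apply NoDup_filter.
Qed.

Lemma lsum_le {X : Type} (g h : X -> R) (l : list X) :
  (forall x, g x <= h x) -> lsum g l <= lsum h l.
Proof. intros H. induction l as [|x l IH]; simpl; [lra|]. specialize (H x). lra. Qed.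

Lemma lsum_rcons {X : Type} (g : X -> R) (l : list X) (x : X) : lsum g (l ++ x :: nil) = lsum g l + g x.
Proof. induction l as [|y l IH]; simpl; [ring|]. rewrite IH. ring. Qed.

(** Comparison with a telescoping sum, by [1 / x^2 <= 2 (1 / x - 1 / (x + 1))]. *)
Lemma lsum_inv_square (K : R) (L : nat) : 0 <= K ->
  lsum (fun k => K * / (INR (S k)) ^ 2) (seq 0 L) <= 2 * K.
Proof.
  intros HK.
  assert (E : lsum (fun k => K * / (INR (S k)) ^ 2) (seq 0 L) <= 2 * K * (1 - / INR (S L))).
  { induction L as [|L IH]; [simpl; rewrite Rinv_1; lra|].
    rewrite seq_S, lsum_rcons. cbn [Nat.add].
    rewrite (S_INR (S L)). set (x := INR (S L)) in *.
    assert (P : 1 <= x) by (unfold x; rewrite S_INR; assert (Q := pos_INR L); lra).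
    assert (Q : / x ^ 2 <= 2 * (/ x - / (x + 1))).
    { apply Rmult_le_reg_r with (x ^ 2 * (x + 1)); [simpl; nra|].
      replace (/ x ^ 2 * (x ^ 2 * (x + 1))) with (x + 1) by (field; lra).
      replace (2 * (/ x - / (x + 1)) * (x ^ 2 * (x + 1))) with (2 * x) by (field; lra). lra. }
    nra. }
  assert (0 < / INR (S L)) by (apply Rinv_0_lt_compat, lt_0_INR; lia). nra.
Qed.

Section Counting.

Variable t : nat -> C.
Hypothesis t_ge2 : forall n, 2 <= Cmod (t n).
Variables (c0 : R) (N : nat).
Hypothesis t_sep : separated t c0 N.

Let level (n : nat) : nat := nfl (Cmod (t n)).

(* Grid cells small enough to hold at most one [t n] each. *)
Let cell (k n : nat) : nat * nat :=
  (nfl ((fst (t n) + INR (S k)) * (2 / c0 * INR (S k) ^ N)),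
   nfl ((snd (t n) + INR (S k)) * (2 / c0 * INR (S k) ^ N))).

Lemma level_bound (k n : nat) : level n = k -> INR k <= Cmod (t n) < INR (S k).
Proof.
  intros <-. unfold level. rewrite S_INR. apply nfl_spec, Cmod_ge_0.
Qed.

Lemma grid_scale_pos (k : nat) : 0 < 2 / c0 * INR (S k) ^ N.
Proof.
  destruct t_sep as (Hc & _). apply Rmult_lt_0_compat; [apply Rdiv_lt_0_compat; lra|].
  apply pow_lt, lt_0_INR. lia.
Qed.

Lemma cell_coord (k : nat) (x : R) : Rabs x <= INR (S k) ->
  0 <= (x + INR (S k)) * (2 / c0 * INR (S k) ^ N) <= 4 / c0 * INR (S k) ^ (S N).
Proof.
  intros Hx. assert (P := grid_scale_pos k). apply Rabs_le_between in Hx. split.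
  - apply Rmult_le_pos; lra.
  - replace (4 / c0 * INR (S k) ^ S N) with (2 * INR (S k) * (2 / c0 * INR (S k) ^ N)).
    + apply Rmult_le_compat_r; lra.
    + destruct t_sep as (Hc & _). generalize (INR (S k)). intros y.
      change (y ^ S N) with (y * y ^ N). field. lra.
Qed.

Lemma cell_close (k : nat) (x y : R) : Rabs x <= INR (S k) -> Rabs y <= INR (S k) ->
  nfl ((x + INR (S k)) * (2 / c0 * INR (S k) ^ N)) = nfl ((y + INR (S k)) * (2 / c0 * INR (S k) ^ N)) ->
  Rabs (x - y) * (2 / c0 * INR (S k) ^ N) < 1.
Proof.
  intros Hx Hy E. assert (Cx := cell_coord k x Hx). assert (Cy := cell_coord k y Hy).
  assert (P := grid_scale_pos k). set (s := 2 / c0 * INR (S k) ^ N) in *.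
  assert (Fx := nfl_spec _ (proj1 Cx)). assert (Fy := nfl_spec _ (proj1 Cy)). rewrite E in Fx.
  rewrite <- (Rabs_pos_eq s) by lra. rewrite <- Rabs_mult. apply Rabs_def1; nra.
Qed.

(** Cells have side [c0 / (2 (k + 1)^N)], so two points in one cell are closer than
    [c0 / (k + 1)^N], which is less than the separation allows for points of modulus below
    [k + 1]. *)
Lemma cell_inj (k n m : nat) : level n = k -> level m = k -> cell k n = cell k m -> n = m.
Proof.
  intros Hn Hm E. destruct (Nat.eq_dec m n) as [|Ne]; auto. exfalso.
  destruct t_sep as (Hc & _ & Hs). specialize (Hs n m Ne).
  assert (Ln := level_bound k n Hn). assert (Lm := level_bound k m Hm).
  unfold cell in E. injection E as E1 E2.
  assert (F1 := cell_close k (fst (t n)) (fst (t m)) ltac:(assert (Q := fst_le_Cmod (t n)); lra)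
    ltac:(assert (Q := fst_le_Cmod (t m)); lra) E1).
  assert (F2 := cell_close k (snd (t n)) (snd (t m)) ltac:(assert (Q := snd_le_Cmod (t n)); lra)
    ltac:(assert (Q := snd_le_Cmod (t m)); lra) E2).
  assert (D : Cmod (t n - t m) <= Rabs (fst (t n) - fst (t m)) + Rabs (snd (t n) - snd (t m))).
  { replace (t n - t m)%C with (RtoC (fst (t n) - fst (t m)) + Ci * RtoC (snd (t n) - snd (t m)))%C
      by (apply injective_projections; simpl; ring).
    eapply Rle_trans; [apply Cmod_triangle|]. rewrite Cmod_mult, Cmod_Ci, !Cmod_R. lra. }
  assert (G := t_ge2 n).
  assert (Pn : 0 < Cmod (t n) ^ N) by (apply pow_lt; lra).
  assert (Pk : Cmod (t n) ^ N <= INR (S k) ^ N) by (apply pow_incr; lra).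
  assert (S0 : c0 / INR (S k) ^ N <= Cmod (t n - t m)).
  { eapply Rle_trans; [|exact Hs]. apply Rmult_le_compat_l; [lra|]. apply Rinv_le_contravar; lra. }
  apply Rmult_le_compat_r with (r := 2 / c0 * INR (S k) ^ N) in S0; [|left; apply grid_scale_pos].
  replace (c0 / INR (S k) ^ N * (2 / c0 * INR (S k) ^ N)) with 2 in S0 by (field; lra).
  assert (P := grid_scale_pos k). nra.
Qed.

(** The points occupy distinct cells of a [G] by [G] grid, as both cell coordinates are at most
    [4 / c0 * (k + 1)^(N + 1)]. *)
Lemma level_card (k : nat) (l : list nat) : NoDup l -> (forall n, In n l -> level n = k) ->
  INR (length l) <= (4 / c0 * INR (S k) ^ (S N) + 1) ^ 2.
Proof.
  intros Hl Hk. set (G := S (nfl (4 / c0 * INR (S k) ^ (S N)))).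
  assert (P0 : 0 <= 4 / c0 * INR (S k) ^ S N).
  { assert (Q := cell_coord k 0 ltac:(rewrite Rabs_R0; apply pos_INR)). lra. }
  assert (HG : INR G <= 4 / c0 * INR (S k) ^ (S N) + 1).
  { unfold G. rewrite S_INR. assert (Q := nfl_spec _ P0). lra. }
  assert (Len : (length l <= G * G)%nat).
  { assert (ND : NoDup (map (cell k) l)).
    { apply Injective_map_NoDup_in; auto. intros x y Hx Hy. apply cell_inj; auto. }
    assert (I : incl (map (cell k) l) (list_prod (seq 0 G) (seq 0 G))).
    { intros p Hp. apply in_map_iff in Hp. destruct Hp as (n & <- & Hn).
      assert (Ln := level_bound k n (Hk n Hn)).
      assert (M : forall x, Rabs x <= INR (S k) ->
        In (nfl ((x + INR (S k)) * (2 / c0 * INR (S k) ^ N))) (seq 0 G)).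
      { intros x Hx. apply in_seq. split; [lia|]. assert (Q := cell_coord k x Hx).
        assert (Q1 := nfl_spec _ (proj1 Q)). assert (Q2 := nfl_spec _ P0).
        rewrite Nat.add_0_l. unfold G. apply INR_lt. rewrite (S_INR (nfl _)). lra. }
      unfold cell. apply in_prod; apply M.
      - assert (Q := fst_le_Cmod (t n)). lra.
      - assert (Q := snd_le_Cmod (t n)). lra. }
    assert (Q := NoDup_incl_length ND I).
    rewrite length_map, length_prod, !length_seq in Q. exact Q. }
  apply le_INR in Len. rewrite mult_INR in Len. assert (Q := pos_INR G).
  rewrite <- Rsqr_pow2. eapply Rle_trans; [exact Len|]. apply Rmult_le_compat; auto.
Qed.

Lemma t_pow_summable : exists q, (1 <= q)%nat /\ ex_series (fun n => / Cmod (t n) ^ q).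
Proof.
  (* Level [k] has at most a multiple of [(k + 1)^(2 N + 2)] points, so this exponent leaves a
     summable [(k + 1)^-2]. *)
  set (q := (N + N + 4)%nat). exists q. split; [lia|].
  destruct t_sep as (Hc & HN & _).
  (* The factor 25 is the square of [4 + 1], the [+ 1] in the count being absorbed since [c0 <= 1];
     [2 ^ q] comes from [|t n| >= (k + 1) / 2] on level [k]. *)
  set (K := 25 / (c0 * c0) * 2 ^ q).
  assert (HK : 0 <= K).
  { unfold K. apply Rmult_le_pos; [|apply pow_le; lra]. left. apply Rdiv_lt_0_compat; [lra|]. apply Rmult_lt_0_compat; lra. }
  set (w := fun k : nat => 2 ^ q * / INR (S k) ^ q).
  assert (Hw : forall k, 0 <= w k).
  { intros k. unfold w. apply Rmult_le_pos; [apply pow_le; lra|]. left. apply Rinv_0_lt_compat, pow_lt, lt_0_INR. lia. }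
  set (card := fun k : nat => (4 / c0 * INR (S k) ^ (S N) + 1) ^ 2).
  assert (Hg : forall n, / Cmod (t n) ^ q <= w (level n)).
  { intros n. unfold w. assert (L := level_bound _ n eq_refl). assert (G := t_ge2 n).
    rewrite <- !pow_inv, <- Rpow_mult_distr.
    assert (P : 0 < INR (S (level n))) by (apply lt_0_INR; lia).
    apply pow_incr. split; [left; apply Rinv_0_lt_compat; lra|].
    replace (2 * / INR (S (level n))) with (/ (INR (S (level n)) / 2)) by (field; lra).
    apply Rinv_le_contravar; [lra|]. rewrite S_INR in *. lra. }
  assert (Hp : forall M, lsum (fun n => / Cmod (t n) ^ q) (seq 0 M) <= 2 * K).
  { intros M.
    assert (exists L, forall x, In x (seq 0 M) -> (level x < L)%nat) as [L HL].
    { induction M as [|M [L HL]]; [exists O; easy|].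
      exists (Nat.max L (S (level M))). intros x Hx. rewrite seq_S in Hx. apply in_app_iff in Hx.
      destruct Hx as [Hx|[<-|[]]]; [specialize (HL x Hx); lia|simpl; lia]. }
    eapply Rle_trans; [apply (lsum_by_level _ level card w L Hw Hg level_card)|].
    - apply seq_NoDup.
    - exact HL.
    - eapply Rle_trans; [|apply (lsum_inv_square K L HK)]. apply lsum_le. intros k.
      unfold card, w, K. set (x := INR (S k)).
      assert (Hx : 1 <= x) by (unfold x; rewrite S_INR; assert (Q := pos_INR k); lra).
      assert (Px : 1 <= x ^ S N) by now apply pow_R1_Rle.
      assert (P1 : 4 / c0 * x ^ S N + 1 <= 5 / c0 * x ^ S N).
      { assert (1 <= / c0) by (rewrite <- Rinv_1; apply Rinv_le_contravar; lra).
        assert (1 <= / c0 * x ^ S N) by nra. unfold Rdiv. lra. }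
      assert (P2 : (4 / c0 * x ^ S N + 1) ^ 2 <= 25 / (c0 * c0) * (x ^ S N * x ^ S N)).
      { replace (25 / (c0 * c0) * (x ^ S N * x ^ S N)) with ((5 / c0 * x ^ S N) ^ 2) by (field; lra).
        apply pow_incr. split; auto. assert (0 < 4 / c0) by (apply Rdiv_lt_0_compat; lra). nra. }
      assert (P3 : x ^ q = (x ^ S N * x ^ S N) * x ^ 2).
      { unfold q. rewrite <- !pow_add. f_equal. lia. }
      rewrite P3. assert (Px2 : 0 < x ^ 2) by (apply pow_lt; lra).
      assert (P4 : 0 <= 2 ^ q * / (x ^ S N * x ^ S N * x ^ 2)).
      { apply Rmult_le_pos; [apply pow_le; lra|]. left. apply Rinv_0_lt_compat.
        apply Rmult_lt_0_compat; [apply Rmult_lt_0_compat; lra|lra]. }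
      eapply Rle_trans; [apply Rmult_le_compat_r; [exact P4|exact P2]|].
      right. field. repeat split; lra. }
  assert (Hpos : forall n, 0 < / Cmod (t n) ^ q).
  { intros n. assert (G := t_ge2 n). apply Rinv_0_lt_compat, pow_lt. lra. }
  assert (E : forall M, sum_n (fun n => / Cmod (t n) ^ q) M = lsum (fun n => / Cmod (t n) ^ q) (seq 0 (S M))).
  { induction M as [|M IH]; [rewrite sum_O; simpl; ring|].
    rewrite sum_Sn, IH, (seq_S (S M)), lsum_rcons. reflexivity. }
  destruct (ex_finite_lim_seq_incr (sum_n (fun n => / Cmod (t n) ^ q)) (2 * K)) as [l Hl].
  - intros n. rewrite sum_Sn. change plus with Rplus. specialize (Hpos (S n)). lra.
  - intros n. rewrite E. apply Hp.
  - exists l. exact Hl.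
Qed.

End Counting.

(** * Small perturbations planting infinitely many zeros *)

Lemma l2_dom (a b : nat -> C) (W : nat -> R) (K : R) :
  (forall n, Cmod (b n) <= Cmod (a n) + K * W n) -> l2 a -> ex_series (fun n => W n ^ 2) -> l2 b.
Proof.
  intros H Ha HW.
  apply (ex_series_dom _ (fun n => 2 * Cmod (a n) ^ 2 + (2 * K ^ 2) * W n ^ 2)).
  - intros n. split; [apply pow2_ge_0|]. specialize (H n).
    assert (P := Cmod_ge_0 (b n)). assert (Q := amgm (Cmod (a n)) (K * W n)).
    assert (E : Cmod (b n) ^ 2 <= (Cmod (a n) + K * W n) ^ 2) by (apply pow_incr; lra).
    simpl in *. lra.
  - apply ex_series_Rplus; now apply ex_series_Rscal.
Qed.

Section Sliding_hump.

Variables (t : nat -> C) (A : C -> C) (mu : nat -> R).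
Hypothesis hH : CdB_data t A mu.
Hypothesis t_ge2 : forall n, 2 <= Cmod (t n).

Let t_inj := CdB_distinct _ _ _ hH.
Let t_lim := CdB_infty _ _ _ hH.

Variable r : nat -> R.
Hypothesis r_pos : forall n, 0 < r n.
Hypothesis r_disj : forall n m, n <> m -> forall z, ~ (Defs.disc (t n) (r n) z /\ Defs.disc (t m) (r m) z).
Hypothesis r_loc : forall a, l2 a -> (exists n, a n <> 0%C) -> localized t (coef mu a) r.

Variable W : nat -> R.
Hypothesis W_pos : forall n, 0 < W n.
Hypothesis W_l2 : ex_series (fun n => W n ^ 2).

Notation zeroa a := (zero_of t (coef mu a)).

(** At a point of [T] a zero is a vanishing coefficient and passes to the limit entrywise. Off [T]
    the transforms converge at [u], because the differences are controlled by the fixed square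
    summable [W]. *)
Lemma zero_of_limit (a : nat -> nat -> C) (b : nat -> C) (M : R) (k0 : nat) (u : C) :
  (forall k, l2 (a k)) -> l2 b ->
  (forall k i, Cmod (a k i - b i) <= M * (/ 2) ^ k * W i) ->
  (forall k, (k0 <= k)%nat -> zeroa (a k) u) -> zeroa b u.
Proof.
  intros Ha Hb Hd Hz.
  destruct (classic (exists n, u = t n)) as [[n ->]|Nu].
  - right. exists n. split; auto. apply (coef_0 t A mu hH). apply NNPP. intros N.
    assert (Hp := proj1 (Cmod_gt_0 _) N).
    destruct (half_pow_small (M * W n) (Cmod (b n)) Hp) as [k Hk].
    assert (Z : a (k0 + k)%nat n = 0%C).
    { destruct (Hz (k0 + k)%nat ltac:(lia)) as [[O _]|(j & E & Z)]; [now destruct (O n)|].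
      apply (proj1 (coef_0 t A mu hH _ _)) in Z. now rewrite (t_inj _ _ E). }
    specialize (Hd (k0 + k)%nat n). rewrite Z in Hd.
    replace (0 - b n)%C with (- b n)%C in Hd by ring. rewrite Cmod_opp in Hd.
    assert (HM : 0 <= M * W n).
    { apply Rnot_lt_le. intros L. assert (P : 0 < (/ 2) ^ (k0 + k)) by (apply pow_lt; lra). nra. }
    assert (L : (/ 2) ^ (k0 + k) <= (/ 2) ^ k).
    { rewrite pow_add. assert (P : 0 < (/ 2) ^ k) by (apply pow_lt; lra).
      assert ((/ 2) ^ k0 <= 1) by (rewrite <- (pow1 k0); apply pow_incr; lra). nra. }
    nra.
  - assert (Ou : forall n, u <> t n) by (intros n E; apply Nu; eauto).
    left. split; auto. apply NNPP. intros N. assert (Hp := proj1 (Cmod_gt_0 _) N).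
    destruct (t_dist_pos t t_lim u (fun _ => True)) as (d & Hd0 & Au0); [auto|].
    assert (Au : forall c, away t c u d) by (intros c n; right; auto).
    assert (LW : l2 (fun n => RtoC (W n))).
    { apply (ex_series_Rext (fun n => W n ^ 2)); auto. intros n. rewrite Cmod_R, pow2_abs. auto. }
    set (S := Series (fun n => Cmod (coef mu (fun n => RtoC (W n)) n / (u - t n)))).
    assert (ES := summ_CT t t_ge2 _ u d (coef_adm t A mu hH t_ge2 _ LW) Hd0 (Au _)).
    destruct (half_pow_small (M * S) (Cmod (CT t (coef mu b) u)) Hp) as [k Hk].
    assert (Z : CT t (coef mu (a (k0 + k)%nat)) u = 0%C).
    { destruct (Hz (k0 + k)%nat ltac:(lia)) as [[_ Z]|(j & E & _)]; auto. now destruct (Ou j). }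
    specialize (Hd (k0 + k)%nat).
    set (ak := a (k0 + k)%nat) in *.
    assert (E : CT t (coef mu b) u = Csum (fun n => coef mu b n / (u - t n) + - (1) * (coef mu ak n / (u - t n)))%C).
    { rewrite Csum_plus, Csum_scal.
      - change (Csum (fun n => coef mu ak n / (u - t n))%C) with (CT t (coef mu ak) u). rewrite Z.
        unfold CT. ring.
      - apply (summ_CT t t_ge2 _ u d); auto. apply (coef_adm t A mu hH t_ge2). apply Ha.
      - apply (summ_CT t t_ge2 _ u d); auto. apply (coef_adm t A mu hH t_ge2). auto.
      - apply summ_scal, (summ_CT t t_ge2 _ u d); auto. apply (coef_adm t A mu hH t_ge2). apply Ha. }
    assert (B : Cmod (CT t (coef mu b) u) <= M * (/ 2) ^ (k0 + k) * S).
    { rewrite E. unfold S. rewrite <- Series_scal_l. apply Csum_dom.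
      - intros n. 
        replace (coef mu b n / (u - t n) + - (1) * (coef mu ak n / (u - t n)))%C
         with (- (ak n - b n) * (RtoC (sqrt (mu n)) / (u - t n)))%C by (unfold coef, Cdiv; ring).
        replace (coef mu (fun n => RtoC (W n)) n / (u - t n))%C with (RtoC (W n) * (RtoC (sqrt (mu n)) / (u - t n)))%C
          by (unfold coef, Cdiv; ring).
        rewrite !Cmod_mult, Cmod_opp, <- Rmult_assoc. apply Rmult_le_compat_r; [apply Cmod_ge_0|].
        rewrite (Cmod_R (W n)), Rabs_pos_eq by (left; apply W_pos). apply Hd.
      - apply ex_series_Rscal. exact ES. }
    assert (HS : 0 <= S) by (apply Series_nonneg; [intros; apply Cmod_ge_0|exact ES]).
    assert (HM : 0 <= M * S).
    { apply Rnot_lt_le. intros L. assert (P : 0 < (/ 2) ^ (k0 + k)) by (apply pow_lt; lra). nra. }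
    assert (L : (/ 2) ^ (k0 + k) <= (/ 2) ^ k).
    { rewrite pow_add. assert (P : 0 < (/ 2) ^ k) by (apply pow_lt; lra).
      assert ((/ 2) ^ k0 <= 1) by (rewrite <- (pow1 k0); apply pow_incr; lra). nra. }
    nra.
Qed.

(** A state pairs a coefficient sequence with a bound: discs of index below the bound are finished,
    and their zeros survive all later modifications. *)
Definition stage (eps : R) (s s' : (nat -> C) * nat) : Prop :=
  exists m u v, (snd s <= m < snd s')%nat /\ u <> v /\
    Defs.disc (t m) (r m) u /\ Defs.disc (t m) (r m) v /\
    zeroa (fst s') u /\ zeroa (fst s') v /\
    (forall i, Cmod (fst s' i - fst s i) <= eps * W i) /\
    (forall k x, (k < snd s)%nat -> Defs.disc (t k) (r k) x -> zeroa (fst s) x -> zeroa (fst s') x).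

(* Infinitely many small modifications, each planting two zeros in a new disc without touching
   the earlier ones, converge to an element that is not localized. *)
Lemma sliding_hump (Inv : (nat -> C) * nat -> Prop) (s0 : (nat -> C) * nat) :
  (forall s eps, Inv s -> 0 < eps -> exists s', Inv s' /\ stage eps s s') ->
  Inv s0 -> l2 (fst s0) -> (exists n, fst s0 n <> 0%C) -> False.
Proof.
  intros Hstep H0 L0 [i0 Hi0]. assert (Hp := proj1 (Cmod_gt_0 _) Hi0).
  (* The changes at [i0] add up to at most [2 e W i0], half of the initial entry, so the limit is
     not zero. *)
  set (e := Cmod (fst s0 i0) / (4 * W i0)).
  assert (He : 0 < e) by (apply Rdiv_lt_0_compat; auto; specialize (W_pos i0); lra).
  assert (Hk : forall k, 0 < e * (/ 2) ^ k) by (intros k; apply Rmult_lt_0_compat; auto; apply pow_lt; lra).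
  assert (St : forall (k : nat) (s : {s | Inv s}), exists s' : {s | Inv s}, stage (e * (/ 2) ^ k) (proj1_sig s) (proj1_sig s')).
  { intros k [s Hs]. destruct (Hstep s _ Hs (Hk k)) as (s' & Hs' & Hst). exists (exist _ s' Hs'). exact Hst. }
  set (F := fun k s => proj1_sig (constructive_indefinite_description _ (St k s))).
  set (X := fun k => nat_rect (fun _ => {s | Inv s}) (exist _ s0 H0) F k).
  assert (XS : forall k, stage (e * (/ 2) ^ k) (proj1_sig (X k)) (proj1_sig (X (S k)))).
  { intros k. change (X (S k)) with (F k (X k)). unfold F.
    destruct (constructive_indefinite_description _ (St k (X k))) as [s' Hs']. exact Hs'. }
  set (a := fun k => fst (proj1_sig (X k))). set (b := fun k => snd (proj1_sig (X k))).
  assert (Inc : forall k i, Cmod (a (S k) i - a k i) <= e * W i * (/ 2) ^ k).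
  { intros k i. destruct (XS k) as (m & u & v & _ & _ & _ & _ & _ & _ & Hd & _). specialize (Hd i).
    unfold a. lra. }
  assert (Bm : forall k j, (k <= j)%nat -> (b k <= b j)%nat).
  { intros k j Hkj. induction Hkj as [|j Hkj IH]; auto.
    destruct (XS j) as (m & u & v & Hm & _). fold (b j) (b (S j)) in Hm. lia. }
  assert (Bk : forall k, (k <= b k)%nat).
  { induction k; [lia|]. destruct (XS k) as (m & u & v & Hm & _). fold (b k) (b (S k)) in Hm. lia. }
  assert (Lim : forall i, exists l, forall k, Cmod (a k i - l) <= 2 * (e * W i) * (/ 2) ^ k).
  { intros i. apply (geom_limit (fun k => a k i)). intros k. apply Inc. }
  set (al := fun i => proj1_sig (constructive_indefinite_description _ (Lim i))).
  assert (Hal : forall k i, Cmod (a k i - al i) <= (2 * e) * (/ 2) ^ k * W i).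
  { intros k i. unfold al. destruct (constructive_indefinite_description _ (Lim i)) as [l Hl]. simpl.
    specialize (Hl k). lra. }
  assert (Lal : l2 al).
  { apply (l2_dom (fst s0) al W (2 * e)); auto. intros n. specialize (Hal O n). simpl in Hal.
    change (a O n) with (fst s0 n) in Hal.
    assert (T := Cmod_triangle_rev (al n) (fst s0 n)). rewrite Cmod_sub_sym in T. lra. }
  assert (La : forall k, l2 (a k)).
  { intros k. apply (l2_dom al (a k) W (2 * e)); auto. intros n. specialize (Hal k n).
    assert (T := Cmod_triangle_rev (a k n) (al n)).
    assert (P : (/ 2) ^ k <= 1) by (rewrite <- (pow1 k); apply pow_incr; lra).
    specialize (W_pos n). assert (0 < 2 * e * W n) by nra. nra. }
  assert (Nal : al i0 <> 0%C).
  { intros Z. specialize (Hal O i0). rewrite Z in Hal. change (a O i0) with (fst s0 i0) in Hal.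
    replace (fst s0 i0 - 0)%C with (fst s0 i0) in Hal by ring. simpl in Hal.
    replace (2 * e * 1 * W i0) with (Cmod (fst s0 i0) / 2) in Hal; [lra|].
    unfold e. field. specialize (W_pos i0). lra. }
  destruct (r_loc al Lal (ex_intro _ i0 Nal)) as [_ [l Hl]].
  (* Stage [k] plants its zeros in a disc of index at least [k], beyond every exceptional index in
     [l]. *)
  set (k := S (list_max l)).
  destruct (XS k) as (m & u & v & Hm & Huv & Du & Dv & Zu & Zv & _).
  fold (b k) (b (S k)) in Hm. fold (a (S k)) in Zu, Zv.
  assert (Kp : forall x, Defs.disc (t m) (r m) x -> zeroa (a (S k)) x -> zeroa al x).
  { intros x Dx Zx. apply (zero_of_limit a al (2 * e) (S k) x La Lal Hal).
    intros j Hj. induction Hj as [|j Hj IH]; auto.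
    destruct (XS j) as (m' & u' & v' & _ & _ & _ & _ & _ & _ & _ & Pz).
    apply (Pz m x); auto. fold (b j). assert (Q := Bm (S k) j Hj). lia. }
  assert (Nm : ~ In m l).
  { intros Hin. assert (Q := proj1 (list_max_le l (list_max l)) (le_n _)).
    rewrite Forall_forall in Q. specialize (Q m Hin). specialize (Bk k). unfold k in *. lia. }
  apply Nm, Hl. intros (z & _ & Uz). apply Huv.
  rewrite <- (Uz u), <- (Uz v); auto.
Qed.

End Sliding_hump.

(* The Moebius factor [(1 - z / w') / (1 - z / w)], which moves a zero from [w] to [w']. *)
Definition mover (w w' z : C) : C := ((w / w' * z + - w) / (z - w))%C.

Lemma mover_near_1 (w w' z : C) : z <> w -> (w' : C) <> 0%C -> 2 * Cmod z <= Cmod w -> 0 < Cmod w ->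
  Cmod (mover w w' z - 1) <= 2 * Cmod z * (/ Cmod w + / Cmod w').
Proof.
  intros Hz Hw' H Hw. assert (N := Csub_neq0 _ _ Hz). assert (Hw'p := proj1 (Cmod_gt_0 _) Hw').
  assert (Nw : w <> 0%C) by now apply Cmod_gt_0.
  replace (mover w w' z - 1)%C with (z * (w - w') / (w' * (z - w)))%C by (unfold mover; field; auto).
  rewrite Cmod_div, !Cmod_mult by now apply Cmult_neq_0.
  assert (T := Cmod_triangle_sub w w').
  assert (D : Cmod w / 2 <= Cmod (z - w)).
  { rewrite Cmod_sub_sym. assert (T2 := Cmod_triangle_rev w z). lra. }
  assert (Pz := Cmod_ge_0 z).
  apply Rle_trans with (Cmod z * (Cmod w + Cmod w') / (Cmod w' * (Cmod w / 2))).
  - apply Rmult_le_compat.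
    + apply Rmult_le_pos; auto. apply Cmod_ge_0.
    + left. apply Rinv_0_lt_compat, Rmult_lt_0_compat; lra.
    + now apply Rmult_le_compat_l.
    + apply Rinv_le_contravar; [apply Rmult_lt_0_compat; lra|]. apply Rmult_le_compat_l; lra.
  - right. field. lra.
Qed.

(** Finitely many points are small compared with [w] and [w'] once these are far out. The remaining
    indices must be handled by vanishing or decay of the coefficients. *)
Lemma mover_prefix (t a : nat -> C) (W : nat -> R) (b : nat) (eps : R) :
  (forall n, 2 <= Cmod (t n)) -> (forall n, 0 < W n) -> 0 < eps ->
  exists X, 1 <= X /\ forall w w', X <= Cmod w -> X <= Cmod w' ->
    forall i, (i < b)%nat -> Cmod (a i * mover w w' (t i) - a i) <= eps * W i.
Proof.
  intros Ht HW He. induction b as [|b (X & HX & IH)].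
  - exists 1. split; [lra|]. lia.
  - specialize (Ht b). assert (HWb := HW b). assert (Pa := Cmod_ge_0 (a b)).
    assert (Q0 : 0 < eps * W b) by now apply Rmult_lt_0_compat.
    assert (Q1 : 0 <= 4 * Cmod (t b) * Cmod (a b) / (eps * W b)).
    { apply Rmult_le_pos; [|left; now apply Rinv_0_lt_compat]. nra. }
    exists (X + (2 * Cmod (t b) + 1) + 4 * Cmod (t b) * Cmod (a b) / (eps * W b)).
    split; [lra|]. intros w w' Hw Hw' i Hi.
    destruct (Nat.eq_dec i b) as [->|Ne]; [|apply IH; lra || lia].
    set (Y := X + (2 * Cmod (t b) + 1) + 4 * Cmod (t b) * Cmod (a b) / (eps * W b)) in *.
    assert (HY : 1 <= Y) by (unfold Y; lra).
    assert (HY2 : 2 * Cmod (t b) <= Y) by (unfold Y; lra).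
    replace (a b * mover w w' (t b) - a b)%C with (a b * (mover w w' (t b) - 1))%C by ring.
    rewrite Cmod_mult.
    assert (Nw : t b <> w) by (intros E; rewrite <- E in Hw; unfold Y in Hw; lra).
    assert (Nw' : w' <> 0%C) by (apply Cmod_gt_0; lra).
    assert (M := mover_near_1 w w' (t b) Nw Nw' ltac:(lra) ltac:(lra)).
    assert (I1 : / Cmod w <= / Y) by (apply Rinv_le_contravar; lra).
    assert (I2 : / Cmod w' <= / Y) by (apply Rinv_le_contravar; lra).
    apply Rle_trans with (Cmod (a b) * (2 * Cmod (t b) * (2 * / Y))).
    { apply Rmult_le_compat_l; auto. eapply Rle_trans; [exact M|]. apply Rmult_le_compat_l; lra. }
    apply Rmult_le_reg_r with Y; [lra|].
    replace (Cmod (a b) * (2 * Cmod (t b) * (2 * / Y)) * Y) with (4 * Cmod (t b) * Cmod (a b)) by (field; lra).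
    replace (4 * Cmod (t b) * Cmod (a b)) with (eps * W b * (4 * Cmod (t b) * Cmod (a b) / (eps * W b))) by (field; lra).
    apply Rmult_le_compat_l; [lra|]. unfold Y. lra.
Qed.

(** * Localization forces rapid decay of the masses *)

Section Mass_decay.

Variables (t : nat -> C) (A : C -> C) (mu : nat -> R).
Hypothesis hH : CdB_data t A mu.
Hypothesis t_ge2 : forall n, 2 <= Cmod (t n).

Let t_inj := CdB_distinct _ _ _ hH.
Let t_lim := CdB_infty _ _ _ hH.

Variable r : nat -> R.
Hypothesis r_pos : forall n, 0 < r n.
Hypothesis r_disj : forall n m, n <> m -> forall z, ~ (Defs.disc (t n) (r n) z /\ Defs.disc (t m) (r m) z).
Hypothesis r_lim : is_lim_seq r 0.
Hypothesis r_loc : forall a, l2 a -> (exists n, a n <> 0%C) -> localized t (coef mu a) r.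

Variable q : nat.
Hypothesis q_sum : ex_series (fun n => / Cmod (t n) ^ q).

Definition weight (n : nat) : R := / Cmod (t n) ^ q.

Lemma weight_pos (n : nat) : 0 < weight n.
Proof. specialize (t_ge2 n). apply Rinv_0_lt_compat, pow_lt. lra. Qed.

Lemma weight_le1 (n : nat) : weight n <= 1.
Proof.
  unfold weight. rewrite <- Rinv_1. apply Rinv_le_contravar; [lra|].
  apply pow_R1_Rle. specialize (t_ge2 n). lra.
Qed.

Lemma weight_l2 : ex_series (fun n => weight n ^ 2).
Proof.
  apply (ex_series_dom _ weight); auto. intros n. assert (P := weight_pos n).
  assert (L := weight_le1 n). simpl. split; nra.
Qed.

Lemma r_eventually_small : exists n0, forall n, (n0 <= n)%nat -> r n < 1.
Proof.
  apply is_lim_seq_spec in r_lim. destruct (r_lim (mkposreal 1 Rlt_0_1)) as [n0 H].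
  exists n0. intros n Hn. specialize (H n Hn). simpl in H. rewrite Rminus_0_r in H.
  apply Rabs_def2 in H. lra.
Qed.

Lemma disc_t (n k : nat) : Defs.disc (t k) (r k) (t n) -> n = k.
Proof.
  intros H. destruct (Nat.eq_dec n k) as [|Ne]; auto. exfalso.
  apply (r_disj n k Ne (t n)). split; auto. unfold Defs.disc. rewrite Cmod_self_sub. apply r_pos.
Qed.

Definition uncoef (c : nat -> C) (n : nat) : C := (c n / RtoC (sqrt (mu n)))%C.

Lemma sqrt_mu_neq0 (n : nat) : RtoC (sqrt (mu n)) <> 0%C.
Proof. intros E. apply RtoC_inj in E. assert (P := sqrt_mu_pos t A mu hH n). lra. Qed.

Lemma coef_uncoef (c : nat -> C) (n : nat) : coef mu (uncoef c) n = c n.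
Proof. unfold coef, uncoef. field. apply sqrt_mu_neq0. Qed.

(* Multiplication of a finitely supported transform by [(p z + q) / (z - t n)]. *)
Definition extend (c : nat -> C) (n : nat) (p p0 : C) (i : nat) : C :=
  if Nat.eqb i n then ((p * t n + p0) * CT t c (t n))%C else (c i * ((p * t i + p0) / (t i - t n)))%C.

Definition supported (c : nat -> C) (b : nat) : Prop := forall i, (b <= i)%nat -> c i = 0%C.

Lemma supported_away (c : nat -> C) (b : nat) (z : C) : supported c b ->
  (forall i, (i < b)%nat -> z <> t i) -> exists d, 0 < d /\ away t c z d.
Proof.
  intros Hs Hz. apply away_neq; auto. intros i Hi. apply Hz.
  destruct (Nat.lt_ge_cases i b); auto. exfalso. now apply Hi, Hs.
Qed.

Lemma extend_supported (c : nat -> C) (b n : nat) (p p0 : C) : supported c b -> (b <= n)%nat ->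
  supported (extend c n p p0) (S n).
Proof.
  intros Hs Hn i Hi. unfold extend. destruct (Nat.eqb_spec i n); [lia|].
  rewrite Hs by lia. ring.
Qed.

(** [t n] is not yet a pole, so the Moebius identity applies at [w = t n]; its correction term is
    exactly the new entry, with residue [(p t n + p0) * CT t c (t n)]. *)
Lemma extend_CT (c : nat -> C) (b n : nat) (p p0 z : C) : supported c b -> (b <= n)%nat ->
  (forall i, (i < S n)%nat -> z <> t i) ->
  CT t (extend c n p p0) z = ((p * z + p0) / (z - t n) * CT t c z)%C.
Proof.
  intros Hs Hn Hz.
  assert (Hs' := extend_supported c b n p p0 Hs Hn).
  destruct (supported_away _ _ z Hs' Hz) as (d & Hd & Az).
  destruct (supported_away c b z Hs) as (d1 & Hd1 & Az1); [intros i Hi; apply Hz; lia|].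
  destruct (supported_away c b (t n) Hs) as (d2 & Hd2 & An).
  { intros i Hi E. apply t_inj in E. lia. }
  rewrite (CT_drop t t_ge2 _ z d n (adm_0_finite t _ _ Hs') Hd Az).
  assert (Nz : z <> t n) by (apply Hz; lia).
  rewrite (CT_ext t (drop n (extend c n p p0)) (fun i => c i * ((p * t i + p0) / (t i - t n)))%C).
  - rewrite (CT_mobius t t_ge2 c p p0 z (t n) d1 d2); auto; [|now apply (adm_0_finite t c b)].
    unfold extend. rewrite Nat.eqb_refl. field. now apply Csub_neq0.
  - intros i. unfold drop, extend. destruct (Nat.eqb_spec i n) as [->|]; auto.
    rewrite Hs by auto. ring.
Qed.

Definition decays (c : nat -> C) (b P : nat) : Prop :=
  exists K R, 0 <= K /\ 1 <= R /\ forall z, (forall i, (i < b)%nat -> z <> t i) -> R <= Cmod z ->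
    Cmod (CT t c z) * Cmod z ^ P <= K.

Lemma far_from_t (n : nat) (z : C) : 2 * Cmod (t n) <= Cmod z -> Cmod z / 2 <= Cmod (z - t n).
Proof. intros H. assert (T := Cmod_triangle_rev z (t n)). lra. Qed.

(** The transform is the product of the [1 / (z - t i)] for [i <= P]; each factor after the first
    adds a pole and gains a power of [1 / |z|]. *)
Lemma decaying_element (P : nat) : exists c b, supported c b /\ (exists i, c i <> 0%C) /\ decays c b P.
Proof.
  induction P as [|P (c & b & Hs & [i0 Hi0] & K & R & HK & HR & H)].
  - exists (fun i => if Nat.eqb i 0 then 1 else 0)%C, 1%nat. split; [|split].
    + intros i Hi. destruct (Nat.eqb_spec i 0); [lia|auto].
    + exists O. simpl. apply C1_nz.
    + exists 1, (2 * Cmod (t 0%nat)). specialize (t_ge2 O). split; [lra|]. split; [lra|].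
      intros z Hz Hr. unfold CT.
      rewrite (Csum_ext _ (fun n => if Nat.eqb n 0 then 1 / (z - t 0%nat) else 0)%C).
      2:{ intros n. destruct (Nat.eqb_spec n 0) as [->|]; auto. unfold Cdiv. ring. }
      rewrite Csum_single. assert (F := far_from_t O z Hr).
      rewrite Cmod_div, Cmod_1 by (apply Csub_neq0, Hz; lia). simpl. rewrite Rmult_1_r. unfold Rdiv. rewrite Rmult_1_l.
      rewrite <- Rinv_1. apply Rinv_le_contravar; lra.
  - exists (extend c b 0 1), (S b). split; [now apply (extend_supported c b)|].
    assert (Lt : (i0 < b)%nat).
    { destruct (Nat.lt_ge_cases i0 b); auto. exfalso. now apply Hi0, Hs. }
    split.
    + exists i0. unfold extend. destruct (Nat.eqb_spec i0 b); [lia|].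
      replace (0 * t i0 + 1)%C with (RtoC 1) by ring.
      apply Cmult_neq_0; auto. apply Cmult_neq_0; [apply C1_nz|]. apply Cinv_neq_0, Csub_neq0.
      intros E. apply t_inj in E. lia.
    + assert (Pb := Cmod_ge_0 (t b)). exists (2 * K), (R + 2 * Cmod (t b)). split; [lra|]. split; [lra|].
      intros z Hz Hr. rewrite (extend_CT c b b) by auto.
      assert (F := far_from_t b z ltac:(lra)).
      rewrite Cmod_mult, Cmod_div by (apply Csub_neq0, Hz; lia).
      replace (0 * z + 1)%C with (RtoC 1) by ring. rewrite Cmod_1.
      assert (H' := H z ltac:(intros i Hi; apply Hz; lia) ltac:(lra)).
      simpl pow.
      replace (1 / Cmod (z - t b) * Cmod (CT t c z) * (Cmod z * Cmod z ^ P)) with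
        (Cmod z / Cmod (z - t b) * (Cmod (CT t c z) * Cmod z ^ P)) by (field; lra).
      apply Rmult_le_compat; auto.
      * apply Rmult_le_pos; [lra|]. left. apply Rinv_0_lt_compat. lra.
      * apply Rmult_le_pos; [apply Cmod_ge_0|]. apply pow_le. lra.
      * apply Rmult_le_reg_r with (Cmod (z - t b)); [lra|].
        unfold Rdiv. rewrite Rmult_assoc, Rinv_l by lra. lra.
Qed.

Section Heavy.

Variable M : nat.
Hypothesis heavy : forall B, exists n, (B <= n)%nat /\ / Cmod (t n) ^ (M + M) < mu n.

(** The decay needed at the new pole [w]: two powers for the numerator of the Moebius factor, [M]
    for dividing by [sqrt (mu n)], [q] for the weight, and one more that makes the change small. *)
Let P := (M + q + 3)%nat.

(** An additional zero has to be paid for by a pole. A heavy [t n] is where a pole is cheap, since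
    its entry in the square summable sequence is the residue divided by [sqrt (mu n)]. *)
Lemma heavy_stage (s : (nat -> C) * nat) (eps : R) :
  supported (coef mu (fst s)) (snd s) /\ decays (coef mu (fst s)) (snd s) P -> 0 < eps ->
  exists s', (supported (coef mu (fst s')) (snd s') /\ decays (coef mu (fst s')) (snd s') P) /\
    stage t mu r weight eps s s'.
Proof.
  destruct s as [a b]. simpl fst. simpl snd. intros [Hs (K & R & HK & HR & H)] He.
  destruct (mover_prefix t a weight b eps t_ge2 weight_pos He) as (X & HX & Hpre).
  destruct r_eventually_small as [n1 Hn1].
  assert (HKe : 0 <= 2 * K / eps) by (apply Rmult_le_pos; [lra|left; now apply Rinv_0_lt_compat]).
  destruct (t_eventually t t_lim (X + R + 2 * K / eps + 1)) as [n2 Hn2].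
  destruct (heavy (b + n1 + n2)) as (n & Hn & Hmu).
  (* The disc around [t (S n)] already contains a zero, its centre, where the coefficient vanishes;
     [w'] is a second point of that disc. *)
  set (w := t n). set (w' := (t (S n) + RtoC (r (S n) / 2))%C).
  assert (Lw : X + R + 2 * K / eps + 1 < Cmod w) by (apply Hn2; lia).
  assert (Dw' : Defs.disc (t (S n)) (r (S n)) w').
  { unfold Defs.disc, w'. replace (t (S n) + RtoC (r (S n) / 2) - t (S n))%C with (RtoC (r (S n) / 2)) by ring.
    rewrite Cmod_R. assert (Q := r_pos (S n)). rewrite Rabs_pos_eq; lra. }
  assert (Nw' : w' <> t (S n)).
  { intros E. assert (Q := r_pos (S n)).
    assert (Z : RtoC (r (S n) / 2) = 0%C) by (transitivity (w' - t (S n))%C; [unfold w'; ring|rewrite E; ring]).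
    apply RtoC_inj in Z. lra. }
  assert (Ow' : forall j, w' <> t j).
  { intros j E. assert (Ej : j = S n) by (apply disc_t; now rewrite <- E). subst j. auto. }
  assert (Lw' : X + R + 2 * K / eps < Cmod w').
  { assert (L1 := Hn2 (S n) ltac:(lia)). assert (L2 := Hn1 (S n) ltac:(lia)).
    unfold Defs.disc in Dw'. assert (T := Cmod_triangle_rev (t (S n)) w'). rewrite Cmod_sub_sym in T. lra. }
  assert (W0 : w' <> 0%C) by (apply Cmod_gt_0; lra).
  set (c := coef mu a) in *. set (c' := extend c n (w / w')%C (- w)%C).
  assert (Hs' : supported c' (S n)) by (apply (extend_supported c b); auto; lia).
  assert (ECT : forall z, (forall i, (i < S n)%nat -> z <> t i) -> CT t c' z = (mover w w' z * CT t c z)%C).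
  { intros z Hz. apply (extend_CT c b n); auto. lia. }
  (* The bound passes [S n], so the disc that just received its two zeros is finished and its centre
     never becomes a pole. *)
  exists (uncoef c', S (S n)). simpl fst. simpl snd.
  assert (Ec : forall i, coef mu (uncoef c') i = c' i) by (intros; apply coef_uncoef).
  assert (Ect : forall z, CT t (coef mu (uncoef c')) z = CT t c' z) by (intros; now apply CT_ext).
  split; [split|].
  - intros i Hi. rewrite Ec. apply Hs'. lia.
  - exists ((2 * Cmod (w / w') + 2 * Cmod w) * K), (R + 2 * Cmod w).
    assert (P1 := Cmod_ge_0 (w / w')). assert (P2 := Cmod_ge_0 w).
    split; [apply Rmult_le_pos; lra|]. split; [lra|].
    intros z Hz Hr. rewrite Ect, ECT by (intros i Hi; apply Hz; lia).
    assert (F := far_from_t n z ltac:(fold w; lra)). fold w in F.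
    assert (H' := H z ltac:(intros i Hi; apply Hz; lia) ltac:(lra)).
    rewrite Cmod_mult, Rmult_assoc. apply Rmult_le_compat; auto; [apply Cmod_ge_0| |].
    + apply Rmult_le_pos; [apply Cmod_ge_0|]. apply pow_le. lra.
    + unfold mover. assert (Nz : (z - w)%C <> 0%C) by (apply Cmod_gt_0; lra).
      rewrite Cmod_div by auto. apply Rmult_le_reg_r with (Cmod (z - w)); [lra|].
      unfold Rdiv. rewrite Rmult_assoc, Rinv_l, Rmult_1_r by lra.
      eapply Rle_trans; [apply Cmod_triangle|]. rewrite Cmod_mult, Cmod_opp. nra.
  - exists (S n), (t (S n)), w'. simpl fst. simpl snd.
    split; [lia|]. split; [auto|]. split.
    { unfold Defs.disc. rewrite Cmod_self_sub. apply r_pos. }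
    split; [auto|]. split; [|split; [|split]].
    + right. exists (S n). split; auto. rewrite Ec. apply Hs'. lia.
    + left. split; auto. rewrite Ect, ECT by auto. unfold mover.
      replace (w / w' * w' + - w)%C with (RtoC 0) by (field; auto). unfold Cdiv. ring.
    + intros i. assert (Wi := weight_pos i).
      destruct (Nat.eq_dec i n) as [->|Ni].
      (* The entry at the new pole is the only one where the mass matters: heaviness gives
         [sqrt (mu n) >= |w|^-M], and the decay of the transform at [w] does the rest. *)
      * assert (Z : a n = 0%C) by (apply (proj1 (coef_0 t A mu hH a n)), Hs; lia).
        rewrite Z. unfold uncoef, c', extend. rewrite Nat.eqb_refl. fold w.
        match goal with |- Cmod (?x - _)%C <= _ => replace (x - 0)%C with x by ring end.
        assert (Sm := sqrt_mu_pos t A mu hH n).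
        rewrite Cmod_div, Cmod_mult, Cmod_R, Rabs_pos_eq by (try apply sqrt_mu_neq0; lra).
        assert (H' := H w ltac:(intros i Hi E; apply t_inj in E; lia) ltac:(lra)).
        assert (Bm : / Cmod w ^ M <= sqrt (mu n)).
        { rewrite <- (sqrt_Rsqr (/ Cmod w ^ M)).
          - apply sqrt_le_1_alt. unfold Rsqr. rewrite <- Rinv_mult, <- pow_add. left. exact Hmu.
          - left. apply Rinv_0_lt_compat, pow_lt. lra. }
        assert (Cf : Cmod (w / w' * w + - w) <= 2 * Cmod w ^ 2).
        { eapply Rle_trans; [apply Cmod_triangle|]. rewrite Cmod_opp, Cmod_mult, Cmod_div by auto.
          assert (Cmod w / Cmod w' <= Cmod w).
          { unfold Rdiv. rewrite <- (Rmult_1_r (Cmod w)) at 2. apply Rmult_le_compat_l; [lra|].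
            rewrite <- Rinv_1. apply Rinv_le_contravar; lra. }
          simpl. nra. }
        set (x := Cmod w) in *. assert (Hx : 1 < x) by lra.
        assert (Px : forall k, 0 < x ^ k) by (intros; apply pow_lt; lra).
        assert (Bc : Cmod (CT t c w) <= K / x ^ P).
        { apply Rmult_le_reg_r with (x ^ P); auto. unfold Rdiv. rewrite Rmult_assoc, Rinv_l; [lra|].
          apply Rgt_not_eq, Px. }
        assert (Is : / sqrt (mu n) <= x ^ M).
        { rewrite <- (Rinv_inv (x ^ M)). apply Rinv_le_contravar; auto. apply Rinv_0_lt_compat, Px. }
        apply Rle_trans with (2 * x ^ 2 * (K / x ^ P) * x ^ M).
        { apply Rmult_le_compat; auto.
          - apply Rmult_le_pos; apply Cmod_ge_0.
          - left. now apply Rinv_0_lt_compat.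
          - apply Rmult_le_compat; auto; apply Cmod_ge_0. }
        unfold weight. fold w x.
        assert (EP : x ^ P = x ^ M * x ^ q * (x ^ 2 * x)).
        { unfold P. rewrite !pow_add. simpl. ring. }
        rewrite EP.
        replace (2 * x ^ 2 * (K / (x ^ M * x ^ q * (x ^ 2 * x))) * x ^ M) with (2 * K / eps / x * (eps * / x ^ q)).
        2:{ assert (N1 := Rgt_not_eq _ _ (Px M)). assert (N2 := Rgt_not_eq _ _ (Px q)). field. repeat split; auto; lra. }
        rewrite <- (Rmult_1_l (eps * / x ^ q)) at 2. apply Rmult_le_compat_r.
        { left. apply Rmult_lt_0_compat; auto using Rinv_0_lt_compat. }
        apply Rmult_le_reg_r with x; [lra|]. unfold Rdiv at 1. rewrite Rmult_assoc, Rinv_l by lra. lra.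
      * destruct (Nat.lt_ge_cases i b) as [L|L].
        -- assert (E : uncoef c' i = (a i * mover w w' (t i))%C).
           { unfold uncoef, c', extend. destruct (Nat.eqb_spec i n); [easy|].
             fold w (mover w w' (t i)). unfold c, coef. generalize (mover w w' (t i)). intros y. field. apply sqrt_mu_neq0. }
           rewrite E. apply Hpre; auto; lra.
        -- assert (Z : a i = 0%C) by (apply (proj1 (coef_0 t A mu hH a i)), Hs; lia).
           assert (Z' : uncoef c' i = 0%C).
           { unfold uncoef, c', extend. destruct (Nat.eqb_spec i n); [easy|].
             unfold c, coef. rewrite Z. unfold Cdiv. ring. }
           rewrite Z, Z', Cmod_self_sub. left. now apply Rmult_lt_0_compat.
    + intros k x Hk Dx [[Ox Zx]|(j & -> & Zj)].
      * left. split; auto. rewrite Ect, ECT by auto. fold c in Zx. rewrite Zx. ring.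
      * right. exists j. split; auto. apply disc_t in Dx. subst j.
        rewrite Ec. unfold c', extend. destruct (Nat.eqb_spec k n); [lia|].
        fold c in Zj. rewrite Zj. ring.
Qed.

Lemma no_heavy_masses : False.
Proof.
  destruct (decaying_element P) as (c & b & Hs & [i0 Hi0] & Hd).
  assert (Ec : forall i, coef mu (uncoef c) i = c i) by (intros; apply coef_uncoef).
  apply (sliding_hump t A mu hH t_ge2 r r_loc weight weight_pos weight_l2
    (fun s => supported (coef mu (fst s)) (snd s) /\ decays (coef mu (fst s)) (snd s) P) (uncoef c, b)).
  - intros s eps Hi He. now apply heavy_stage.
  - simpl. split.
    + intros i Hi. rewrite Ec. now apply Hs.
    + destruct Hd as (K & R & HK & HR & H). exists K, R. split; [auto|]. split; [auto|].
      intros z Hz Hr. rewrite (CT_ext t _ c) by apply Ec. now apply H.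
  - apply (ex_series_eventually_0 _ b). intros i Hi. simpl fst. unfold uncoef. rewrite Hs by auto.
    unfold Cdiv. rewrite Cmult_0_l, Cmod_0. simpl. ring.
  - exists i0. simpl. unfold uncoef. apply Cmult_neq_0; auto. apply Cinv_neq_0, sqrt_mu_neq0.
Qed.

End Heavy.

Lemma mass_decay (M : nat) : exists n0, forall n, (n0 <= n)%nat -> mu n <= / Cmod (t n) ^ (M + M).
Proof.
  apply NNPP. intros N. apply (no_heavy_masses M). intros B. apply NNPP. intros N'.
  apply N. exists B. intros n Hn. apply Rnot_lt_le. intros L. apply N'. eauto.
Qed.

Lemma localized_subset_L2 : subset_L2 t mu polynomial.
Proof.
  assert (Pw : forall k, in_L2 t mu (fun z => z ^ k)%C).
  { intros k. destruct (mass_decay (k + q)) as [n0 H]. unfold in_L2.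
    apply (ex_series_incr_n (K := R_AbsRing) (V := R_NormedModule) _ n0).
    apply (ex_series_dom _ (fun n => / Cmod (t (n0 + n)%nat) ^ q)).
    - intros n. specialize (H (n0 + n)%nat ltac:(lia)). specialize (t_ge2 (n0 + n)%nat).
      rewrite Cmod_pow. set (x := Cmod (t (n0 + n)%nat)) in *.
      assert (Hm := CdB_mu_pos _ _ _ hH (n0 + n)%nat).
      assert (Px : forall j, 1 <= x ^ j) by (intros; apply pow_R1_Rle; lra).
      split; [apply Rmult_le_pos; [apply pow2_ge_0|lra]|].
      apply Rle_trans with ((x ^ k) ^ 2 * / x ^ (k + q + (k + q))).
      { apply Rmult_le_compat_l; auto. apply pow2_ge_0. }
      rewrite !pow_add. assert (Pk := Px k). assert (Pq := Px q).
      replace ((x ^ k) ^ 2 * / (x ^ k * x ^ q * (x ^ k * x ^ q))) with (/ x ^ q * / x ^ q) by (field; lra).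
      rewrite <- (Rmult_1_r (/ x ^ q)) at 3. apply Rmult_le_compat_l; [left; apply Rinv_0_lt_compat; lra|].
      rewrite <- Rinv_1. apply Rinv_le_contravar; lra.
    - now apply (ex_series_incr_n (K := R_AbsRing) (V := R_NormedModule) (fun n => / Cmod (t n) ^ q) n0). }
  assert (Sc : forall x p, in_L2 t mu p -> in_L2 t mu (fun z => x * p z)%C).
  { intros x p Hp. unfold in_L2. apply (ex_series_Rext (fun n => Cmod x ^ 2 * (Cmod (p (t n)) ^ 2 * mu n))).
    - intros n. rewrite Cmod_mult, Rpow_mult_distr. ring.
    - now apply ex_series_Rscal. }
  intros p (d & c & Hp). unfold in_L2.
  cut (in_L2 t mu (fun z => csum_n (fun k => c k * z ^ k)%C d)).
  { intros H. apply (ex_series_Rext (fun n => Cmod (csum_n (fun k => c k * t n ^ k)%C d) ^ 2 * mu n)); auto.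
    intros n. now rewrite <- Hp. }
  clear Hp p. induction d as [|d IH].
  - unfold in_L2. apply (ex_series_Rext (fun n => Cmod (c O * t n ^ 0) ^ 2 * mu n)); [|exact (Sc _ _ (Pw O))].
    intros n. now rewrite sum_O.
  - assert (Q := in_L2_minus t A mu hH _ _ IH (Sc (- c (S d))%C _ (Pw (S d)))). unfold in_L2 in *.
    eapply ex_series_Rext; [|exact Q]. intros n. cbv beta. rewrite sum_Sn.
    change (plus ?x ?y) with (x + y)%C. f_equal. f_equal. f_equal. ring.
Qed.

End Mass_decay.

(** * Orthogonal projection onto polynomials *)

Definition nrm2 (a : nat -> C) : R := Series (fun n => Cmod (a n) ^ 2).

Definition rdot (a b : nat -> C) : R := Series (fun n => fst (a n) * fst (b n) + snd (a n) * snd (b n)).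

Lemma Cmod_sqr (z : C) : Cmod z ^ 2 = fst z ^ 2 + snd z ^ 2.
Proof. apply Cmod2_alt. Qed.

Lemma l2_plus (a b : nat -> C) : l2 a -> l2 b -> l2 (fun n => a n + b n)%C.
Proof.
  intros Ha Hb. apply (l2_dom a _ (fun n => Cmod (b n)) 1); auto.
  intros n. rewrite Rmult_1_l. apply Cmod_triangle.
Qed.

Lemma l2_scal (k : C) (a : nat -> C) : l2 a -> l2 (fun n => k * a n)%C.
Proof.
  intros Ha. apply (ex_series_Rext (fun n => Cmod k ^ 2 * Cmod (a n) ^ 2)).
  - intros n. rewrite Cmod_mult, Rpow_mult_distr. auto.
  - now apply ex_series_Rscal.
Qed.

Lemma nrm2_nonneg (a : nat -> C) : l2 a -> 0 <= nrm2 a.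
Proof. intros H. apply Series_nonneg; auto. intros; apply pow2_ge_0. Qed.

Lemma nrm2_ext (a b : nat -> C) : (forall n, a n = b n) -> nrm2 a = nrm2 b.
Proof. intros H. apply Series_ext. intros n. now rewrite H. Qed.

Lemma nrm2_scal (k : C) (a : nat -> C) : nrm2 (fun n => k * a n)%C = Cmod k ^ 2 * nrm2 a.
Proof.
  unfold nrm2. rewrite <- Series_scal_l. apply Series_ext. intros n.
  now rewrite Cmod_mult, Rpow_mult_distr.
Qed.

Lemma nrm2_term (a : nat -> C) (n : nat) : l2 a -> Cmod (a n) ^ 2 <= nrm2 a.
Proof. intros H. apply (term_le_Series (fun n => Cmod (a n) ^ 2)); auto. intros; apply pow2_ge_0. Qed.

Lemma rdot_ex (a b : nat -> C) : l2 a -> l2 b ->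
  ex_series (fun n => fst (a n) * fst (b n) + snd (a n) * snd (b n)).
Proof.
  intros Ha Hb.
  apply (ex_series_le (K := R_AbsRing) (V := R_CompleteNormedModule) _ (fun n => Cmod (a n) ^ 2 + Cmod (b n) ^ 2)).
  - intros n. change (Rabs (fst (a n) * fst (b n) + snd (a n) * snd (b n)) <= Cmod (a n) ^ 2 + Cmod (b n) ^ 2).
    rewrite !Cmod_sqr.
    assert (Q1 := amgm (fst (a n)) (fst (b n))). assert (Q2 := amgm (snd (a n)) (snd (b n))).
    assert (Q3 := amgm (fst (a n)) (- fst (b n))). assert (Q4 := amgm (snd (a n)) (- snd (b n))).
    assert (S1 := pow2_ge_0 (fst (a n))). assert (S2 := pow2_ge_0 (fst (b n))).
    assert (S3 := pow2_ge_0 (snd (a n))). assert (S4 := pow2_ge_0 (snd (b n))).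
    apply Rabs_le. split; simpl in *; lra.
  - apply ex_series_Rplus; auto.
Qed.

Lemma nrm2_expand (a b : nat -> C) (s : R) : l2 a -> l2 b ->
  nrm2 (fun n => a n + RtoC s * b n)%C = nrm2 a + 2 * s * rdot a b + s ^ 2 * nrm2 b.
Proof.
  intros Ha Hb. unfold nrm2, rdot. rewrite <- !Series_scal_l.
  assert (Hr := rdot_ex a b Ha Hb).
  rewrite <- Series_plus, <- Series_plus; auto using ex_series_Rscal.
  - apply Series_ext. intros n. rewrite !Cmod_sqr. simpl. ring.
  - apply ex_series_Rplus; auto. now apply ex_series_Rscal.
Qed.

(** A substitute for the triangle inequality that stays with squared norms; [e] is sent to zero
    afterwards. *)
Lemma nrm2_plus_le (a b : nat -> C) (e : R) : l2 a -> l2 b -> 0 < e ->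
  nrm2 (fun n => a n + b n)%C <= (1 + e) * nrm2 a + (1 + / e) * nrm2 b.
Proof.
  intros Ha Hb He. unfold nrm2. rewrite <- !Series_scal_l, <- Series_plus by now apply ex_series_Rscal.
  apply Series_le; [|apply ex_series_Rplus; now apply ex_series_Rscal].
  intros n. split; [apply pow2_ge_0|]. rewrite !Cmod_sqr. simpl fst. simpl snd.
  assert (He' : 0 < / e) by now apply Rinv_0_lt_compat.
  assert (Q : forall x y, (x + y) ^ 2 <= (1 + e) * x ^ 2 + (1 + / e) * y ^ 2).
  { intros x y. replace ((1 + e) * x ^ 2 + (1 + / e) * y ^ 2) with ((x + y) ^ 2 + / e * (e * x - y) ^ 2) by (field; lra).
    assert (0 <= / e * (e * x - y) ^ 2) by (apply Rmult_le_pos; [lra|apply pow2_ge_0]). lra. }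
  assert (Q1 := Q (fst (a n)) (fst (b n))). assert (Q2 := Q (snd (a n)) (snd (b n))). lra.
Qed.

Lemma nrm2_parallelogram (a b : nat -> C) : l2 a -> l2 b ->
  nrm2 (fun n => a n - b n)%C + nrm2 (fun n => a n + b n)%C = 2 * nrm2 a + 2 * nrm2 b.
Proof.
  intros Ha Hb.
  assert (E1 := nrm2_expand a b 1 Ha Hb). assert (E2 := nrm2_expand a b (-1) Ha Hb).
  rewrite (nrm2_ext _ (fun n => a n + b n)%C) in E1 by (intros; ring).
  rewrite (nrm2_ext _ (fun n => a n - b n)%C) in E2.
  2:{ intros n. apply injective_projections; simpl; ring. }
  rewrite E1, E2. ring.
Qed.

(** Completeness of the sequence space. Squared distances of order [4^-j] give entrywise increments
    of order [2^-j], hence an entrywise limit; the norm bounds pass to it through partial sums. *)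
Lemma l2_limit (u : nat -> nat -> C) : (forall j, l2 (u j)) ->
  (forall i j, nrm2 (fun n => u i n - u j n)%C <= 2 * ((/ 4) ^ i + (/ 4) ^ j)) ->
  exists h, l2 h /\ forall j, nrm2 (fun n => u j n - h n)%C <= 4 * (/ 4) ^ j.
Proof.
  intros Hu Hd.
  assert (E4 : forall k, (/ 4) ^ k = ((/ 2) ^ k) ^ 2).
  { intros k. rewrite <- pow_mult, Nat.mul_comm, pow_mult. f_equal. lra. }
  assert (Hl2 : forall i j, l2 (fun n => u i n - u j n)%C).
  { intros i j. apply (ex_series_Rext (fun n => Cmod (u i n + - (1) * u j n)%C ^ 2)).
    - intros n. f_equal. f_equal. ring.
    - apply l2_plus; auto. now apply (l2_scal (- (1))). }
  assert (Inc : forall n k, Cmod (u (S k) n - u k n) <= 2 * (/ 2) ^ k).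
  { intros n k. assert (T := nrm2_term _ n (Hl2 (S k) k)). cbv beta in T. assert (D := Hd (S k) k).
    assert (P : 0 < (/ 4) ^ k) by (apply pow_lt; lra). simpl pow in D.
    assert (Q : Cmod (u (S k) n - u k n) ^ 2 <= (2 * (/ 2) ^ k) ^ 2).
    { rewrite Rpow_mult_distr, <- E4. simpl in *. lra. }
    apply Rsqr_incr_0_var; [now rewrite !Rsqr_pow2|]. apply Rmult_le_pos; [lra|apply pow_le; lra]. }
  assert (Lim : forall n, exists l, forall k, Cmod (u k n - l) <= 2 * 2 * (/ 2) ^ k).
  { intros n. apply (geom_limit (fun k => u k n)). intros k. apply Inc. }
  set (h := fun n => proj1_sig (constructive_indefinite_description _ (Lim n))).
  assert (Hh : forall k n, Cmod (u k n - h n) <= 4 * (/ 2) ^ k).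
  { intros k n. unfold h. destruct (constructive_indefinite_description _ (Lim n)) as [l Hl]. simpl.
    specialize (Hl k). lra. }
  assert (Part : forall j X, sum_n (fun n => Cmod (u j n - h n) ^ 2) X <= 4 * (/ 4) ^ j).
  { intros j X. apply le_epsilon. intros e He.
    assert (B : forall i, sum_n (fun n => Cmod (u j n - h n) ^ 2) X <= 4 * (/ 4) ^ j + (4 + 32 * INR (S X)) * (/ 2) ^ i).
    { intros i.
      assert (B1 : forall Y, sum_n (fun n => Cmod (u j n - h n) ^ 2) Y <=
        2 * sum_n (fun n => Cmod (u j n - u i n) ^ 2) Y + 32 * INR (S Y) * (/ 4) ^ i).
      { assert (T : forall n, Cmod (u j n - h n) ^ 2 <= 2 * Cmod (u j n - u i n) ^ 2 + 32 * (/ 4) ^ i).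
        { intros n. assert (T := Cmod_triangle (u j n - u i n) (u i n - h n)).
          replace (u j n - u i n + (u i n - h n))%C with (u j n - h n)%C in T by ring.
          assert (T2 := Hh i n). assert (Q := amgm (Cmod (u j n - u i n)) (Cmod (u i n - h n))).
          assert (T3 : Cmod (u i n - h n) ^ 2 <= 16 * (/ 4) ^ i).
          { rewrite E4. replace (16 * ((/ 2) ^ i) ^ 2) with ((4 * (/ 2) ^ i) ^ 2) by ring.
            apply pow_incr. split; auto. apply Cmod_ge_0. }
          assert (T4 : Cmod (u j n - h n) ^ 2 <= (Cmod (u j n - u i n) + Cmod (u i n - h n)) ^ 2).
          { apply pow_incr. split; auto. apply Cmod_ge_0. }
          simpl in *. lra. }
        induction Y as [|Y IH].
        - rewrite !sum_O. simpl INR. specialize (T O). lra.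
        - rewrite !sum_Sn. change plus with Rplus. rewrite (S_INR (S Y)). specialize (T (S Y)). lra. }
      specialize (B1 X). assert (B2 := sum_n_le_Series _ X (fun n => pow2_ge_0 _) (Hl2 j i)).
      assert (D := Hd j i). unfold nrm2 in D. cbv beta in B2.
      assert (P4 : (/ 4) ^ i <= (/ 2) ^ i) by (apply pow_incr; lra).
      assert (PX := pos_INR (S X)). nra. }
    destruct (half_pow_small (4 + 32 * INR (S X)) e He) as [i Hi]. specialize (B i). lra. }
  assert (Hj : forall j, ex_series (fun n => Cmod (u j n - h n) ^ 2)).
  { intros j. destruct (ex_finite_lim_seq_incr (sum_n (fun n => Cmod (u j n - h n) ^ 2)) (4 * (/ 4) ^ j)) as [l Hl].
    - intros n. rewrite sum_Sn. change plus with Rplus. assert (Q := pow2_ge_0 (Cmod (u j (S n) - h (S n)))). lra.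
    - intros n. apply Part.
    - exists l. exact Hl. }
  exists h. split.
  - apply (ex_series_Rext (fun n => Cmod (u O n + - (1) * (u O n - h n))%C ^ 2)).
    + intros n. f_equal. f_equal. ring.
    + apply l2_plus; auto. apply (l2_scal (- (1))). apply Hj.
  - intros j. unfold nrm2. assert (L := Series_correct _ (Hj j)).
    assert (L' : is_lim_seq (sum_n (fun n => Cmod (u j n - h n) ^ 2)) (Series (fun n => Cmod (u j n - h n) ^ 2))) by exact L.
    apply (is_lim_seq_le _ (fun _ => 4 * (/ 4) ^ j) (Finite (Series (fun n => Cmod (u j n - h n) ^ 2))) (Finite (4 * (/ 4) ^ j)) (Part j) L').
    apply is_lim_seq_const.
Qed.

Section Projection.

Variables (t : nat -> C) (A : C -> C) (mu : nat -> R).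
Hypothesis hH : CdB_data t A mu.
Hypothesis t_ge2 : forall n, 2 <= Cmod (t n).

(** The isometry from [L^2(mu)] onto the square summable sequences. *)
Definition vec (p : C -> C) (n : nat) : C := coef mu (fun n => p (t n)) n.

Lemma vec_sqr (p : C -> C) (n : nat) : Cmod (vec p n) ^ 2 = Cmod (p (t n)) ^ 2 * mu n.
Proof.
  unfold vec. rewrite Cmod_coef, Rpow_mult_distr, pow2_sqrt; auto.
  left. apply (CdB_mu_pos _ _ _ hH).
Qed.

Lemma vec_l2 (p : C -> C) : in_L2 t mu p -> l2 (vec p).
Proof. apply ex_series_Rext. intros n. now rewrite vec_sqr. Qed.

(** For a function [g] at positive distance from the polynomials, the differences [g - p] along a
    minimizing sequence are Cauchy by the parallelogram law. Their limit [h] still has minimal norm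
    among its translates by polynomials, hence is orthogonal to them, and it is nonzero because the
    distance is positive. *)
Lemma orthogonal_of_not_dense :
  subset_L2 t mu polynomial -> ~ dense_L2 t mu polynomial ->
  exists a, l2 a /\ (exists n, a n <> 0%C) /\ forall k, Csum (tpow t (coef mu a) k) = 0%C.
Proof.
  intros HS HD.
  assert (exists g eps, in_L2 t mu g /\ 0 < eps /\ forall p, polynomial p -> eps ^ 2 <= nrm2 (vec (fun z => g z - p z)%C))
    as (g & eps & Hg & He & Hge).
  { apply NNPP. intros N. apply HD. intros g eps Hg He. apply NNPP. intros N2. apply N.
    exists g, eps. split; [auto|]. split; [auto|]. intros p Hp. apply Rnot_lt_le. intros L. apply N2.
    exists p. split; [auto|]. split; [now apply HS|]. unfold L2_norm.
    rewrite <- (sqrt_pow2 eps) by lra. apply sqrt_lt_1_alt.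
    unfold nrm2 in L. rewrite (Series_ext _ (fun n => Cmod (g (t n) - p (t n)) ^ 2 * mu n)) in L.
    - split; auto. apply Series_nonneg.
      + intros n. apply Rmult_le_pos; [apply pow2_ge_0|left; apply (CdB_mu_pos _ _ _ hH)].
      + apply (in_L2_minus t A mu hH g p); auto.
    - intros n. apply vec_sqr. }
  assert (Lp : forall p, polynomial p -> l2 (vec (fun z => g z - p z)%C)).
  { intros p Hp. apply vec_l2. apply (in_L2_minus t A mu hH g p); auto. }
  set (V := fun p => nrm2 (vec (fun z => g z - p z)%C)) in *.
  (* [completeness] yields suprema, so the infimum of the squared distances is obtained after a
     change of sign. *)
  destruct (completeness (fun x => exists p, polynomial p /\ x = - V p)) as [d' [Ub Lb]].
  { exists 0. intros x (p & Hp & ->). assert (Q := nrm2_nonneg _ (Lp p Hp)). fold (V p) in Q. lra. }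
  { exists (- V (fun z => z ^ 0)%C). exists (fun z => z ^ 0)%C. split; auto. apply polynomial_pow. }
  set (d := - d').
  assert (Dle : forall p, polynomial p -> d <= V p).
  { intros p Hp. assert (Q := Ub (- V p) (ex_intro _ p (conj Hp eq_refl))). unfold d. lra. }
  assert (Dinf : forall e, 0 < e -> exists p, polynomial p /\ V p < d + e).
  { intros e Hpos. apply NNPP. intros N. assert (Q := Lb (d' - e)).
    assert (d' <= d' - e); [|lra]. apply Q. intros x (p & Hp & ->).
    assert (d + e <= V p); [|unfold d in *; lra]. apply Rnot_lt_le. intros L. apply N. eauto. }
  assert (Dpos : 0 < d).
  { assert (P2 : 0 < eps ^ 2) by (apply pow_lt; lra).
    assert (d' <= - eps ^ 2); [|unfold d; lra]. apply Lb. intros x (p & Hp & ->).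
    specialize (Hge p Hp). fold (V p) in Hge. lra. }
  assert (Hs : forall j : nat, exists p, polynomial p /\ V p < d + (/ 4) ^ j).
  { intros j. apply Dinf. apply pow_lt. lra. }
  set (pj := fun j => proj1_sig (constructive_indefinite_description _ (Hs j))).
  assert (Hpj : forall j, polynomial (pj j) /\ V (pj j) < d + (/ 4) ^ j).
  { intros j. unfold pj. destruct (constructive_indefinite_description _ (Hs j)) as [p Hp]. exact Hp. }
  set (u := fun j => vec (fun z => g z - pj j z)%C).
  assert (Hu : forall j, l2 (u j)) by (intros j; apply Lp, Hpj).
  destruct (l2_limit u Hu) as (h & Lh & Hh).
  { intros i j. assert (Pg := nrm2_parallelogram (u i) (u j) (Hu i) (Hu j)).
    destruct (Hpj i) as [Pi Vi]. destruct (Hpj j) as [Pj Vj].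
    set (m := fun z => (RtoC (/ 2) * pj i z + RtoC (/ 2) * pj j z)%C).
    assert (Pm : polynomial m) by (apply polynomial_plus; now apply polynomial_scal).
    assert (Em : nrm2 (fun n => u i n + u j n)%C = 4 * V m).
    { unfold V. replace 4 with (Cmod (RtoC 2) ^ 2) by (rewrite Cmod_R, Rabs_pos_eq; simpl; lra).
      rewrite <- nrm2_scal. apply nrm2_ext. intros n. unfold u, vec, coef, m.
      assert (H2 : (RtoC 2 * RtoC (/ 2))%C = RtoC 1) by (rewrite <- RtoC_mult; f_equal; field).
      transitivity ((RtoC 2 * g (t n) - (RtoC 2 * RtoC (/ 2)) * (pj i (t n) + pj j (t n))) * RtoC (sqrt (mu n)))%C; [|ring].
      rewrite H2. replace (RtoC 2) with (RtoC 1 + RtoC 1)%C by (rewrite <- RtoC_plus; f_equal; lra). ring. }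
    specialize (Dle m Pm). fold (V (pj i)) (V (pj j)) in Pg.
    change (nrm2 (u i)) with (V (pj i)) in Pg. change (nrm2 (u j)) with (V (pj j)) in Pg. lra. }
  assert (Small : forall e K, 0 < e -> exists j, K * (/ 4) ^ j < e).
  { intros e K Hpos. destruct (half_pow_small (Rabs K) e Hpos) as [j Hj]. exists j.
    assert (P4 : (/ 4) ^ j <= (/ 2) ^ j) by (apply pow_incr; lra).
    assert (P0 : 0 < (/ 4) ^ j) by (apply pow_lt; lra). assert (L := Rle_abs K). assert (L0 := Rabs_pos K). nra. }
  assert (Lj : forall j, l2 (fun n => u j n - h n)%C).
  { intros j. apply (ex_series_Rext (fun n => Cmod (u j n + - (1) * h n)%C ^ 2)).
    - intros n. f_equal. f_equal. ring.
    - apply l2_plus; auto. now apply (l2_scal (- (1))). }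
  assert (Nh : nrm2 h <= d).
  { assert (B : forall e, 0 < e -> nrm2 h <= (1 + e) * d).
    { intros e Hpos. apply le_epsilon. intros e' He'.
      destruct (Small e' ((1 + e) + (1 + / e) * 4) He') as [j Hj].
      assert (Q := nrm2_plus_le (u j) (fun n => - (1) * (u j n - h n))%C e (Hu j) (l2_scal _ _ (Lj j)) Hpos).
      rewrite nrm2_scal, Cmod_m1 in Q. 
      rewrite (nrm2_ext _ h) in Q by (intros n; ring).
      destruct (Hpj j) as [_ Vj]. change (V (pj j)) with (nrm2 (u j)) in Vj. specialize (Hh j).
      assert (He2 : 0 < / e) by now apply Rinv_0_lt_compat. nra. }
    apply le_epsilon. intros e Hpos. specialize (B (e / d) ltac:(now apply Rdiv_lt_0_compat)).
    replace ((1 + e / d) * d) with (d + e) in B by (field; lra). exact B. }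
  assert (Mh : forall p, polynomial p -> d <= nrm2 (fun n => h n + vec p n)%C).
  { intros p Hp. set (x := nrm2 (fun n => h n + vec p n)%C).
    assert (Lv : l2 (vec p)) by (apply vec_l2, HS, Hp).
    assert (Lhv := l2_plus _ _ Lh Lv).
    assert (Hx : 0 <= x) by now apply nrm2_nonneg.
    assert (B : forall e, 0 < e -> d <= (1 + e) * x).
    { intros e Hpos. apply le_epsilon. intros e' He'.
      destruct (Small e' ((1 + / e) * 4) He') as [j Hj].
      assert (Q := nrm2_plus_le (fun n => h n + vec p n)%C (fun n => u j n - h n)%C e Lhv (Lj j) Hpos).
      fold x in Q.
      destruct (Hpj j) as [Pj _].
      assert (Pq : polynomial (fun z => pj j z + - (1) * p z)%C).
      { apply polynomial_plus; auto. now apply polynomial_scal. }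
      specialize (Dle _ Pq). unfold V in Dle.
      rewrite (nrm2_ext _ (fun n => h n + vec p n + (u j n - h n))%C) in Dle.
      2:{ intros n. unfold u, vec, coef. ring. }
      specialize (Hh j). assert (He2 : 0 < / e) by now apply Rinv_0_lt_compat. nra. }
    apply le_epsilon. intros e Hpos. specialize (B (e / (x + 1)) ltac:(apply Rdiv_lt_0_compat; lra)).
    assert (e / (x + 1) * x <= e); [|lra].
    apply Rmult_le_reg_r with (x + 1); [lra|].
    replace (e / (x + 1) * x * (x + 1)) with (e * x) by (field; lra). nra. }
  assert (Orth : forall p, polynomial p -> rdot h (vec p) = 0).
  { intros p Hp. assert (Lv : l2 (vec p)) by (apply vec_l2, HS, Hp).
    assert (Q : forall s, 0 <= 2 * s * rdot h (vec p) + s ^ 2 * nrm2 (vec p)).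
    { intros s. assert (M := Mh _ (polynomial_scal (RtoC s) p Hp)).
      rewrite (nrm2_ext _ (fun n => h n + RtoC s * vec p n)%C) in M by (intros n; unfold vec, coef; ring).
      rewrite nrm2_expand in M by auto. lra. }
    set (x := rdot h (vec p)) in *. set (y := nrm2 (vec p)) in *.
    assert (Hy : 0 <= y) by now apply nrm2_nonneg.
    (* The minimizing parameter would be [- x / y]; the [+ 1] covers [y = 0]. *)
    specialize (Q (- x / (y + 1))).
    replace (2 * (- x / (y + 1)) * x + (- x / (y + 1)) ^ 2 * y) with (- (x ^ 2 * ((y + 2) / (y + 1) ^ 2))) in Q by (field; lra).
    assert (P : 0 < (y + 2) / (y + 1) ^ 2) by (apply Rdiv_lt_0_compat; [lra|apply pow_lt; lra]).
    apply NNPP. intros Nx. assert (0 < x ^ 2) by (apply pow2_gt_0; auto). nra. }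
  (* Conjugation turns the inner product into the bilinear pairing of the moments. As [rdot] is only
     its real part, the powers [z^k] give the real parts of the moments and [- Ci * z^k] the
     imaginary ones. *)
  exists (fun n => Cconj (h n)). split; [|split].
  - apply (ex_series_Rext (fun n => Cmod (h n) ^ 2)); auto. intros n. now rewrite Cmod_conj.
  - apply NNPP. intros N.
    assert (Z : forall n, h n = 0%C).
    { intros n. apply Cmod_eq_0. rewrite <- Cmod_conj. apply NNPP. intros N2. apply N. exists n.
      intros E. apply N2. rewrite E. apply Cmod_0. }
    assert (M := Mh (fun z => 0 * z ^ 0)%C (polynomial_scal 0 _ (polynomial_pow 0))).
    rewrite (nrm2_ext _ (fun n => 0 * h n)%C) in M.
    + rewrite nrm2_scal, Cmod_0 in M. simpl in M. lra.
    + intros n. unfold vec, coef. rewrite Z. ring.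
  - intros k.
    assert (O1 := Orth _ (polynomial_pow k)).
    assert (O2 := Orth _ (polynomial_scal (- Ci) _ (polynomial_pow k))).
    unfold Csum. apply injective_projections; cbn [fst snd RtoC].
    + eapply eq_trans; [|exact O1]. apply Series_ext. intros n. unfold tpow, vec, coef.
      generalize (t n ^ k)%C as x. intros x. unfold RtoC. simpl. ring.
    + eapply eq_trans; [|exact O2]. apply Series_ext. intros n. unfold tpow, vec, coef.
      generalize (t n ^ k)%C as x. intros x. unfold RtoC. simpl. ring.
Qed.

End Projection.

(** * Transforms with vanishing moments *)

Section Orthogonal.

Variables (t : nat -> C) (A : C -> C) (mu : nat -> R).
Hypothesis hH : CdB_data t A mu.
Hypothesis t_ge2 : forall n, 2 <= Cmod (t n).

Let t_inj := CdB_distinct _ _ _ hH.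
Let t_lim := CdB_infty _ _ _ hH.

Variables (c0 : R) (N : nat).
Hypothesis t_sep : separated t c0 N.

Variable r : nat -> R.
Hypothesis r_pos : forall n, 0 < r n.
Hypothesis r_disj : forall n m, n <> m -> forall z, ~ (Defs.disc (t n) (r n) z /\ Defs.disc (t m) (r m) z).
Hypothesis r_lim : is_lim_seq r 0.
Hypothesis r_loc : forall a, l2 a -> (exists n, a n <> 0%C) -> localized t (coef mu a) r.

Hypothesis poly_L2 : subset_L2 t mu polynomial.

Notation zeroa a := (zero_of t (coef mu a)).

Definition orth (a : nat -> C) : Prop :=
  l2 a /\ (exists n, a n <> 0%C) /\ forall k, Csum (tpow t (coef mu a) k) = 0%C.

Definition bounded_by (a : nat -> C) (P : nat) : Prop :=
  exists K, 0 <= K /\ forall n, Cmod (a n) <= K * / Cmod (t n) ^ P.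

Lemma inv_pow_pos (n k : nat) : 0 < / Cmod (t n) ^ k.
Proof. apply Rinv_0_lt_compat, pow_lt. specialize (t_ge2 n). lra. Qed.

Lemma inv_pow_mono (n j k : nat) : (j <= k)%nat -> / Cmod (t n) ^ k <= / Cmod (t n) ^ j.
Proof.
  intros H. assert (P := t_pow_ge1 t t_ge2 j n). apply Rinv_le_contravar; [lra|].
  now apply t_pow_mono.
Qed.

Lemma localized_zeros_in_discs (a : nat -> C) : l2 a -> (exists n, a n <> 0%C) ->
  exists n0, forall n, (n0 <= n)%nat -> exists z, Defs.disc (t n) (r n) z /\ zeroa a z /\
    forall z', Defs.disc (t n) (r n) z' -> zeroa a z' -> z = z'.
Proof.
  intros Ha Hn. destruct (r_loc a Ha Hn) as [_ [l Hl]]. exists (S (list_max l)).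
  intros n Hn'. assert (Nl : ~ In n l).
  { intros Hin. assert (Q := proj1 (list_max_le l (list_max l)) (le_n _)).
    rewrite Forall_forall in Q. specialize (Q n Hin). lia. }
  destruct (classic (exists! z, Defs.disc (t n) (r n) z /\ zeroa a z)) as [(z & [H1 H2] & U)|Ne].
  - exists z. auto.
  - destruct (Nl (Hl n Ne)).
Qed.

Lemma zero_at_t (a : nat -> C) (n : nat) : zeroa a (t n) -> a n = 0%C.
Proof.
  intros [[O _]|(j & E & Z)]; [now destruct (O n)|].
  apply (proj1 (coef_0 t A mu hH a j)) in Z. now rewrite (t_inj _ _ E).
Qed.

Lemma zero_in_T (n : nat) (z : C) : Defs.disc (t n) (r n) z ->
  (forall k, z <> t k) \/ z = t n.
Proof.
  intros D. destruct (classic (exists k, z = t k)) as [[k ->]|Nk].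
  - right. f_equal. now apply (disc_t t r r_pos r_disj).
  - left. intros k E. apply Nk. eauto.
Qed.

(** From [c' n * (t n - w) = c n], the moment of order [k + 1] of [c'] is that of order [k] of [c]
    plus [w] times that of order [k] of [c'], and the moment of order zero of [c'] is [- CT t c w],
    which vanishes. *)
Lemma orth_divide (a : nat -> C) (w : C) : orth a -> (forall n, w <> t n) -> CT t (coef mu a) w = 0%C ->
  orth (fun n => a n * ((0 * t n + 1) / (t n - w)))%C.
Proof.
  intros (La & [i0 Hi0] & Ma) Ow Zw.
  destruct (away_off t t_lim a w Ow) as (d & Hd & Aw).
  destruct (mobius_factor_bounded t a 0 1 w d Hd Aw) as (K & HK & Hb).
  assert (La' : l2 (fun n => a n * ((0 * t n + 1) / (t n - w)))%C).
  { apply (ex_series_dom _ (fun n => K ^ 2 * Cmod (a n) ^ 2)); [|now apply ex_series_Rscal].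
    intros n. split; [apply pow2_ge_0|]. rewrite <- Rpow_mult_distr. apply pow_incr.
    split; [apply Cmod_ge_0|apply Hb]. }
  assert (Nw : forall n, (t n - w)%C <> 0%C) by (intros n; apply Csub_neq0; auto).
  split; [exact La'|]. split.
  - exists i0. replace (0 * t i0 + 1)%C with (RtoC 1) by ring.
    apply Cmult_neq_0; auto. apply Cmult_neq_0; [apply C1_nz|]. now apply Cinv_neq_0.
  - set (c := coef mu a) in *. set (c' := coef mu (fun n => a n * ((0 * t n + 1) / (t n - w)))%C).
    assert (Rc : rapid t c) by now apply (coef_rapid t A mu hH).
    assert (Rc' : rapid t c') by now apply (coef_rapid t A mu hH).
    assert (E : forall n, (c' n * (t n - w))%C = c n).
    { intros n. unfold c', c, coef. field. auto. }
    induction k as [|k IH].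
    + transitivity (- (1) * CT t c w)%C; [|rewrite Zw; ring].
      unfold CT. rewrite <- Csum_scal.
      * apply Csum_ext. intros n. unfold tpow. rewrite <- E. simpl. field.
        intros Z. apply (Ow n). replace w with (w - t n + t n)%C by ring. rewrite Z. ring.
      * apply (summ_CT t t_ge2 c w d); auto; [now apply rapid_adm|].
        intros n. destruct (Aw n) as [Z|Z]; auto. left. unfold c, coef. rewrite Z. ring.
    + rewrite (Csum_ext _ (fun n => tpow t c k n + w * tpow t c' k n)%C).
      * rewrite Csum_plus, Csum_scal, IH; try (now apply rapid_summ); [|now apply summ_scal, rapid_summ].
        unfold c. rewrite Ma. ring.
      * intros n. unfold tpow. rewrite <- E. simpl. ring.
Qed.

Lemma t_prefix_bound (B : nat) : exists X, 0 <= X /\ forall n, (n < B)%nat -> Cmod (t n) <= X.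
Proof.
  induction B as [|k (X & HX & IH)]; [exists 0; split; [lra|lia]|].
  exists (X + Cmod (t k)). assert (Pk := Cmod_ge_0 (t k)). split; [lra|]. intros n Hn.
  destruct (Nat.eq_dec n k) as [->|Ne]; [lra|]. specialize (IH n ltac:(lia)). lra.
Qed.

(** Dividing out a zero off [T] gains one power of [1 / |t n|]. If there is no such zero,
    localization puts the zero of almost every disc at its centre, so almost all entries vanish and
    any power is available. *)
Lemma orth_bounded (P : nat) : (exists a, orth a) -> exists a, orth a /\ bounded_by a P.
Proof.
  intros [a0 H0]. induction P as [|P (a & Ha & K & HK & Hb)].
  - exists a0. split; auto. destruct H0 as (La & _). set (S := nrm2 a0).
    assert (HS : 0 <= S) by now apply nrm2_nonneg.
    exists (1 + S). split; [lra|]. intros n. simpl. rewrite Rinv_1, Rmult_1_r.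
    assert (T := nrm2_term a0 n La). fold S in T. assert (Pn := Cmod_ge_0 (a0 n)). simpl in T. nra.
  - destruct (classic (exists w, (forall n, w <> t n) /\ CT t (coef mu a) w = 0%C)) as [(w & Ow & Zw)|Nw].
    + exists (fun n => a n * ((0 * t n + 1) / (t n - w)))%C. split; [now apply orth_divide|].
      destruct (t_dist_pos t t_lim w (fun _ => True)) as (d & Hd & Dw); [auto|].
      assert (Pw : 0 <= Cmod w / d) by (apply Rmult_le_pos; [apply Cmod_ge_0|left; now apply Rinv_0_lt_compat]).
      exists (K * (1 + Cmod w / d)). split; [apply Rmult_le_pos; lra|].
      intros n. specialize (Dw n I). rewrite Cmod_sub_sym in Dw.
      assert (Nn : (t n - w)%C <> 0%C) by (apply Cmod_gt_0; lra).
      replace (0 * t n + 1)%C with (RtoC 1) by ring.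
      rewrite Cmod_mult, Cmod_div, Cmod_1 by auto. assert (Tn := t_ge2 n).
      assert (B : 1 / Cmod (t n - w) <= (1 + Cmod w / d) * / Cmod (t n)).
      { apply Rmult_le_reg_r with (Cmod (t n) * Cmod (t n - w)); [apply Rmult_lt_0_compat; lra|].
        replace (1 / Cmod (t n - w) * (Cmod (t n) * Cmod (t n - w))) with (Cmod (t n)) by (field; lra).
        replace ((1 + Cmod w / d) * / Cmod (t n) * (Cmod (t n) * Cmod (t n - w)))
          with (Cmod (t n - w) + Cmod w / d * Cmod (t n - w)) by (field; lra).
        assert (T := Cmod_triangle_rev (t n) w).
        assert (Cmod w <= Cmod w / d * Cmod (t n - w)); [|lra].
        replace (Cmod w) with (Cmod w / d * d) at 1 by (field; lra). now apply Rmult_le_compat_l. }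
      simpl pow. rewrite Rinv_mult.
      replace (K * (1 + Cmod w / d) * (/ Cmod (t n) * / Cmod (t n) ^ P)) with
        (K * / Cmod (t n) ^ P * ((1 + Cmod w / d) * / Cmod (t n))) by ring.
      apply Rmult_le_compat; auto; [apply Cmod_ge_0|].
      left. apply Rdiv_lt_0_compat; lra.
    + exists a. split; auto.
      destruct (localized_zeros_in_discs a (proj1 Ha) (proj1 (proj2 Ha))) as [n0 Hn0].
      assert (Fin : forall n, (n0 <= n)%nat -> a n = 0%C).
      { intros n Hn. destruct (Hn0 n Hn) as (z & Dz & Zz & _).
        destruct (zero_in_T n z Dz) as [O| ->]; [|now apply zero_at_t].
        exfalso. apply Nw. exists z. split; auto. destruct Zz as [[_ Z]|(j & E & _)]; auto. now destruct (O j). }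
      destruct (t_prefix_bound n0) as (X & HX & Hm). exists (K * X). split; [now apply Rmult_le_pos|].
      intros n. destruct (Nat.lt_ge_cases n n0) as [L|L].
      * eapply Rle_trans; [apply Hb|]. simpl pow. rewrite Rinv_mult. assert (Tn := t_ge2 n).
        rewrite Rmult_assoc. apply Rmult_le_compat_l; auto.
        rewrite <- Rmult_assoc. rewrite <- (Rmult_1_l (/ Cmod (t n) ^ P)) at 1.
        apply Rmult_le_compat_r; [left; apply inv_pow_pos|].
        apply Rmult_le_reg_r with (Cmod (t n)); [lra|]. rewrite Rmult_assoc, Rinv_l by lra.
        specialize (Hm n L). lra.
      * rewrite Fin, Cmod_0 by auto. apply Rmult_le_pos; [now apply Rmult_le_pos|]. left. apply inv_pow_pos.
Qed.

(** * Moving the zeros of a transform between discs *)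

Lemma mover_zero (w w' : C) : w' <> 0%C -> mover w w' w' = 0%C.
Proof.
  intros H. unfold mover. replace (w / w' * w' + - w)%C with (RtoC 0) by (field; auto).
  unfold Cdiv. ring.
Qed.

Lemma moved_CT (a : nat -> C) (w w' z : C) : l2 a -> (forall n, w <> t n) -> CT t (coef mu a) w = 0%C ->
  (forall n, z <> t n) -> z <> w ->
  CT t (coef mu (fun n => a n * mover w w' (t n))%C) z = (mover w w' z * CT t (coef mu a) z)%C.
Proof.
  intros La Ow Zw Oz Nz. assert (Hc := coef_adm t A mu hH t_ge2 a La).
  destruct (away_off t t_lim (coef mu a) w Ow) as (d & Hd & Aw).
  destruct (away_off t t_lim (coef mu a) z Oz) as (e & He & Az).
  rewrite (CT_ext t _ (fun n => coef mu a n * ((w / w' * t n + - w) / (t n - w)))%C).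
  - rewrite (CT_mobius t t_ge2 (coef mu a) (w / w') (- w) z w e d) by auto. rewrite Zw.
    unfold mover. ring.
  - intros n. unfold coef, mover. ring.
Qed.

Lemma moved_zero (a : nat -> C) (w w' z : C) : l2 a -> (forall n, w <> t n) -> zeroa a w ->
  z <> w -> zeroa a z -> zeroa (fun n => a n * mover w w' (t n))%C z.
Proof.
  intros La Ow Zw Nz Zz.
  assert (Zw' : CT t (coef mu a) w = 0%C) by (destruct Zw as [[_ Z]|(j & E & _)]; auto; now destruct (Ow j)).
  destruct Zz as [[O Z]|(j & -> & Z)].
  - left. split; auto. rewrite moved_CT by auto. rewrite Z. ring.
  - right. exists j. split; auto. apply (proj1 (coef_0 t A mu hH a j)) in Z.
    unfold coef. rewrite Z. ring.
Qed.

Lemma moved_zero_new (a : nat -> C) (w w' : C) : l2 a -> (forall n, w <> t n) -> zeroa a w ->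
  w' <> w -> w' <> 0%C -> zeroa (fun n => a n * mover w w' (t n))%C w'.
Proof.
  intros La Ow Zw Nw W0.
  assert (Zw' : CT t (coef mu a) w = 0%C) by (destruct Zw as [[_ Z]|(j & E & _)]; auto; now destruct (Ow j)).
  destruct (classic (exists j, w' = t j)) as [[j E]|O].
  - right. exists j. split; auto. unfold coef. rewrite <- E, mover_zero by auto. ring.
  - assert (Ow' : forall n, w' <> t n) by (intros n E; apply O; eauto).
    left. split; auto. rewrite moved_CT by auto. rewrite mover_zero by auto. ring.
Qed.

Variable q : nat.
Hypothesis q_ge1 : (1 <= q)%nat.
Hypothesis q_sum : ex_series (fun n => / Cmod (t n) ^ q).

Section Swap.

Variables (a : nat -> C) (z : nat -> C) (n1 : nat) (C1 : R).
Hypothesis a_l2 : l2 a.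
Hypothesis a_nz : exists n, a n <> 0%C.
Hypothesis z_disc : forall n, (n1 <= n)%nat -> Defs.disc (t n) (r n) (z n).
Hypothesis z_zero : forall n, (n1 <= n)%nat -> zeroa a (z n).
Hypothesis a_small : forall i, Cmod (a i) <= C1 * (weight t q i * / Cmod (t i)).

Lemma disc_neq (n m : nat) (x y : C) : n <> m -> Defs.disc (t n) (r n) x -> Defs.disc (t m) (r m) y -> x <> y.
Proof. intros Hnm Hx Hy ->. apply (r_disj n m Hnm y). auto. Qed.

(** Moving [z n] into disc [m] gives this disc two zeros, [w'] and [z m]. With such moves available
    arbitrarily far out, and bounded on the coefficients uniformly over the moves, the construction
    can be repeated indefinitely. *)
Lemma swap_hump :
  (forall B, exists n m w', (B <= n)%nat /\ (B <= m)%nat /\ n <> m /\ (forall k, z n <> t k) /\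
     Defs.disc (t m) (r m) w' /\ w' <> z m /\
     forall i, Cmod (a i * mover (z n) w' (t i)) <= C1 * (weight t q i * / Cmod (t i))) -> False.
Proof.
  intros H.
  (* Besides keeping the later [z n] as zeros, the invariant says that the current sequence is [a]
     times a bounded factor, so that the uniform bound assumed for [a] transfers to it. *)
  apply (sliding_hump t A mu hH t_ge2 r r_loc (weight t q) (weight_pos t t_ge2 q) (weight_l2 t t_ge2 q q_sum)
    (fun s => (n1 <= snd s)%nat /\ (forall n, (snd s <= n)%nat -> zeroa (fst s) (z n)) /\
       exists K, 0 <= K /\ forall i, exists k, fst s i = (a i * k)%C /\ Cmod k <= K)
    (a, n1)); auto.
  2:{ simpl. split; [lia|]. split; [auto|]. exists 1. split; [lra|]. intros i. exists 1%C.
      rewrite Cmod_1. split; [ring|lra]. }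
  intros [a1 b] eps. simpl fst. simpl snd. intros (Hb & Hz & K & HK & Hk) He.
  assert (L1 : l2 a1).
  { apply (ex_series_dom _ (fun n => K ^ 2 * Cmod (a n) ^ 2)); [|now apply ex_series_Rscal].
    intros n. split; [apply pow2_ge_0|]. rewrite <- Rpow_mult_distr. apply pow_incr.
    split; [apply Cmod_ge_0|]. destruct (Hk n) as (k & E & Bk). rewrite E.
    rewrite Cmod_mult, Rmult_comm. apply Rmult_le_compat_r; auto. apply Cmod_ge_0. }
  (* Beyond [i1] the spare factor [1 / |t i|] in the bounds makes the change small for every
     admissible move; the finitely many earlier indices are handled by taking [w] and [w'] far
     out. *)
  destruct (t_eventually t t_lim (2 * K * C1 / eps)) as [i1 Hi1].
  destruct (mover_prefix t a1 (weight t q) i1 eps t_ge2 (weight_pos t t_ge2 q) He) as (X & HX & Hpre).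
  destruct (r_eventually_small r r_lim) as [n2 Hn2].
  destruct (t_eventually t t_lim (X + 1)) as [n3 Hn3].
  destruct (H (b + n2 + n3)%nat) as (n & m & w' & Hn & Hm & Hnm & On & Dw' & Nw' & Hw).
  set (w := z n) in *.
  assert (Dw : Defs.disc (t n) (r n) w) by (apply z_disc; lia).
  assert (Big : forall j x, (b + n2 + n3 <= j)%nat -> Defs.disc (t j) (r j) x -> X <= Cmod x).
  { intros j x Hj Dx. assert (A1 := Hn2 j ltac:(lia)). assert (A2 := Hn3 j ltac:(lia)).
    unfold Defs.disc in Dx. assert (T := Cmod_triangle_rev (t j) x). rewrite Cmod_sub_sym in T. lra. }
  assert (Bw := Big n w Hn Dw). assert (Bw' := Big m w' Hm Dw').
  assert (W0 : w' <> 0%C) by (apply Cmod_gt_0; lra).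
  assert (Zw : zeroa a1 w) by (apply Hz; lia).
  exists (fun i => a1 i * mover w w' (t i), S (Nat.max n m))%C. simpl fst. simpl snd.
  split; [split; [lia|split]|].
  - intros j Hj. apply moved_zero; auto; [|apply Hz; lia].
    apply (disc_neq j n); [lia|apply z_disc; lia|exact Dw].
  - destruct (away_off t t_lim (fun _ => 1%C) w On) as (d & Hd & Aw).
    destruct (mobius_factor_bounded t (fun _ => 1%C) (w / w') (- w) w d Hd Aw) as (K2 & HK2 & Hb2).
    exists (K * K2). split; [now apply Rmult_le_pos|]. intros i.
    destruct (Hk i) as (k & E & Bk).
    exists (k * mover w w' (t i))%C. split; [rewrite E; ring|].
    rewrite Cmod_mult. apply Rmult_le_compat; auto; try apply Cmod_ge_0.
    specialize (Hb2 i). rewrite Cmult_1_l, Cmod_1, Rmult_1_r in Hb2. exact Hb2.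
  - exists m, w', (z m). simpl fst. simpl snd. split; [lia|]. split; [auto|]. split; [auto|].
    split; [apply z_disc; lia|]. split; [|split; [|split]].
    + apply moved_zero_new; auto. apply (disc_neq m n); auto.
    + apply moved_zero; auto; [|apply Hz; lia].
      apply (disc_neq m n); auto. apply z_disc; lia.
    + intros i. destruct (Nat.lt_ge_cases i i1) as [L|L]; [now apply Hpre|].
      specialize (Hi1 i L). assert (Wi := weight_pos t t_ge2 q i). assert (Ti := t_ge2 i).
      destruct (Hk i) as (k & E & Bk). rewrite E.
      replace (a i * k * mover w w' (t i) - a i * k)%C with (k * (a i * mover w w' (t i) - a i))%C by ring.
      rewrite Cmod_mult.
      apply Rle_trans with (K * (2 * (C1 * (weight t q i * / Cmod (t i))))).
      { apply Rmult_le_compat; auto; try apply Cmod_ge_0.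
        eapply Rle_trans; [apply Cmod_triangle_sub|]. specialize (Hw i). specialize (a_small i). lra. }
      replace (K * (2 * (C1 * (weight t q i * / Cmod (t i))))) with
        (2 * K * C1 / eps * / Cmod (t i) * (eps * weight t q i)) by (field; lra).
      rewrite <- (Rmult_1_l (eps * weight t q i)) at 2. apply Rmult_le_compat_r.
      { left. now apply Rmult_lt_0_compat. }
      apply Rmult_le_reg_r with (Cmod (t i)); [lra|]. rewrite Rmult_assoc, Rinv_l by lra. lra.
    + intros k x Hkb Dx Zx. apply moved_zero; auto. apply (disc_neq k n); auto. lia.
Qed.

End Swap.

(** Written as [w (s / w' - 1) / (s - w)], with [|w| <= |s - w| + |s|], the factor costs two powers
    of [|s|], provided [a] also pays for the denominator [s - w]. The bound depends on neither [w]
    nor [w']. *)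
Lemma mover_bound (a w w' s : C) (K : R) (L : nat) : 2 <= Cmod s -> 1 <= Cmod w' -> s <> w -> 0 <= K ->
  Cmod a <= K * / Cmod s ^ (S (S L)) -> Cmod a <= K * / Cmod s ^ (S (S L)) * Cmod (s - w) ->
  Cmod (a * mover w w' s) <= 4 * K * / Cmod s ^ L.
Proof.
  intros Hs Hw' Hsw HK H1 H2. assert (Np := Cmod_sub_pos _ _ Hsw). assert (Nsw := Csub_neq0 _ _ Hsw).
  assert (W0 : w' <> 0%C) by (apply Cmod_gt_0; lra).
  set (x := Cmod s) in *. set (B := K * / x ^ S (S L)) in *.
  assert (PB : 0 <= B).
  { unfold B. apply Rmult_le_pos; auto. left. apply Rinv_0_lt_compat, pow_lt. lra. }
  assert (M : Cmod (mover w w' s) <= 2 * x * (1 + x * / Cmod (s - w))).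
  { unfold mover. rewrite Cmod_div by auto.
    replace (w / w' * s + - w)%C with (w * (s / w' - 1))%C by (field; auto).
    rewrite Cmod_mult.
    assert (B1 : Cmod (s / w' - 1) <= 2 * x).
    { eapply Rle_trans; [apply Cmod_triangle_sub|]. rewrite Cmod_1, Cmod_div by auto. fold x.
      assert (x / Cmod w' <= x).
      { unfold Rdiv. rewrite <- (Rmult_1_r x) at 2. apply Rmult_le_compat_l; [lra|].
        rewrite <- Rinv_1. apply Rinv_le_contravar; lra. }
      lra. }
    assert (B2 : Cmod w <= Cmod (s - w) + x).
    { assert (T := Cmod_triangle_rev w s). rewrite Cmod_sub_sym in T. fold x in T. lra. }
    apply Rmult_le_reg_r with (Cmod (s - w)); auto.
    unfold Rdiv. rewrite Rmult_assoc, Rinv_l, Rmult_1_r by lra.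
    replace (2 * x * (1 + x * / Cmod (s - w)) * Cmod (s - w)) with ((Cmod (s - w) + x) * (2 * x)) by (field; lra).
    apply Rmult_le_compat; auto; apply Cmod_ge_0. }
  rewrite Cmod_mult.
  apply Rle_trans with (Cmod a * (2 * x * (1 + x * / Cmod (s - w)))).
  { apply Rmult_le_compat_l; auto. apply Cmod_ge_0. }
  assert (D : Cmod a * / Cmod (s - w) <= B).
  { apply Rmult_le_reg_r with (Cmod (s - w)); auto. rewrite Rmult_assoc, Rinv_l by lra. lra. }
  replace (Cmod a * (2 * x * (1 + x * / Cmod (s - w)))) with (2 * x * (Cmod a + x * (Cmod a * / Cmod (s - w)))) by ring.
  apply Rle_trans with (2 * x * (x * B + x * B)).
  { apply Rmult_le_compat_l; [lra|]. assert (Cmod a <= x * B) by nra.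
    assert (x * (Cmod a * / Cmod (s - w)) <= x * B) by (apply Rmult_le_compat_l; lra). lra. }
  right. unfold B. simpl pow. field. split; [|lra]. apply pow_nonzero. lra.
Qed.

Lemma other_point_in_disc (n : nat) (x : C) : exists y, Defs.disc (t n) (r n) y /\ y <> x.
Proof.
  destruct (classic (t n = x)) as [E|Ne].
  - exists (t n + RtoC (r n / 2))%C. assert (P := r_pos n). split.
    + unfold Defs.disc. replace (t n + RtoC (r n / 2) - t n)%C with (RtoC (r n / 2)) by ring.
      rewrite Cmod_R, Rabs_pos_eq; lra.
    + intros E'. assert (Z : RtoC (r n / 2) = 0%C).
      { transitivity (x - t n)%C; [rewrite <- E'; ring|rewrite E; ring]. }
      apply RtoC_inj in Z. lra.
  - exists (t n). split; auto. unfold Defs.disc. rewrite Cmod_self_sub. apply r_pos.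
Qed.

Section Rapid_zeros.

Variables (a : nat -> C) (z : nat -> C) (n1 : nat) (K : R).
Hypothesis a_orth : orth a.
Hypothesis z_disc : forall n, (n1 <= n)%nat -> Defs.disc (t n) (r n) (z n).
Hypothesis z_zero : forall n, (n1 <= n)%nat -> zeroa a (z n).
Hypothesis K_nonneg : 0 <= K.
Hypothesis a_bound : forall n, Cmod (a n) <= K * / Cmod (t n) ^ (q + 3 + N + q).

(** The left-hand side is the gap within which [z n] will be found. The power [q + 3] is what a move
    needs: two powers are lost, and the weight [|t n|^-q] with one spare power must remain. The
    other [N + q] powers make the gap smaller than the separation and summable after multiplication
    by [|t n|^N]. *)
Lemma gap_bound (n : nat) : Cmod (a n) * Cmod (t n) ^ (q + 3) <= K * / Cmod (t n) ^ (N + q).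
Proof.
  assert (P := t_pow_ge1 t t_ge2 (q + 3) n). assert (P2 := t_pow_ge1 t t_ge2 (N + q) n).
  eapply Rle_trans; [apply Rmult_le_compat_r; [|apply a_bound]; lra|].
  rewrite <- Nat.add_assoc, pow_add. right. field. lra.
Qed.

Lemma gap_le_half_sep (n : nat) : 2 * K / c0 <= Cmod (t n) ->
  Cmod (a n) * Cmod (t n) ^ (q + 3) <= c0 / 2 / Cmod (t n) ^ N.
Proof.
  intros H. destruct t_sep as (Hc & _). eapply Rle_trans; [apply gap_bound|].
  assert (P := t_pow_ge1 t t_ge2 N n). assert (P2 := t_pow_mono t t_ge2 1 q n q_ge1). rewrite pow_1 in P2.
  assert (G := t_ge2 n). rewrite pow_add, Rinv_mult.
  replace (K * (/ Cmod (t n) ^ N * / Cmod (t n) ^ q)) with (K * / Cmod (t n) ^ q * / Cmod (t n) ^ N) by ring.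
  apply Rmult_le_compat_r; [left; apply inv_pow_pos|].
  apply Rmult_le_reg_r with (Cmod (t n) ^ q); [lra|]. rewrite Rmult_assoc, Rinv_l by lra.
  apply Rle_trans with (c0 / 2 * (2 * K / c0)); [right; field; lra|].
  apply Rmult_le_compat_l; lra.
Qed.

(** If [z n] lies outside the gap around [t n] for infinitely many [n], these zeros can be moved.
    Either [z n] is outside the gap around every [t i], and then any target far out is admissible;
    or it lies in the gap around another [t m], and then the target [t m] annihilates the one
    dangerous entry, while separation protects the others. *)
Lemma zeros_rapidly_close : exists n2, (n1 <= n2)%nat /\
  forall n, (n2 <= n)%nat -> Cmod (z n - t n) <= Cmod (a n) * Cmod (t n) ^ (q + 3).
Proof.
  apply NNPP. intros NN. destruct t_sep as (Hc & _ & Hs).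
  assert (Hq : 0 <= 2 * K / c0) by (apply Rmult_le_pos; [lra|left; apply Rinv_0_lt_compat; lra]).
  (* One constant for all uses: [K] bounds the coefficients, 1 occurs when no gap contains [z n],
     and [2 K / c0] when one does. *)
  set (K3 := K + 1 + 2 * K / c0). assert (HK3 : 1 <= K3) by (unfold K3; lra).
  assert (EW : forall i, / Cmod (t i) ^ S q = weight t q i * / Cmod (t i)).
  { intros i. unfold weight. simpl pow. rewrite Rinv_mult. ring. }
  assert (Ab : forall i, Cmod (a i) <= K3 * / Cmod (t i) ^ S (S (S q))).
  { intros i. eapply Rle_trans; [apply a_bound|]. apply Rmult_le_compat; [auto|left; apply inv_pow_pos|unfold K3; lra|].
    apply inv_pow_mono. lia. }
  apply (swap_hump a z n1 (4 * K3) (proj1 a_orth) (proj1 (proj2 a_orth)) z_disc z_zero).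
  { intros i. rewrite <- EW. eapply Rle_trans; [apply Ab|].
    apply Rmult_le_compat; [lra|left; apply inv_pow_pos|lra|apply inv_pow_mono; lia]. }
  intros B. destruct (t_prefix_bound (B + n1)) as (X & HX & Hpre).
  destruct (r_eventually_small r r_lim) as [n2 Hn2].
  (* Gaps are at most [K], so a [t m] whose gap contains [z n] satisfies [|t m| > X + 2 K / c0]: its
     index is beyond the prefix and its gap at most half the separation. *)
  destruct (t_eventually t t_lim (X + 1 + K + 2 * K / c0)) as [n3 Hn3].
  assert (exists n, (B + n1 + n2 + n3 <= n)%nat /\ Cmod (a n) * Cmod (t n) ^ (q + 3) < Cmod (z n - t n)) as (n & Hn & Far).
  { apply NNPP. intros N'. apply NN. exists (B + n1 + n2 + n3)%nat. split; [lia|].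
    intros n Hn. apply Rnot_lt_le. intros L. apply N'. eauto. }
  assert (Gp : forall i, 0 <= Cmod (a i) * Cmod (t i) ^ (q + 3)).
  { intros i. apply Rmult_le_pos; [apply Cmod_ge_0|apply pow_le, Cmod_ge_0]. }
  assert (Dz := z_disc n ltac:(lia)).
  assert (Oz : forall k, z n <> t k).
  { destruct (zero_in_T n (z n) Dz) as [O|E]; auto. exfalso. rewrite E, Cmod_self_sub in Far.
    specialize (Gp n). lra. }
  assert (Hzn : X + K + 2 * K / c0 < Cmod (z n)).
  { assert (A1 := Hn2 n ltac:(lia)). assert (A2 := Hn3 n ltac:(lia)).
    unfold Defs.disc in Dz. assert (T := Cmod_triangle_rev (t n) (z n)). rewrite Cmod_sub_sym in T. lra. }
  (* In the first case the target is [t m] itself, where the factor vanishes; in the second, any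
     point of the next disc other than the zero already there. *)
  destruct (classic (exists m, m <> n /\ Cmod (z n - t m) <= Cmod (a m) * Cmod (t m) ^ (q + 3))) as [(m & Hmn & Near)|NoNear].
  - assert (Gm : Cmod (a m) * Cmod (t m) ^ (q + 3) <= K).
    { eapply Rle_trans; [apply gap_bound|]. rewrite <- (Rmult_1_r K) at 2. apply Rmult_le_compat_l; auto.
      rewrite <- Rinv_1. apply Rinv_le_contravar; [lra|]. apply t_pow_ge1; auto. }
    assert (Tm : X + 2 * K / c0 < Cmod (t m)).
    { assert (T := Cmod_triangle_rev (z n) (t m)). lra. }
    assert (Hm : (B + n1 <= m)%nat).
    { destruct (Nat.lt_ge_cases m (B + n1)) as [L|L]; auto. specialize (Hpre m L). lra. }
    exists n, m, (t m). split; [lia|]. split; [lia|]. split; [auto|]. split; [auto|].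
    split; [unfold Defs.disc; rewrite Cmod_self_sub; apply r_pos|]. split.
    (* If [t m] were already the zero of its disc, then [a m = 0], the gap would be empty and [z n]
       would equal [t m]. *)
    + intros E. assert (Zm := z_zero m ltac:(lia)). rewrite <- E in Zm. apply zero_at_t in Zm.
      rewrite Zm, Cmod_0, Rmult_0_l in Near. assert (P := Cmod_sub_pos _ _ (Oz m)). lra.
    + intros i. rewrite <- EW. destruct (Nat.eq_dec i m) as [->|Nim].
      { rewrite mover_zero, Cmult_0_r, Cmod_0.
        - apply Rmult_le_pos; [lra|left; apply inv_pow_pos].
        - apply Cmod_gt_0. assert (G := t_ge2 m). lra. }
      apply mover_bound; auto; [assert (G := t_ge2 m); lra|lra|].
      assert (S1 := Hs i m ltac:(auto)). assert (S2 := Hs m i Nim).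
      assert (Hf := gap_le_half_sep m ltac:(lra)).
      assert (D : c0 / 2 / Cmod (t i) ^ N <= Cmod (t i - z n)).
      { assert (T := Cmod_triangle_rev (t i - t m) (z n - t m)).
        replace (t i - t m - (z n - t m))%C with (t i - z n)%C in T by ring.
        rewrite (Cmod_sub_sym (t m)) in S2.
        replace (c0 / 2 / Cmod (t m) ^ N) with (c0 / Cmod (t m) ^ N / 2) in Hf
          by (field; assert (P := t_pow_ge1 t t_ge2 N m); lra).
        replace (c0 / 2 / Cmod (t i) ^ N) with (c0 / Cmod (t i) ^ N / 2)
          by (field; assert (P := t_pow_ge1 t t_ge2 N i); lra). lra. }
      eapply Rle_trans; [apply a_bound|].
      apply Rle_trans with (K * / Cmod (t i) ^ S (S (S q)) * / Cmod (t i) ^ N).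
      { rewrite Rmult_assoc. apply Rmult_le_compat_l; auto. rewrite <- Rinv_mult, <- pow_add.
        apply inv_pow_mono. lia. }
      apply Rle_trans with (K * / Cmod (t i) ^ S (S (S q)) * (2 / c0 * Cmod (t i - z n))).
      * apply Rmult_le_compat_l; [apply Rmult_le_pos; [auto|left; apply inv_pow_pos]|].
        apply Rle_trans with (2 / c0 * (c0 / 2 / Cmod (t i) ^ N)).
        -- right. field. split; [|lra]. assert (P := t_pow_ge1 t t_ge2 N i). lra.
        -- apply Rmult_le_compat_l; auto. apply Rmult_le_pos; [lra|left; apply Rinv_0_lt_compat; lra].
      * replace (K * / Cmod (t i) ^ S (S (S q)) * (2 / c0 * Cmod (t i - z n))) with
          (2 * K / c0 * / Cmod (t i) ^ S (S (S q)) * Cmod (t i - z n)) by (field; split; [lra|]; apply pow_nonzero; assert (G := t_ge2 i); lra).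
        apply Rmult_le_compat_r; [apply Cmod_ge_0|]. apply Rmult_le_compat_r; [left; apply inv_pow_pos|].
        unfold K3. lra.
  - destruct (other_point_in_disc (S n) (z (S n))) as (w' & Dw' & Nw').
    exists n, (S n), w'. split; [lia|]. split; [lia|]. split; [lia|]. split; [auto|]. split; [auto|]. split; [auto|].
    intros i. rewrite <- EW. apply mover_bound; auto; [|lra|].
    + assert (A1 := Hn2 (S n) ltac:(lia)). assert (G := t_ge2 (S n)).
      unfold Defs.disc in Dw'. assert (T := Cmod_triangle_rev (t (S n)) w'). rewrite Cmod_sub_sym in T. lra.
    + assert (L : Cmod (a i) * Cmod (t i) ^ (q + 3) <= Cmod (t i - z n)).
      { rewrite Cmod_sub_sym. destruct (Nat.eq_dec i n) as [->|Ne]; [lra|].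
        apply Rnot_lt_le. intros L. apply NoNear. exists i. split; auto. lra. }
      replace (q + 3)%nat with (S (S (S q))) in L by lia.
      assert (P := t_pow_ge1 t t_ge2 (S (S (S q))) i).
      apply Rle_trans with (/ Cmod (t i) ^ S (S (S q)) * Cmod (t i - z n)).
      * apply Rmult_le_reg_l with (Cmod (t i) ^ S (S (S q))); [lra|].
        rewrite <- Rmult_assoc, Rinv_r, Rmult_1_l by lra. lra.
      * apply Rmult_le_compat_r; [apply Cmod_ge_0|].
        rewrite <- (Rmult_1_l (/ Cmod (t i) ^ S (S (S q)))) at 1.
        apply Rmult_le_compat_r; [left; apply inv_pow_pos|lra].
Qed.

End Rapid_zeros.

End Orthogonal.

(** * Removing all the poles by convergent products *)

Fixpoint prod1p (x : nat -> R) (k : nat) : R :=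
  match k with O => 1 | S k => prod1p x k * (1 + x k) end.

Lemma prod1p_ge1 (x : nat -> R) (k : nat) : (forall n, 0 <= x n) -> 1 <= prod1p x k.
Proof. intros H. induction k as [|k IH]; simpl; [lra|]. specialize (H k). nra. Qed.

Lemma prod1p_le_exp (x : nat -> R) (k : nat) : (forall n, 0 <= x n) -> ex_series x ->
  prod1p x k <= exp (Series x).
Proof.
  intros H E.
  assert (B : prod1p x (S k) <= exp (sum_n x k)).
  { induction k as [|k IH].
    - rewrite sum_O. simpl. rewrite Rmult_1_l. apply exp_ineq1_le.
    - rewrite sum_Sn. change plus with Rplus. rewrite exp_plus.
      change (prod1p x (S (S k))) with (prod1p x (S k) * (1 + x (S k))).
      assert (P := prod1p_ge1 x (S k) H). specialize (H (S k)).
      apply Rmult_le_compat; [lra|lra|exact IH|]. apply exp_ineq1_le. }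
  assert (P := prod1p_ge1 x k H). assert (Hk := H k). simpl in B.
  apply Rle_trans with (exp (sum_n x k)); [nra|].
  destruct (sum_n_le_Series x k H E) as [L|L]; [left; now apply exp_increasing|right; now f_equal].
Qed.

Section Conclusion.

Variable t : nat -> C.
Hypothesis t_inj : forall n m, t n = t m -> n = m.
Hypothesis t_lim : is_lim_seq (fun n => Cmod (t n)) p_infty.
Hypothesis t_ge2 : forall n, 2 <= Cmod (t n).
Variables (c0 : R) (N : nat).
Hypothesis t_sep : separated t c0 N.

(** Multiplying the coefficients by [t n - s] multiplies the transform by [z - s], because the
    moment of order zero vanishes. So finitely many poles can be removed without spending any zeros,
    and the moments still vanish. *)
Lemma kill_prefix (c : nat -> C) (n3 : nat) : rapid t c -> (forall k, Csum (tpow t c k) = 0%C) ->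
  exists c2, rapid t c2 /\ (forall k, Csum (tpow t c2 k) = 0%C) /\ (forall n, (n < n3)%nat -> c2 n = 0%C) /\
    (forall n, c n = 0%C -> c2 n = 0%C) /\
    forall z, (forall n, z <> t n) -> (CT t c2 z = 0%C <-> CT t c z = 0%C).
Proof.
  intros Hc Hm. induction n3 as [|n3 (c2 & R2 & M2 & Z2 & Zc & E2)].
  { exists c. split; [auto|]. split; [auto|]. split; [lia|]. split; [auto|]. tauto. }
  set (s := t n3). set (c3 := fun n => (c2 n * (t n - s))%C).
  assert (Et : forall k n, tpow t c3 k n = (tpow t c2 (S k) n + (- s) * tpow t c2 k n)%C).
  { intros k n. unfold tpow, c3. simpl. ring. }
  exists c3. split; [|split; [|split; [|split]]].
  - intros k. apply (ex_series_dom _ (fun n => Cmod (c2 n) * Cmod (t n) ^ S k + Cmod s * (Cmod (c2 n) * Cmod (t n) ^ k))).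
    + intros n. assert (P := Cmod_ge_0 (c2 n)). assert (P2 : 0 <= Cmod (t n) ^ k) by apply pow_le, Cmod_ge_0.
      split; [apply Rmult_le_pos; auto; apply Cmod_ge_0|].
      unfold c3. rewrite Cmod_mult. assert (T := Cmod_triangle_sub (t n) s). simpl pow.
      replace (Cmod (c2 n) * (Cmod (t n) * Cmod (t n) ^ k) + Cmod s * (Cmod (c2 n) * Cmod (t n) ^ k))
        with (Cmod (c2 n) * (Cmod (t n) + Cmod s) * Cmod (t n) ^ k) by ring.
      apply Rmult_le_compat_r; auto. now apply Rmult_le_compat_l.
    + apply ex_series_Rplus; [apply R2|]. apply ex_series_Rscal, R2.
  - intros k. rewrite (Csum_ext _ _ (Et k)), Csum_plus, Csum_scal, !M2.
    + ring.
    + now apply rapid_summ.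
    + now apply rapid_summ.
    + now apply summ_scal, rapid_summ.
  - intros n Hn. unfold c3. destruct (Nat.eq_dec n n3) as [->|Ne]; [unfold s; ring|].
    rewrite Z2 by lia. ring.
  - intros n Hn. unfold c3. rewrite Zc by auto. ring.
  - intros z Oz. rewrite <- E2 by auto.
    destruct (away_off t t_lim c2 z Oz) as (d & Hd & Az).
    assert (A2 := rapid_adm t t_ge2 c2 R2).
    assert (E : CT t c3 z = ((z - s) * CT t c2 z)%C).
    { unfold CT. rewrite (Csum_ext _ (fun n => (z - s) * (c2 n / (z - t n)) + (- (1)) * tpow t c2 0 n)%C).
      - rewrite Csum_plus, !Csum_scal, M2.
        + ring.
        + now apply rapid_summ.
        + now apply (summ_CT t t_ge2 c2 z d).
        + apply summ_scal. now apply (summ_CT t t_ge2 c2 z d).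
        + now apply summ_scal, rapid_summ.
      - intros n. unfold c3, tpow. simpl. field. apply Csub_neq0, Oz. }
    rewrite E. split; intros Q; [|rewrite Q; ring].
    apply NNPP. intros Nq. apply (Cmult_neq_0 _ _ (Csub_neq0 _ _ (Oz n3)) Nq Q).
Qed.

(* Moving every zero [w k] onto the nearby pole [t (n3 + k)] removes all poles, while the
   transform changes only by a convergent product. *)
Lemma remove_tail (c : nat -> C) (n3 : nat) (w : nat -> C) (z : C) :
  adm t c -> (forall n, (n < n3)%nat -> c n = 0%C) ->
  (forall k, (w k = t (n3 + k)%nat /\ c (n3 + k)%nat = 0%C) \/ ((forall n, w k <> t n) /\ CT t c (w k) = 0%C)) ->
  (forall j k, j <> k -> w j <> w k) ->
  (forall k, Cmod (w k - t (n3 + k)%nat) <= c0 / 2 / Cmod (t (n3 + k)%nat) ^ N) ->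
  ex_series (fun k => Cmod (w k - t (n3 + k)%nat) * Cmod (t (n3 + k)%nat) ^ N) ->
  (forall n, z <> t n) -> CT t c z = 0%C.
Proof.
  intros Hc Hz Hw Hinj Hhalf Hsum Oz. destruct t_sep as (Hc0 & _ & Hs).
  destruct (t_dist_pos t t_lim z (fun _ => True)) as (d & Hd & Dz); [auto|].
  set (e := fun k => Cmod (w k - t (n3 + k)%nat)).
  assert (He : forall k, 0 <= e k) by (intros; apply Cmod_ge_0).
  (* The [k]-th move multiplies the coefficients by at most [1 + x k], since [w k] stays at least
     half the separation away from the other poles, and divides the value at [z] by at most
     [1 + y k], since [z] keeps distance [d] from [T]. *)
  set (x := fun k => 2 / c0 * (e k * Cmod (t (n3 + k)%nat) ^ N)). set (y := fun k => / d * e k).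
  assert (G0 : 0 < 2 / c0) by (apply Rdiv_lt_0_compat; lra). assert (Gd : 0 < / d) by now apply Rinv_0_lt_compat.
  assert (Hx : forall k, 0 <= x k).
  { intros k. assert (Q := t_pow_ge1 t t_ge2 N (n3 + k)). specialize (He k).
    unfold x. apply Rmult_le_pos; [lra|]. apply Rmult_le_pos; lra. }
  assert (Hy : forall k, 0 <= y k) by (intros k; specialize (He k); unfold y; apply Rmult_le_pos; lra).
  assert (Ex : ex_series x) by now apply ex_series_Rscal.
  assert (Ey : ex_series y).
  { apply ex_series_Rscal. eapply ex_series_dom; [|exact Hsum]. intros k. cbv beta. split; auto.
    assert (Q := t_pow_ge1 t t_ge2 N (n3 + k)). specialize (He k). fold (e k).
    rewrite <- (Rmult_1_r (e k)) at 1. apply Rmult_le_compat_l; auto. }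
  assert (Step : forall J, exists cJ, adm t cJ /\ (forall n, (n < n3 + J)%nat -> cJ n = 0%C) /\
    (forall n, Cmod (cJ n) <= prod1p x J * Cmod (c n)) /\
    (forall k, (J <= k)%nat -> (forall n, w k <> t n) -> CT t cJ (w k) = 0%C) /\
    Cmod (CT t c z) <= prod1p y J * Cmod (CT t cJ z)).
  { induction J as [|J (cJ & AJ & ZJ & BJ & NJ & CJ)].
    - exists c. split; [auto|]. split; [intros n Hn; apply Hz; lia|]. simpl. split; [intros; lra|]. split; [|lra].
      intros k _ Ok. destruct (Hw k) as [[E _]|[_ Z]]; auto. now destruct (Ok (n3 + k)%nat).
    - assert (PJx := prod1p_ge1 x J Hx). assert (PJy := prod1p_ge1 y J Hy).
      (* If the zero already sits at [t (n3 + J)], the pole is absent and nothing is moved. *)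
      destruct (Hw J) as [[Ew Zw]|[Ow _]].
      + exists cJ. split; [auto|]. split; [|split; [|split]].
        * intros n Hn. destruct (Nat.eq_dec n (n3 + J)) as [->|Ne]; [|apply ZJ; lia].
          apply Cmod_eq_0, Rle_antisym; [|apply Cmod_ge_0].
          eapply Rle_trans; [apply BJ|]. rewrite Zw, Cmod_0. lra.
        * intros n. eapply Rle_trans; [apply BJ|]. simpl. specialize (Hx J).
          apply Rmult_le_compat_r; [apply Cmod_ge_0|]. nra.
        * intros k Hk. apply NJ. lia.
        * eapply Rle_trans; [apply CJ|]. simpl. specialize (Hy J).
          apply Rmult_le_compat_r; [apply Cmod_ge_0|]. nra.
      + set (s := t (n3 + J)%nat). set (v := w J).
        assert (Zv : CT t cJ v = 0%C) by (apply NJ; auto).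
        destruct (away_off t t_lim cJ v Ow) as (dv & Hdv & Av).
        set (c' := fun n => (cJ n * ((1 * t n + - s) / (t n - v)))%C).
        assert (ECT : forall u, (forall n, u <> t n) -> u <> v ->
          CT t c' u = ((u - s) / (u - v) * CT t cJ u)%C).
        { intros u Ou Nu. destruct (away_off t t_lim cJ u Ou) as (du & Hdu & Au). unfold c'.
          rewrite (CT_mobius t t_ge2 cJ 1 (- s) u v du dv) by auto. rewrite Zv.
          replace (1 * u + - s)%C with (u - s)%C by ring. ring. }
        exists c'. split; [|split; [|split; [|split]]].
        * destruct (mobius_factor_bounded t cJ 1 (- s) v dv Hdv Av) as (K & _ & HK).
          now apply (adm_dom t t_ge2 cJ _ K).
        * intros n Hn. unfold c'. destruct (Nat.eq_dec n (n3 + J)) as [->|Ne].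
          -- unfold s, Cdiv. ring.
          -- rewrite ZJ by lia. ring.
        * intros n. simpl. unfold c'. destruct (Nat.eq_dec n (n3 + J)) as [->|Ne].
          { replace (1 * t (n3 + J)%nat + - s)%C with (RtoC 0) by (unfold s; ring).
            unfold Cdiv. rewrite Cmult_0_l, Cmult_0_r, Cmod_0. specialize (Hx J).
            apply Rmult_le_pos; [nra|apply Cmod_ge_0]. }
          assert (Nn : (t n - v)%C <> 0%C) by (apply Csub_neq0; auto).
          assert (Pn := proj1 (Cmod_gt_0 _) Nn).
          rewrite Cmod_mult.
          assert (F : Cmod ((1 * t n + - s) / (t n - v)) <= 1 + x J).
          { replace ((1 * t n + - s) / (t n - v))%C with (1 + (v - s) / (t n - v))%C by (field; auto).
            eapply Rle_trans; [apply Cmod_triangle|]. rewrite Cmod_1, Cmod_div by auto.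
            apply Rplus_le_compat_l. change (Cmod (v - s)) with (e J).
            assert (S1 := Hs (n3 + J)%nat n ltac:(auto)). fold s in S1.
            assert (Q := t_pow_ge1 t t_ge2 N (n3 + J)). fold s in Q.
            assert (H2 := Hhalf J). fold s v in H2.
            assert (T := Cmod_triangle_rev (s - t n) (s - v)).
            replace (s - t n - (s - v))%C with (- (t n - v))%C in T by ring. rewrite Cmod_opp in T.
            rewrite (Cmod_sub_sym s v) in T.
            assert (L : c0 / 2 / Cmod s ^ N <= Cmod (t n - v)).
            { replace (c0 / 2 / Cmod s ^ N) with (c0 / Cmod s ^ N / 2) in * by (field; lra). lra. }
            unfold x. fold s. unfold Rdiv at 1.
            replace (2 / c0 * (e J * Cmod s ^ N)) with (e J * / (c0 / 2 / Cmod s ^ N)) by (field; lra).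
            apply Rmult_le_compat_l; auto. apply Rinv_le_contravar; auto.
            apply Rdiv_lt_0_compat; lra. }
          rewrite Rmult_assoc, (Rmult_comm (1 + x J)), <- Rmult_assoc.
          apply Rmult_le_compat; auto; apply Cmod_ge_0.
        * intros k Hk Ok. rewrite ECT; auto.
          -- rewrite NJ by (auto; lia). ring.
          -- unfold v. apply Hinj. lia.
        * simpl. eapply Rle_trans; [apply CJ|]. rewrite Rmult_assoc. apply Rmult_le_compat_l; [lra|].
          (* At the zero being moved the factor has no value, but there the transform vanishes
             anyway. *)
          destruct (classic (z = v)) as [->|Nz].
          { rewrite Zv, Cmod_0. specialize (Hy J). apply Rmult_le_pos; [lra|apply Cmod_ge_0]. }
          rewrite ECT by auto.
          assert (Ns : (z - s)%C <> 0%C) by apply Csub_neq0, Oz.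
          assert (Nv : (z - v)%C <> 0%C) by now apply Csub_neq0.
          assert (Ps := Dz (n3 + J)%nat I). fold s in Ps. assert (Pv := proj1 (Cmod_gt_0 _) Nv).
          rewrite Cmod_mult, Cmod_div, <- Rmult_assoc by auto.
          rewrite <- (Rmult_1_l (Cmod (CT t cJ z))) at 1. apply Rmult_le_compat_r; [apply Cmod_ge_0|].
          apply Rmult_le_reg_r with (Cmod (z - v)); auto.
          replace ((1 + y J) * (Cmod (z - s) / Cmod (z - v)) * Cmod (z - v)) with (Cmod (z - s) + y J * Cmod (z - s)) by (field; lra).
          assert (T := Cmod_triangle_sub (z - s) (v - s)).
          replace (z - s - (v - s))%C with (z - v)%C in T by ring.
          change (Cmod (v - s)) with (e J) in T.
          assert (e J <= y J * Cmod (z - s)); [|lra].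
          unfold y. replace (e J) with (/ d * e J * d) at 1 by (field; lra).
          apply Rmult_le_compat_l; auto. apply (Hy J). }
  assert (Az : away t c z d) by (intros n; right; auto).
  assert (Sm := summ_CT t t_ge2 c z d Hc Hd Az).
  apply Cmod_eq_0, Rle_antisym; [|apply Cmod_ge_0]. apply le_epsilon. intros eps Heps. rewrite Rplus_0_l.
  set (X := exp (Series x)). set (Y := exp (Series y)).
  assert (PX : 0 < X) by apply exp_pos. assert (PY : 0 < Y) by apply exp_pos.
  (* After [J] moves every entry below [n3 + J] is zero and the others are at most [X] times the
     original ones. So [|CT t c z|] is at most [X * Y] times a tail of the original series. *)
  destruct (Series_tail (fun n => Cmod (c n / (z - t n))%C) (eps / (X * Y))) as [J HJ].
  { intros n. apply Cmod_ge_0. }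
  { exact Sm. }
  { apply Rdiv_lt_0_compat; auto. now apply Rmult_lt_0_compat. }
  destruct (Step J) as (cJ & AJ & ZJ & BJ & _ & CJ).
  assert (BX := prod1p_le_exp x J Hx Ex). assert (BY := prod1p_le_exp y J Hy Ey). fold X in BX. fold Y in BY.
  set (b := fun n => if Nat.ltb n J then 0 else Cmod (c n / (z - t n))%C).
  assert (Hb : Series b < eps / (X * Y)).
  { apply HJ.
    - intros n. unfold b. destruct (Nat.ltb n J); split; try lra; apply Cmod_ge_0.
    - intros n Hn. unfold b. destruct (Nat.ltb_spec n J); [auto|lia]. }
  assert (Eb : ex_series b).
  { eapply ex_series_dom; [|exact Sm]. intros n. unfold b. destruct (Nat.ltb n J); split; try lra; apply Cmod_ge_0. }
  assert (B1 : Cmod (CT t cJ z) <= X * Series b).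
  { rewrite <- Series_scal_l. apply Csum_dom; [|now apply ex_series_Rscal].
    intros n. unfold b. destruct (Nat.ltb_spec n J) as [L|L].
    - rewrite ZJ by lia. unfold Cdiv. rewrite Cmult_0_l, Cmod_0. lra.
    - assert (Nn : (z - t n)%C <> 0%C) by apply Csub_neq0, Oz.
      rewrite !Cmod_div by auto. unfold Rdiv. rewrite <- Rmult_assoc.
      apply Rmult_le_compat_r; [left; apply Rinv_0_lt_compat; now apply Cmod_gt_0|].
      eapply Rle_trans; [apply BJ|]. apply Rmult_le_compat_r; auto. apply Cmod_ge_0. }
  eapply Rle_trans; [apply CJ|]. apply Rle_trans with (Y * (X * Series b)).
  - apply Rmult_le_compat; auto; [|apply Cmod_ge_0]. assert (Q := prod1p_ge1 y J Hy). lra.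
  - apply Rle_trans with (Y * (X * (eps / (X * Y)))); [|right; field; lra].
    apply Rmult_le_compat_l; [lra|]. apply Rmult_le_compat_l; lra.
Qed.

End Conclusion.

(** The decay obtained by dividing out zeros makes the gaps between [z n] and [t n], times
    [|t n|^N], of order [|t n|^-q]; this is the summability that the infinite product requires. The
    finitely many poles without a nearby zero are removed by multiplication with a polynomial. *)
Lemma no_orth (t : nat -> C) (A : C -> C) (mu : nat -> R) (hH : CdB_data t A mu)
    (t_ge2 : forall n, 2 <= Cmod (t n)) (c0 : R) (N : nat) (t_sep : separated t c0 N) (r : nat -> R) (q : nat) :
  (forall n, 0 < r n) ->
  (forall n m, n <> m -> forall z, ~ (Defs.disc (t n) (r n) z /\ Defs.disc (t m) (r m) z)) ->
  is_lim_seq r 0 ->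
  (forall a, l2 a -> (exists n, a n <> 0%C) -> localized t (coef mu a) r) ->
  (1 <= q)%nat -> ex_series (fun n => / Cmod (t n) ^ q) ->
  subset_L2 t mu polynomial -> ~ exists a, orth t mu a.
Proof.
  intros r_pos r_disj r_lim r_loc q_ge1 q_sum HS Ho.
  assert (t_inj := CdB_distinct _ _ _ hH). assert (t_lim := CdB_infty _ _ _ hH).
  destruct (orth_bounded t A mu hH t_ge2 r r_pos r_disj r_loc HS (q + 3 + N + q) Ho) as (a & Oa & K & HK & Hb).
  destruct Oa as (La & Na & Ma).
  destruct (localized_zeros_in_discs t mu r r_loc a La Na) as [n1 Hn1].
  assert (Ch : forall n, exists z, (n1 <= n)%nat -> Defs.disc (t n) (r n) z /\ zero_of t (coef mu a) z).
  { intros n. destruct (Nat.lt_ge_cases n n1) as [L|L]; [exists 0%C; lia|].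
    destruct (Hn1 n L) as (z & D & Z & _). exists z. auto. }
  set (z := fun n => proj1_sig (constructive_indefinite_description _ (Ch n))).
  assert (Hz : forall n, (n1 <= n)%nat -> Defs.disc (t n) (r n) (z n) /\ zero_of t (coef mu a) (z n)).
  { intros n Hn. unfold z. destruct (constructive_indefinite_description _ (Ch n)) as [x Hx]. simpl. auto. }
  assert (Oa : orth t mu a) by (split; auto).
  destruct (zeros_rapidly_close t A mu hH t_ge2 c0 N t_sep r r_pos r_disj r_lim r_loc q q_ge1 q_sum a z n1 K Oa
    (fun n Hn => proj1 (Hz n Hn)) (fun n Hn => proj2 (Hz n Hn)) HK Hb) as (n2 & Hn12 & Hclose).
  (* From here on the gap is at most half the separation. *)
  destruct (t_eventually t t_lim (2 * K / c0)) as [n4 Hn4].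
  set (n3 := (n2 + n4)%nat).
  destruct t_sep as (Hc0 & HN & Hs).
  assert (Rc := coef_rapid t A mu hH a HS La).
  destruct (kill_prefix t t_lim t_ge2 (coef mu a) n3 Rc Ma) as (c2 & R2 & M2 & Z2 & Zc & E2).
  destruct Na as [i0 Hi0]. apply Hi0. apply (coef_0 t A mu hH).
  apply (CT_eq0 t t_inj t_lim t_ge2 (coef mu a)); [now apply rapid_adm|].
  intros u Ou. apply E2; auto.
  assert (Hgap : forall k, Cmod (z (n3 + k)%nat - t (n3 + k)%nat) <= K * / Cmod (t (n3 + k)%nat) ^ (N + q)).
  { intros k. eapply Rle_trans; [apply Hclose; unfold n3; lia|]. now apply gap_bound. }
  apply (remove_tail t t_lim t_ge2 c0 N (conj Hc0 (conj HN Hs)) c2 n3 (fun k => z (n3 + k)%nat) u); auto.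
  - now apply rapid_adm.
  - intros k. destruct (Hz (n3 + k)%nat ltac:(unfold n3; lia)) as [D Z].
    destruct (zero_in_T t r r_pos r_disj (n3 + k)%nat _ D) as [O|E].
    + right. split; auto. apply E2; auto. destruct Z as [[_ Z]|(j & E & _)]; auto. now destruct (O j).
    + left. split; auto. apply Zc. rewrite E in Z. destruct Z as [[O _]|(j & E' & Z)]; [now destruct (O (n3 + k)%nat)|].
      now rewrite (t_inj _ _ E').
  - intros j k Hjk. apply (disc_neq t r r_disj (n3 + j) (n3 + k)); [lia| |]; apply Hz; unfold n3; lia.
  - intros k. eapply Rle_trans; [apply Hclose; unfold n3; lia|].
    apply (gap_le_half_sep t t_ge2 c0 N (conj Hc0 (conj HN Hs)) q q_ge1 a K Hb).
    left. apply Hn4. unfold n3. lia.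
  - apply (ex_series_dom _ (fun k => K * / Cmod (t (n3 + k)%nat) ^ q)).
    + intros k. assert (P := t_pow_ge1 t t_ge2 N (n3 + k)). split.
      * apply Rmult_le_pos; [apply Cmod_ge_0|lra].
      * eapply Rle_trans; [apply Rmult_le_compat_r; [lra|apply Hgap]|].
        rewrite pow_add. right. assert (P2 := t_pow_ge1 t t_ge2 q (n3 + k)). field. lra.
    + apply ex_series_Rscal.
      now apply (ex_series_incr_n (K := R_AbsRing) (V := R_NormedModule) (fun n => / Cmod (t n) ^ q) n3).
Qed.

Theorem theorem1p2 (t : nat -> C) (A : C -> C) (mu : nat -> R)
    (hH : CdB_data t A mu)
    (hsep : power_separated t)
    (ht : forall n : nat, 2 <= Cmod (t n))
    (hord : finite_order A) :
  strong_localization t A mu <->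
  (subset_L2 t mu polynomial /\ dense_L2 t mu polynomial).
Proof.
  destruct (power_separated_nat t ht hsep) as (c0 & N & Hs).
  split.
  - intros HL. apply (strong_localization_coef t A mu hH ht) in HL.
    destruct HL as (r & r_pos & r_disj & r_lim & r_loc).
    destruct (t_pow_summable t ht c0 N Hs) as (q & Hq & Sq).
    assert (HS : subset_L2 t mu polynomial).
    { exact (localized_subset_L2 t A mu hH ht r r_pos r_disj r_lim r_loc q Sq). }
    split; auto. apply NNPP. intros ND.
    apply (no_orth t A mu hH ht c0 N Hs r q r_pos r_disj r_lim r_loc Hq Sq HS).
    exact (orthogonal_of_not_dense t A mu hH HS ND).
  - intros [HS HD]. exact (dense_strong_localization t A mu hH ht c0 N Hs HS HD).
Qed.
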